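(* Let $k$ be a positive integer, let $\alpha,\beta$ be two nonconstant inner functions and let $k\leq\dim K_\alpha$. Let $\varphi\in L^2$ be such that $U_{\varphi}^{\alpha,\beta}\in\mathcal{S}_k(\alpha,\beta)$. Then $$S^*_\beta U_{\varphi}^{\alpha,\beta}=U_{\varphi}^{\alpha,\beta}(S^*_\alpha)^k$$ if and only if $$\varphi\in\overline{\alpha H^2}+\overline{z}^{k-1}(W^*_k\beta)H^2+\overline{\left(\tfrac{\alpha}{\gcd(\alpha,W^*_k\beta)}K_{\gcd(\alpha,W^*_k\beta)}\right)}.$$
   Context: $L^2=L^2(\mathbb{T},m)$ with $m$ normalized Lebesgue measure on the unit circle $\mathbb{T}$; $H^2\subset L^2$ is the Hardy space of the unit disk and $H^\infty=H^2\cap L^\infty$. An inner function is $\alpha\in H^\infty$ with $|\alpha|=1$ a.e. on $\mathbb{T}$; $K_\alpha=H^2\ominus\alpha H^2$ (so $K_\alpha=\{0\}$ if $\alpha$ is constant), $P_\alpha$ is the orthogonal projection of $L^2$ onto $K_\alpha$, $K_\alpha^\infty=K_\alpha\cap H^\infty$ (dense in $K_\alpha$), and $S_\alpha f=P_\alpha(zf)$, $f\in K_\alpha$, is the compressed shift, with adjoint $S_\alpha^*$. $\gcd$ denotes the greatest common inner divisor. A bar over a set of functions denotes the set of complex conjugates. $W_k:L^2\to L^2$ is the bounded linear operator with $W_k(z^n)=z^{n/k}$ if $k\mid n$ and $W_k(z^n)=0$ otherwise ($n\in\mathbb{Z}$); its adjoint is $W_k^*g(z)=g(z^k)$, so $W_k^*\beta$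 is inner. For $\varphi\in L^2$ put $U_\varphi^{\alpha,\beta}f=P_\beta W_k(\varphi f)$, $f\in K_\alpha^\infty$. $\mathcal{S}_k(\alpha,\beta)$ is the set of all operators $U_\varphi^{\alpha,\beta}$, $\varphi\in L^2$, that extend boundedly to $K_\alpha$ (each identified with its bounded extension $K_\alpha\to K_\beta$). *)

(* Defs.v *)
From HB Require Import structures.
From mathcomp Require Import all_boot all_order all_algebra.
From mathcomp Require Import all_classical all_reals all_analysis.
From mathcomp Require Import complex.

Set Implicit Arguments.
Unset Strict Implicit.
Unset Printing Implicit Defensive.
Import Order.TTheory GRing.Theory Num.Theory.
Local Open Scope classical_set_scope.
Local Open Scope ring_scope.

(* A function on the unit circle T is represented by a function f : C -> C, of
   which only the values f (circ t), 0 <= t <= 1, matter.  Normalized Lebesgue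
   measure m on T is the image of Lebesgue measure on [0, 1] under circ.
   Elements of L^2(T) are functions, not classes; equality in L^2 is eqT, and
   an operator is a map on functions which is linear up to eqT. *)
Definition cfun (R : realType) : Type := R[i] -> R[i].

Section Circle.
Context {R : realType}.
Implicit Types (f g : cfun R) (A B : set (cfun R)) (T : cfun R -> cfun R).

Definition circ (t : R) : R[i] :=
  Complex (cos (2 * pi * t)) (sin (2 * pi * t)).

Definition unitI : set R := `[0, 1]%classic.

Definition eqT f g : Prop :=
  ae_eq lebesgue_measure unitI (f \o circ) (g \o circ).

Definition measurableT f : Prop :=
  measurable_fun unitI (fun t => complex.Re (f (circ t))) /\
  measurable_fun unitI (fun t => complex.Im (f (circ t))).

Definition intT f : R[i] :=
  Complex (\int[lebesgue_measure]_(t in unitI) complex.Re (f (circ t)))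
          (\int[lebesgue_measure]_(t in unitI) complex.Im (f (circ t))).

Definition L2 : set (cfun R) := [set f | measurableT f /\
  lebesgue_measure.-integrable unitI
    (fun t => (ComplexField.Normc.normc (f (circ t)) ^+ 2)%:E)].

Definition Linfty : set (cfun R) := [set f | measurableT f /\
  exists M : R, {ae lebesgue_measure, forall t, unitI t ->
    ComplexField.Normc.normc (f (circ t)) <= M}].

Definition innerp f g : R[i] := intT (fun z => f z * conjc (g z)).

Definition norm2 f : R := Num.sqrt
  (\int[lebesgue_measure]_(t in unitI)
     (ComplexField.Normc.normc (f (circ t)) ^+ 2)).

Definition fourier f (n : int) : R[i] := innerp f (fun z => z ^ n).

(* H^2 is identified with the space of its boundary functions. *)
Definition H2 : set (cfun R) :=
  [set f | L2 f /\ forall n : int, n < 0 -> fourier f n = 0].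

Definition Hinfty : set (cfun R) := H2 `&` Linfty.

Definition is_inner f : Prop := Hinfty f /\
  {ae lebesgue_measure, forall t, unitI t ->
    ComplexField.Normc.normc (f (circ t)) = 1}.

Definition nonconstant f : Prop := ~ exists c : R[i], eqT f (fun=> c).

Definition inner_dvd (d a : cfun R) : Prop :=
  is_inner d /\
  exists2 q : cfun R, is_inner q & eqT a (fun z => d z * q z).

(* The greatest common inner divisor is unique only up to a unimodular
   constant factor, hence a relation. *)
Definition is_gcd (a b d : cfun R) : Prop :=
  [/\ inner_dvd d a, inner_dvd d b &
      forall d', inner_dvd d' a -> inner_dvd d' b -> inner_dvd d' d].

Definition Kspace (a : cfun R) : set (cfun R) :=
  [set f | H2 f /\ forall h, H2 h -> innerp f (fun z => a z * h z) = 0].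

Definition Kinfty (a : cfun R) : set (cfun R) := Kspace a `&` Hinfty.

(* The value is independent of the representative of f, because xget picks
   from a set which only depends on the class of f; same for adjoint_on. *)
Definition orth_proj A f : cfun R := xget (fun=> 0)
  [set g | A g /\ forall h, A h -> innerp (fun z => f z - g z) h = 0].

Definition adjoint_on A T f : cfun R := xget (fun=> 0)
  [set g | A g /\ forall h, A h -> innerp (T h) f = innerp h g].

Definition bounded_linear A B T : Prop :=
  [/\ forall f, A f -> B (T f),
      forall (c : R[i]) f g, A f -> A g ->
        eqT (T (fun z => c * f z + g z)) (fun z => c * T f z + T g z) &
      exists M : R, forall f, A f -> norm2 (T f) <= M * norm2 f].

(* k <= dim A, with dim A possibly infinite *)
Definition dim_ge (k : nat) A : Prop := exists e : 'I_k -> cfun R,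
  (forall i, A (e i)) /\
  forall c : 'I_k -> R[i],
    eqT (fun z => \sum_(i < k) c i * e i z) (fun=> 0) -> forall i, c i = 0.

Definition cshift (a : cfun R) f : cfun R := orth_proj (Kspace a) (fun z => z * f z).

Definition cshift_adj (a : cfun R) : cfun R -> cfun R := adjoint_on (Kspace a) (cshift a).

(* W is the operator W_k; it is determined by these conditions up to eqT. *)
Definition is_W (k : nat) (W : cfun R -> cfun R) : Prop :=
  bounded_linear L2 L2 W /\
  forall n : int,
    eqT (W (fun z => z ^ n))
        (if (k %| n)%Z then fun z => z ^ (n %/ k)%Z else fun=> 0).

Definition Wadj (k : nat) g : cfun R := fun z => g (z ^+ k).

Definition Uop (W : cfun R -> cfun R) (b phi : cfun R) f : cfun R :=
  orth_proj (Kspace b) (W (fun z => phi z * f z)).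

(* U_phi^{a,b} belongs to S_k(a,b), and U is its bounded extension. *)
Definition bounded_extension (W : cfun R -> cfun R) (a b phi : cfun R)
    (U : cfun R -> cfun R) : Prop :=
  bounded_linear (Kspace a) (Kspace b) U /\
  forall f, Kinfty a f -> eqT (U f) (Uop W b phi f).

End Circle.

(* Main.v *)
(* Write p_f for the Taylor polynomial of f of degree less than k, and B, h^k for
   the functions beta(z^k), h(z^k). Since z h - <z h, beta> beta is the projection
   of z h onto K_beta, and S_alpha^* ^ k f = z^-k (f - p_f), the intertwining
   relation on the dense subspace K_alpha^oo says that
     <phi p_f, z^k h^k> = <phi f, B> <B, z^k h^k>
   for all f in K_alpha^oo and h in K_beta. As k <= dim K_alpha, the first k
   Taylor coefficients are linearly independent on K_alpha^oo; hence there are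
   constants c_j such that psi = phi - B sum_(j < k) c_j z^-j satisfies both
   <psi z^j, z^k h^k> = 0 for j < k, which means psi = z B g + conj m with g, m
   in H2, and <psi f, B> = 0, which means B m in alpha H2. Finally
   z B g + B sum c_j z^-j ranges over z^-(k-1) B H2, and Beurling's theorem shows
   that B m in alpha H2 amounts to m in (alpha / gamma) H2 =
   alpha H2 + (alpha / gamma) K_gamma. *)
Require Import Defs.
From HB Require Import structures.
From mathcomp Require Import all_boot all_order all_algebra.
From mathcomp Require Import all_classical all_reals all_analysis.
From mathcomp Require Import measurable_realfun complex.
From mathcomp Require Import ring lra.

Set Implicit Arguments.
Unset Strict Implicit.
Unset Printing Implicit Defensive.
Import Order.TTheory GRing.Theory Num.Theory.
Import numFieldNormedType.Exports.
Local Open Scope classical_set_scope.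
Local Open Scope ring_scope.

(* The unqualified name denotes the measurability of [setT]. *)
Local Notation measurable_circ := Defs.measurableT.

(** Since [phi] is only in L2, [phi f] is known to lie in L2 only for bounded [f]. Computations with
    the symbol therefore take place on [Kinfty], and their results reach [Kspace] because a closed
    subspace ([csub]) that contains the projections of all powers of z contains the whole model
    space. The constants c_j come from one test function: the backward shift h_0 of beta lies in
    K_beta, and <B, z^k h_0^k> is the squared norm of beta - beta(0), nonzero because beta is
    nonconstant. Dividing the relation for h_0 by this number gives <phi f, B> = sum f_j c_j.
    Inserted into the relation for an arbitrary h, this leaves a linear relation between the f_j,
    whose coefficients vanish one by one by independence. Both directions use the same two
    evaluations, of <B s f, B> and of <B s z^j, z^k h^k>, for functions s whose Fourier coefficients
    vanish at all n <= -k. Beurling's theorem dictates uniqueness of Fourier coefficients in L1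
    rather than L2: it is applied to |d|^2 - 1 with d merely in L2. *)

Section Circle.
Context {R : realType}.
Implicit Types (t : R) (z w : R[i]) (f g h u v : cfun R) (n m : int).
Local Notation mu := (@lebesgue_measure R).
Local Notation Re := complex.Re.
Local Notation Im := complex.Im.
Local Notation normc := ComplexField.Normc.normc.

(** * Null sets, complex numbers and points of the circle *)

Lemma aeS (P Q : R -> Prop) : (forall t, P t -> Q t) ->
  {ae mu, forall t, P t} -> {ae mu, forall t, Q t}.
Proof. exact: (@filterS _ _ (ae_filter_ringOfSetsType mu)). Qed.

Lemma aeS2 (P Q S : R -> Prop) : (forall t, P t -> Q t -> S t) ->
  {ae mu, forall t, P t} -> {ae mu, forall t, Q t} -> {ae mu, forall t, S t}.
Proof. exact: (@filterS2 _ _ (ae_filter_ringOfSetsType mu)). Qed.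

Lemma aeW (P : R -> Prop) : (forall t, P t) -> {ae mu, forall t, P t}.
Proof. exact: (@nearW _ _ _ (ae_filter_ringOfSetsType mu)). Qed.

Lemma normc2E z : normc z ^+ 2 = Re z ^+ 2 + Im z ^+ 2.
Proof. by case: z => a b /=; rewrite sqr_sqrtr// addr_ge0// sqr_ge0. Qed.

Lemma conjcD z w : conjc (z + w) = conjc z + conjc w.
Proof. exact: rmorphD. Qed.

Lemma conjcN z : conjc (- z) = - conjc z.
Proof. exact: rmorphN. Qed.

Lemma conjcB z w : conjc (z - w) = conjc z - conjc w.
Proof. exact: rmorphB. Qed.

Lemma conjcM z w : conjc (z * w) = conjc z * conjc w.
Proof. exact: rmorphM. Qed.

Lemma mulCconj z : z * conjc z = (normc z ^+ 2)%:C%C.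
Proof.
rewrite normc2E; case: z => a b /=; apply/eqP; rewrite eq_complex /=.
by apply/andP; split; apply/eqP; ring.
Qed.

Lemma normc_conj z : normc (conjc z) = normc z.
Proof. by case: z => a b /=; rewrite sqrrN. Qed.

Lemma normc_ge0 z : 0 <= normc z.
Proof. by case: z => a b /=; exact: sqrtr_ge0. Qed.

Lemma normc_real (x : R) : normc x%:C%C = `|x|.
Proof. by rewrite /= expr0n/= addr0 sqrtr_sqr. Qed.

Lemma normc1_conj z : normc z = 1 -> z * conjc z = 1.
Proof. by move=> z1; rewrite mulCconj z1 expr1n. Qed.

Lemma circ_conj t : circ t * conjc (circ t) = 1.
Proof.
rewrite mulCconj normc2E /= cos2Dsin2 //.
Qed.

Lemma circ_neq0 t : circ t != 0.
Proof.
apply/eqP => c0; have := circ_conj t; rewrite c0 mul0r => /eqP.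
by rewrite eq_sym oner_eq0.
Qed.

Lemma circV t : (circ t)^-1 = conjc (circ t).
Proof.
by apply: (mulfI (circ_neq0 t)); rewrite circ_conj mulfV// circ_neq0.
Qed.

Lemma conj_circ t n : conjc (circ t ^ n) = circ t ^ (- n).
Proof.
have H k : conjc (circ t ^+ k) = (circ t ^+ k)^-1.
  by rewrite -exprVn circV rmorphXn.
case: n => k; first by rewrite -exprnN; exact: H.
by rewrite NegzE opprK -exprnN conjc_inv -!exprnP H invrK.
Qed.

Lemma circ_exprD t n m : circ t ^ (n + m) = circ t ^ n * circ t ^ m.
Proof. by rewrite expfzDr// circ_neq0. Qed.

Lemma normc_circX t n : normc (circ t ^ n) = 1.
Proof.
have : normc (circ t ^ n) ^+ 2 = 1.
  apply: complexI; rewrite -mulCconj conj_circ -circ_exprD subrr//.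
by move/eqP; rewrite sqrp_eq1 ?normc_ge0// => /eqP.
Qed.

Lemma circD s t : circ (s + t) = circ s * circ t.
Proof.
rewrite /circ mulrDr cosD sinD; apply/eqP; rewrite eq_complex /= eqxx /=.
by apply/eqP; ring.
Qed.

Lemma circ0 : circ (0 : R) = 1.
Proof. by rewrite /circ mulr0 cos0 sin0. Qed.

Lemma circ1 : circ (1 : R) = 1.
Proof.
by rewrite /circ mulr1 (_ : 2 * pi = 0 + pi *+ 2) ?cosD2pi ?sinD2pi ?cos0 ?sin0// add0r mulr_natl.
Qed.

Lemma circX t k : circ t ^+ k = circ (k%:R * t).
Proof.
elim: k => [|k ih]; first by rewrite expr0 mul0r circ0.
by rewrite exprS ih -circD -natr1 mulrDl mul1r addrC.
Qed.

Lemma circ_nat (k : nat) : circ (k%:R : R) = 1.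
Proof. by rewrite -(mulr1 k%:R) -circX circ1 expr1n. Qed.

(** * Integration over the unit interval and over the circle *)

Lemma munitI : measurable (@unitI R : set (measurableTypeR R)).
Proof. exact: measurable_itv. Qed.

Lemma mu_unitI : mu (@unitI R) = 1%E.
Proof. by rewrite lebesgue_measure_itv/= lte_fin ltr01 oppr0 adde0. Qed.

Definition mI (x : R -> R) := measurable_fun (@unitI R) x.
Definition iI (x : R -> R) := mu.-integrable (@unitI R) (EFin \o x).

Lemma iI_mI x : iI x -> mI x.
Proof. by move/measurable_int/measurable_EFinP. Qed.

Lemma iI_le x y : mI x -> (forall t, unitI t -> `|x t| <= y t) -> iI y -> iI x.
Proof.
move=> mx xy iy; apply: le_integrable iy => //; first exact: munitI.
  exact/measurable_EFinP.
by move=> t /xy; rewrite /= lee_fin => /le_trans; apply; exact: ler_norm.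
Qed.

Lemma iI_le_ae x y : mI x ->
  {ae mu, forall t, unitI t -> `|x t| <= y t} -> iI y -> iI x.
Proof.
move=> mx xy iy; apply/integrableP; split; first exact/measurable_EFinP.
(* The bound [y] is nonnegative only almost everywhere; its absolute value is so everywhere. *)
have yn : iI (fun t => `|y t|) by exact: integrable_norm.
apply: (@le_lt_trans _ _ (\int[mu]_(t in unitI) `|y t|%:E)%E); last first.
  have /integrableP[_] := yn; under eq_integral do rewrite /= normr_id.
  by [].
apply: ae_ge0_le_integral => //.
- exact: munitI.
- by apply: measurableT_comp => //; exact/measurable_EFinP.
- exact: (measurable_int _ yn).
- apply: aeS xy => t /= h It; rewrite lee_fin (le_trans (h It))//.
  exact: ler_norm.
Qed.

Lemma iI_D x y : iI x -> iI y -> iI (fun t => x t + y t).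
Proof.
move=> ix iy; have := integrableD munitI ix iy.
by apply: eq_integrable; first exact: munitI.
Qed.

Lemma iI_Z c x : iI x -> iI (fun t => c * x t).
Proof.
move=> ix; have := integrableZl munitI c ix.
by apply: eq_integrable; first exact: munitI.
Qed.

Lemma iI_eq x y : (forall t, x t = y t) -> iI x -> iI y.
Proof. by move=> /funext ->. Qed.

Lemma iI_cst c : iI (fun=> c).
Proof.
apply/integrableP; split; first exact/measurable_EFinP/measurable_cst.
rewrite /= integral_cst; last exact: munitI.
by rewrite -[X in X unitI]/(mu : set _ -> _) mu_unitI mule1 ltry.
Qed.

Lemma Rint_cst (c : R) : \int[mu]_(t in unitI) c = c.
Proof.
rewrite Rintegral_cst; last exact: munitI.
by rewrite -[X in X unitI]/(mu : set _ -> _) mu_unitI mulr1.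
Qed.

Lemma Rint_ae x y : mI x -> mI y ->
  {ae mu, forall t, unitI t -> x t = y t} ->
  \int[mu]_(t in unitI) x t = \int[mu]_(t in unitI) y t.
Proof.
move=> mx my xy; congr fine; apply: ae_eq_integral.
- exact: munitI.
- exact/measurable_EFinP.
- exact/measurable_EFinP.
- by apply: aeS xy => t h /h /= ->.
Qed.

Lemma Rint_eq0 x : iI x -> (forall t, unitI t -> 0 <= x t) ->
  \int[mu]_(t in unitI) x t = 0 ->
  {ae mu, forall t, unitI t -> x t = 0}.
Proof.
move=> ix x0 intx.
have : (\int[mu]_(t in unitI) `|(EFin \o x) t|)%E = 0%E.
  under eq_integral => t /set_mem It do rewrite /= ger0_norm ?x0//.
  rewrite -[LHS]fineK; first by rewrite -[fine _]/(Rintegral _ _ _) intx.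
  by apply: integrable_fin_num => //; exact: munitI.
move/(ae_eq_integral_abs _ munitI (measurable_int _ ix)).
by apply: aeS => t h /h /= [].
Qed.

Lemma Rint_ge0 x : (forall t, unitI t -> 0 <= x t) ->
  0 <= \int[mu]_(t in unitI) x t.
Proof. by move=> x0; apply: Rintegral_ge0. Qed.

(** Equality at every point of the circle. Unlike [eqT], it allows rewriting under an integral
    without any measurability obligation; identities such as z^n z^-n = 1 hold in this sense
    although they fail at 0. *)
Definition cc f g := forall t, f (circ t) = g (circ t).

Lemma cc_eqT f g : cc f g -> eqT f g.
Proof. by move=> fg; apply: aeW => t _ /=; rewrite fg. Qed.

Lemma cc_intT f g : cc f g -> intT f = intT g.
Proof.
by move=> fg; rewrite /intT; congr Complex; apply: eq_Rintegral => t _; rewrite fg.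
Qed.

Lemma cc_measurableT f g : cc f g -> measurable_circ f -> measurable_circ g.
Proof.
move=> fg [mr mi]; split.
- by rewrite (_ : (fun t => _) = fun t => Re (f (circ t)))//; apply/funext => t; rewrite fg.
- by rewrite (_ : (fun t => _) = fun t => Im (f (circ t)))//; apply/funext => t; rewrite fg.
Qed.

Lemma cc_L2 f g : cc f g -> L2 f -> L2 g.
Proof.
move=> fg [mf i]; split; first exact: cc_measurableT mf.
rewrite (_ : (fun t => _) = fun t => (normc (f (circ t)) ^+ 2)%:E)//.
by apply/funext => t; rewrite fg.
Qed.

Lemma measurableTD f g : measurable_circ f -> measurable_circ g ->
  measurable_circ (fun z => f z + g z).
Proof.
move=> [fr fi] [gr gi]; split => /=.
- rewrite (_ : (fun t => _) = (fun t => Re (f (circ t)) + Re (g (circ t)))).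
    exact: measurable_funD.
  by apply/funext => t; case: (f _) (g _) => a b [].
- rewrite (_ : (fun t => _) = (fun t => Im (f (circ t)) + Im (g (circ t)))).
    exact: measurable_funD.
  by apply/funext => t; case: (f _) (g _) => a b [].
Qed.

Lemma measurableTM f g : measurable_circ f -> measurable_circ g ->
  measurable_circ (fun z => f z * g z).
Proof.
move=> [fr fi] [gr gi]; split => /=.
- rewrite (_ : (fun t => _) = (fun t => Re (f (circ t)) * Re (g (circ t)) -
      Im (f (circ t)) * Im (g (circ t)))).
    by apply: measurable_funB; exact: measurable_funM.
  by apply/funext => t; case: (f _) (g _) => a b [].
- rewrite (_ : (fun t => _) = (fun t => Re (f (circ t)) * Im (g (circ t)) +
      Im (f (circ t)) * Re (g (circ t)))).
    by apply: measurable_funD; exact: measurable_funM.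
  by apply/funext => t; case: (f _) (g _) => a b [].
Qed.

Lemma measurableTJ f : measurable_circ f -> measurable_circ (fun z => conjc (f z)).
Proof.
move=> [fr fi]; split => /=.
- rewrite (_ : (fun t => _) = (fun t => Re (f (circ t))))//.
  by apply/funext => t; case: (f _).
- rewrite (_ : (fun t => _) = (\- (fun t => Im (f (circ t)))))//.
    exact: measurable_funN.
  by apply/funext => t /=; case: (f _).
Qed.

Lemma measurableT_cst (c : R[i]) : measurable_circ (fun=> c).
Proof. by split; exact: measurable_cst. Qed.

Lemma measurableT_id : measurable_circ (fun z => z).
Proof.
split => /=; apply: (@measurable_funS _ _ _ _ setT) => //;
  apply: continuous_measurable_fun => t.
- apply: continuous_comp; last exact: continuous_cos.
  by apply: continuousM; [exact: cvg_cst|exact: cvg_id].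
- apply: continuous_comp; last exact: continuous_sin.
  by apply: continuousM; [exact: cvg_cst|exact: cvg_id].
Qed.

Lemma measurableTX n : measurable_circ (fun z => z ^ n).
Proof.
have H k : measurable_circ (fun z : R[i] => z ^+ k).
  elim: k => [|k ih]; first exact: measurableT_cst.
  apply: (@cc_measurableT (fun z => z * z ^+ k)).
    by move=> t; rewrite exprS.
  exact: measurableTM measurableT_id ih.
case: (intP n) => [|k|k]; first exact: measurableT_cst.
  exact: (H k.+1).
apply: (@cc_measurableT (fun z => conjc (z ^+ k.+1))).
  by move=> t; rewrite -conj_circ.
exact: measurableTJ (H k.+1).
Qed.

Definition L1 f := iI (fun t => Re (f (circ t))) /\ iI (fun t => Im (f (circ t))).

Lemma L1_measurableT f : L1 f -> measurable_circ f.
Proof. by move=> [/iI_mI ? /iI_mI]. Qed.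

Lemma cc_L1 f g : cc f g -> L1 f -> L1 g.
Proof.
by move=> fg [ir ii]; split; [apply: iI_eq ir|apply: iI_eq ii] => t; rewrite fg.
Qed.

Lemma L1P f (y : R -> R) : measurable_circ f ->
  {ae mu, forall t, unitI t -> normc (f (circ t)) <= y t} -> iI y -> L1 f.
Proof.
move=> [mr mi] fy iy.
have le_nr z : `|Re z| <= normc z.
  by rewrite -[leLHS]sqrtr_sqr; case: z => a b /=; rewrite ler_sqrt ?addr_ge0 ?sqr_ge0// lerDl sqr_ge0.
have le_ni z : `|Im z| <= normc z.
  by rewrite -[leLHS]sqrtr_sqr; case: z => a b /=; rewrite ler_sqrt ?addr_ge0 ?sqr_ge0// lerDr sqr_ge0.
by split; apply: (iI_le_ae _ _ iy) => //; apply: aeS fy => t h /h; exact: le_trans.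
Qed.

Lemma L1D f g : L1 f -> L1 g -> L1 (fun z => f z + g z).
Proof.
move=> [fr fi] [gr gi]; split => /=.
- by apply: iI_eq (iI_D fr gr) => t; case: (f _) (g _) => a b [].
- by apply: iI_eq (iI_D fi gi) => t; case: (f _) (g _) => a b [].
Qed.

Lemma L1Z (c : R[i]) f : L1 f -> L1 (fun z => c * f z).
Proof.
move=> [fr fi]; case: c => a b; split => /=.
- apply: iI_eq (iI_D (iI_Z a fr) (iI_Z (- b) fi)) => t.
  by case: (f _) => x y /=; rewrite mulNr.
- apply: iI_eq (iI_D (iI_Z a fi) (iI_Z b fr)) => t.
  by case: (f _) => x y /=.
Qed.

Lemma L1J f : L1 f -> L1 (fun z => conjc (f z)).
Proof.
move=> [fr fi]; split.
- by apply: iI_eq fr => t; case: (f _).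
- by apply: iI_eq (iI_Z (-1) fi) => t; rewrite mulN1r; case: (f _).
Qed.

Lemma intTD f g : L1 f -> L1 g -> intT (fun z => f z + g z) = intT f + intT g.
Proof.
move=> [fr fi] [gr gi]; rewrite /intT; apply/eqP; rewrite eq_complex /=.
rewrite -!RintegralD ?eqxx//; try exact: munitI.
by apply/andP; split; apply/eqP; apply: eq_Rintegral => t _;
  case: (f _) (g _) => a b [].
Qed.

Lemma intTZ (c : R[i]) f : L1 f -> intT (fun z => c * f z) = c * intT f.
Proof.
move=> [fr fi]; rewrite /intT; apply/eqP; rewrite eq_complex; case: c => a b /=.
rewrite -!RintegralZl//; try exact: munitI.
rewrite -RintegralB//; try exact: munitI; try exact: iI_Z.
rewrite -RintegralD//; try exact: munitI; try exact: iI_Z.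
by apply/andP; split; apply/eqP; apply: eq_Rintegral => t _;
  case: (f _) => x y.
Qed.

Lemma intTJ f : L1 f -> intT (fun z => conjc (f z)) = conjc (intT f).
Proof.
move=> [fr fi]; rewrite /intT; apply/eqP; rewrite eq_complex /=.
rewrite -mulN1r -!RintegralZl ?eqxx//; try exact: munitI.
by apply/andP; split; apply/eqP; apply: eq_Rintegral => t _;
  rewrite ?mulN1r; case: (f _) => x y.
Qed.

Lemma intT_cst (c : R[i]) : intT (fun=> c) = c.
Proof. by rewrite /intT !Rint_cst; case: c. Qed.

Lemma eqT_intT f g : measurable_circ f -> measurable_circ g -> eqT f g -> intT f = intT g.
Proof.
move=> [fr fi] [gr gi] fg; rewrite /intT; congr Complex; apply: Rint_ae => //;
  by apply: aeS fg => t h /h /= ->.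
Qed.

(** * Square integrable and bounded functions *)

Lemma L2P f : L2 f <-> measurable_circ f /\ iI (fun t => normc (f (circ t)) ^+ 2).
Proof. by []. Qed.

Lemma L2_measurableT f : L2 f -> measurable_circ f. Proof. by case. Qed.

Lemma L2D f g : L2 f -> L2 g -> L2 (fun z => f z + g z).
Proof.
move=> [mf fi] [mg gi]; have mfg := measurableTD mf mg.
apply/L2P; split => //.
apply: (@iI_le _ (fun t => 2 * normc (f (circ t)) ^+ 2 + 2 * normc (g (circ t)) ^+ 2)).
- case: mfg => mr mi; rewrite (_ : (fun t => _) = (fun t => Re (f (circ t) + g (circ t)) ^+ 2 + Im (f (circ t) + g (circ t)) ^+ 2)).
    by apply: measurable_funD; apply: measurable_funX.
  by apply/funext => t; rewrite normc2E.
- move=> t _; rewrite ger0_norm ?sqr_ge0// !normc2E.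
  case: (f _) (g _) => a b [c d] /=.
  have := sqr_ge0 (a - c); have := sqr_ge0 (b - d); nra.
- by apply: iI_D; exact: iI_Z.
Qed.

Lemma mI_normc2 f : measurable_circ f -> mI (fun t => normc (f (circ t)) ^+ 2).
Proof.
case => mr mi; rewrite (_ : (fun t => _) = (fun t => Re (f (circ t)) ^+ 2 + Im (f (circ t)) ^+ 2)).
  by apply: measurable_funD; apply: measurable_funX.
by apply/funext => t; rewrite normc2E.
Qed.

Lemma L2M u f : Linfty u -> L2 f -> L2 (fun z => u z * f z).
Proof.
move=> [mu' [M uM]] [mf fi]; have muf := measurableTM mu' mf.
apply/L2P; split => //.
apply: (@iI_le_ae _ (fun t => M ^+ 2 * normc (f (circ t)) ^+ 2)).
- exact: (mI_normc2 muf).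
- apply: aeS uM => t h /h {}h; rewrite ger0_norm ?sqr_ge0//.
  rewrite ComplexField.Normc.normcM exprMn ler_wpM2r ?sqr_ge0//.
  by rewrite ler_sqr ?nnegrE ?normc_ge0// (le_trans _ h)// normc_ge0.
- exact: iI_Z.
Qed.

Lemma L2J f : L2 f -> L2 (fun z => conjc (f z)).
Proof.
move=> [mf fi]; split; first exact: measurableTJ.
by apply: iI_eq fi => t; rewrite normc_conj.
Qed.

Lemma Linfty_cst (c : R[i]) : Linfty (fun=> c).
Proof. by split; [exact: measurableT_cst|exists (normc c); exact: aeW]. Qed.

Lemma LinftyX n : Linfty (fun z => z ^ n).
Proof.
split; first exact: measurableTX.
by exists 1; apply: aeW => t _; rewrite normc_circX.
Qed.

Lemma LinftyJ u : Linfty u -> Linfty (fun z => conjc (u z)).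
Proof.
move=> [mu' [M h]]; split; first exact: measurableTJ.
by exists M; apply: aeS h => t h /h; rewrite normc_conj.
Qed.

Lemma LinftyM u v : Linfty u -> Linfty v -> Linfty (fun z => u z * v z).
Proof.
move=> [mu' [M uM]] [mv [N vN]]; split; first exact: measurableTM.
exists (M * N); apply: aeS2 uM vN => t a b It.
by rewrite ComplexField.Normc.normcM ler_pM ?normc_ge0 ?a ?b.
Qed.

Lemma LinftyD u v : Linfty u -> Linfty v -> Linfty (fun z => u z + v z).
Proof.
move=> [mu' [M uM]] [mv [N vN]]; split; first exact: measurableTD.
exists (M + N); apply: aeS2 uM vN => t a b It.
by rewrite (le_trans (le_normcD _ _))// lerD ?a ?b.
Qed.

Lemma L2_cst (c : R[i]) : L2 (fun=> c).
Proof. by split; [exact: measurableT_cst|exact: iI_cst]. Qed.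

Lemma Linfty_L2 u : Linfty u -> L2 u.
Proof.
move=> uoo; have := L2M uoo (L2_cst 1); apply: cc_L2 => t.
by rewrite mulr1.
Qed.

Lemma L2X n : L2 (fun z => z ^ n).
Proof. exact/Linfty_L2/LinftyX. Qed.

Lemma L2Z (c : R[i]) f : L2 f -> L2 (fun z => c * f z).
Proof. exact: (L2M (Linfty_cst c)). Qed.

Lemma L2N f : L2 f -> L2 (fun z => - f z).
Proof. by move=> /(L2Z (-1)); apply: cc_L2 => t; rewrite mulN1r. Qed.

Lemma L2B f g : L2 f -> L2 g -> L2 (fun z => f z - g z).
Proof. by move=> fL /L2N; exact: L2D. Qed.

Lemma L2MX n f : L2 f -> L2 (fun z => z ^ n * f z).
Proof. exact: (L2M (LinftyX n)). Qed.

Lemma L2_sum k (F : 'I_k -> cfun R) : (forall i, L2 (F i)) ->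
  L2 (fun z => \sum_(i < k) F i z).
Proof.
elim: k F => [|k ih] F LF.
  by apply: cc_L2 (L2_cst 0) => t; rewrite big_ord0.
apply: (@cc_L2 (fun z => F ord0 z + \sum_(i < k) F (lift ord0 i) z)).
  by move=> t; rewrite big_ord_recl.
by apply: L2D => //; exact: ih.
Qed.

Lemma L2_L1M f g : L2 f -> L2 g -> L1 (fun z => f z * conjc (g z)).
Proof.
move=> [mf fi] [mg gi].
apply: (@L1P _ (fun t => normc (f (circ t)) ^+ 2 + normc (g (circ t)) ^+ 2)).
- exact: measurableTM mf (measurableTJ mg).
- apply: aeW => t _; rewrite ComplexField.Normc.normcM normc_conj.
  have := sqr_ge0 (normc (f (circ t)) - normc (g (circ t))).
  have := sqr_ge0 (normc (f (circ t)) + normc (g (circ t))).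
  nra.
- exact: iI_D.
Qed.

End Circle.

(** * Inner product and norm of L2 *)

Section Hilbert.
Context {R : realType}.
Implicit Types (t : R) (z w c : R[i]) (f g h u v : cfun R) (n m : int) (A : set (cfun R)).
Local Notation mu := (@lebesgue_measure R).
Local Notation Re := complex.Re.
Local Notation Im := complex.Im.
Local Notation normc := ComplexField.Normc.normc.

Lemma eqT_refl f : eqT f f.
Proof. exact: aeW. Qed.

Lemma eqT_sym f g : eqT f g -> eqT g f.
Proof. by apply: aeS => t + It => /(_ It) ->. Qed.

Lemma eqT_trans g f h : eqT f g -> eqT g h -> eqT f h.
Proof. by apply: aeS2 => t + + It => /(_ It) -> /(_ It). Qed.

Lemma eqT1 (F : R[i] -> R[i] -> R[i]) f f' :
  eqT f f' -> eqT (fun z => F z (f z)) (fun z => F z (f' z)).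
Proof. by apply: aeS => t + It /= => /(_ It) /= ->. Qed.

Lemma eqTM f f' g g' : eqT f f' -> eqT g g' ->
  eqT (fun z => f z * g z) (fun z => f' z * g' z).
Proof. by apply: aeS2 => t + + It /= => /(_ It) /= -> /(_ It) /= ->. Qed.

Lemma eqTJ f f' : eqT f f' -> eqT (fun z => conjc (f z)) (fun z => conjc (f' z)).
Proof. exact: (eqT1 (fun=> @conjc R)). Qed.

Lemma ip_cc f f' g g' : cc f f' -> cc g g' -> innerp f g = innerp f' g'.
Proof. by move=> ff gg; apply: cc_intT => t; rewrite ff gg. Qed.

Lemma ip_eqT f f' g g' : L2 f -> L2 f' -> L2 g -> L2 g' ->
  eqT f f' -> eqT g g' -> innerp f g = innerp f' g'.
Proof.
move=> Lf Lf' Lg Lg' ff' gg'; apply: eqT_intT.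
- exact: (L1_measurableT (L2_L1M Lf Lg)).
- exact: (L1_measurableT (L2_L1M Lf' Lg')).
- exact: eqTM ff' (eqTJ gg').
Qed.

Lemma ipDl f g h : L2 f -> L2 g -> L2 h ->
  innerp (fun z => f z + g z) h = innerp f h + innerp g h.
Proof.
move=> Lf Lg Lh; rewrite /innerp -intTD; try exact: L2_L1M.
by apply: cc_intT => t; rewrite mulrDl.
Qed.

Lemma ipZl c f h : L2 f -> L2 h -> innerp (fun z => c * f z) h = c * innerp f h.
Proof.
move=> Lf Lh; rewrite /innerp -intTZ; last exact: L2_L1M.
by apply: cc_intT => t; rewrite mulrA.
Qed.

Lemma ipC f g : L2 f -> L2 g -> innerp g f = conjc (innerp f g).
Proof.
move=> Lf Lg; rewrite /innerp -intTJ; last exact: L2_L1M.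
by apply: cc_intT => t; rewrite conjcM conjcK mulrC.
Qed.

Lemma ipDr f g h : L2 f -> L2 g -> L2 h ->
  innerp h (fun z => f z + g z) = innerp h f + innerp h g.
Proof.
move=> Lf Lg Lh; rewrite (ipC (L2D Lf Lg) Lh) ipDl// conjcD.
by rewrite -!ipC.
Qed.

Lemma ipZr c f h : L2 f -> L2 h ->
  innerp h (fun z => c * f z) = conjc c * innerp h f.
Proof.
by move=> Lf Lh; rewrite (ipC (L2Z c Lf) Lh) ipZl// conjcM -ipC.
Qed.

Lemma ipBl f g h : L2 f -> L2 g -> L2 h ->
  innerp (fun z => f z - g z) h = innerp f h - innerp g h.
Proof.
move=> Lf Lg Lh; rewrite -mulN1r -ipZl// -ipDl//; last exact: L2Z.
by apply: ip_cc => // t; rewrite mulN1r.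
Qed.

Lemma ipBr f g h : L2 f -> L2 g -> L2 h ->
  innerp h (fun z => f z - g z) = innerp h f - innerp h g.
Proof.
move=> Lf Lg Lh; rewrite (ipC (L2B Lf Lg) Lh) ipBl// conjcB.
by rewrite -!ipC.
Qed.

Lemma ip0l h : innerp (fun=> 0) h = 0.
Proof.
by rewrite -[RHS](@intT_cst R); apply: cc_intT => t; rewrite mul0r.
Qed.

Lemma ip0r h : innerp h (fun=> 0) = 0.
Proof.
by rewrite -[RHS](@intT_cst R); apply: cc_intT => t; rewrite conjc0 mulr0.
Qed.

(** The two integrands coincide pointwise, so a multiplier can change sides before any integrability
    is known. *)
Lemma ipM u f g : innerp (fun z => u z * f z) g = innerp f (fun z => conjc (u z) * g z).
Proof. by apply: cc_intT => t; rewrite conjcM conjcK mulrCA mulrA. Qed.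

Definition nsq f : R := \int[mu]_(t in unitI) (normc (f (circ t)) ^+ 2).

Lemma norm2E f : norm2 f = Num.sqrt (nsq f). Proof. by []. Qed.

Lemma nsq_ge0 f : 0 <= nsq f.
Proof. by apply: Rint_ge0 => t _; exact: sqr_ge0. Qed.

Lemma norm2_ge0 f : 0 <= norm2 f.
Proof. exact: sqrtr_ge0. Qed.

Lemma sqr_norm2 f : norm2 f ^+ 2 = nsq f.
Proof. by rewrite sqr_sqrtr// nsq_ge0. Qed.

Lemma cc_nsq f g : cc f g -> nsq f = nsq g.
Proof. by move=> fg; apply: eq_Rintegral => t _; rewrite fg. Qed.

Lemma eqT_nsq f g : L2 f -> L2 g -> eqT f g -> nsq f = nsq g.
Proof.
move=> [mf _] [mg _] fg; apply: Rint_ae; [exact: mI_normc2|exact: mI_normc2|].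
by apply: aeS fg => t h /h /= ->.
Qed.

Lemma ip_nsq f : innerp f f = (nsq f)%:C%C.
Proof.
rewrite /innerp /intT /nsq; apply/eqP; rewrite eq_complex /=; apply/andP; split.
  by apply/eqP; apply: eq_Rintegral => t _; rewrite mulCconj.
rewrite (_ : (fun t => _) = fun=> 0); last first.
  by apply/funext => t; rewrite mulCconj.
by rewrite Rint_cst.
Qed.

Lemma nsq0_eqT f : L2 f -> nsq f = 0 -> eqT f (fun=> 0).
Proof.
move=> [mf fi] f0.
have := Rint_eq0 fi (fun t _ => sqr_ge0 _) f0.
apply: aeS => t h /h /eqP; rewrite sqrf_eq0 => /eqP.
exact: ComplexField.Normc.eq0_normc.
Qed.

Lemma nsqD f g : L2 f -> L2 g ->
  nsq (fun z => f z + g z) = nsq f + nsq g + 2 * Re (innerp f g).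
Proof.
move=> Lf Lg; have ReD z w : Re (z + w) = Re z + Re w by case: z w => a b [].
have ReJ z : Re (conjc z) = Re z by case: z.
have nE h : nsq h = Re (innerp h h) by rewrite ip_nsq.
rewrite !nE ipDl// ?ipDr//; try exact: L2D.
rewrite !ReD (ipC Lf Lg) ReJ; ring.
Qed.

Lemma nsqZ c f : L2 f -> nsq (fun z => c * f z) = normc c ^+ 2 * nsq f.
Proof.
move=> Lf; apply: complexI; rewrite -ip_nsq ipZl ?ipZr//; last exact: L2Z.
by rewrite rmorphM /= -ip_nsq -mulCconj mulrA.
Qed.

(* The minimum of [c |-> nsq (f - c g)]. *)
Lemma nsq_min f g : L2 f -> L2 g -> nsq g != 0 ->
  nsq (fun z => f z + (- (innerp f g / (nsq g)%:C%C)) * g z)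
  = nsq f - normc (innerp f g) ^+ 2 / nsq g.
Proof.
move=> Lf Lg g0; rewrite nsqD//; last exact: L2Z.
rewrite ipZr// nsqZ//.
set x := innerp f g; set N := nsq g.
have -> : normc (- (x / N%:C%C)) ^+ 2 = normc x ^+ 2 / N ^+ 2.
  rewrite normcN ComplexField.Normc.normcM exprMn.
  by rewrite ComplexField.Normc.normcV normc_real ger0_norm ?nsq_ge0// exprVn.
have -> : Re (conjc (- (x / N%:C%C)) * x) = - (normc x ^+ 2 / N).
  rewrite conjcN conjcM conjc_inv conjc_real mulNr mulrAC.
  rewrite [conjc x * x]mulrC mulCconj -fmorphV -rmorphM -rmorphN //.
by field.
Qed.

(** The minimal value found in [nsq_min] is a squared norm, hence nonnegative. *)
Lemma nsq_CS f g : L2 f -> L2 g -> normc (innerp f g) ^+ 2 <= nsq f * nsq g.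
Proof.
move=> Lf Lg; have [g0|g0] := eqVneq (nsq g) 0.
  have eg := nsq0_eqT Lg g0.
  rewrite (ip_eqT Lf Lf Lg (L2_cst 0) (eqT_refl f) eg) ip0r.
  by rewrite ComplexField.Normc.normc0 expr0n /= g0 mulr0.
have := nsq_ge0 (fun z => f z + (- (innerp f g / (nsq g)%:C%C)) * g z).
rewrite nsq_min// subr_ge0 ler_pdivrMr// lt_neqAle eq_sym g0 /=.
exact: nsq_ge0.
Qed.

Lemma CauchySchwarz f g : L2 f -> L2 g -> normc (innerp f g) <= norm2 f * norm2 g.
Proof.
move=> Lf Lg.
rewrite -[leLHS](ger0_norm (normc_ge0 _)) -sqrtr_sqr -sqrtrM ?nsq_ge0//.
by rewrite ler_sqrt ?mulr_ge0 ?nsq_ge0// nsq_CS.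
Qed.

Lemma nsqN f : L2 f -> nsq (fun z => - f z) = nsq f.
Proof.
move=> Lf; rewrite -(@cc_nsq (fun z => (-1) * f z)); last by move=> t; rewrite mulN1r.
by rewrite nsqZ// normcN ComplexField.Normc.normc1 expr1n mul1r.
Qed.

Lemma nsqBC f g : L2 f -> L2 g -> nsq (fun z => f z - g z) = nsq (fun z => g z - f z).
Proof.
move=> Lf Lg; rewrite -nsqN; last exact: L2B.
by apply: cc_nsq => t; rewrite opprB.
Qed.

Lemma norm2M_inner u f : Linfty u ->
  {ae mu, forall t, unitI t -> normc (u (circ t)) = 1} -> L2 f ->
  norm2 (fun z => u z * f z) = norm2 f.
Proof.
move=> uoo u1 Lf; congr Num.sqrt; apply: Rint_ae.
- exact: (mI_normc2 (L2_measurableT (L2M uoo Lf))).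
- exact: (mI_normc2 (L2_measurableT Lf)).
- by apply: aeS u1 => t h /h {}h; rewrite ComplexField.Normc.normcM h mul1r.
Qed.

End Hilbert.

(** * Completeness of L2 *)

Section Complete.
Context {R : realType}.
Implicit Types (t : R) (z w c : R[i]) (f g h u v : cfun R) (n m : nat) (A : set (cfun R)).
Local Notation mu := (@lebesgue_measure R).
Local Notation Re := complex.Re.
Local Notation Im := complex.Im.
Local Notation normc := ComplexField.Normc.normc.

Lemma ReD z w : Re (z + w) = Re z + Re w. Proof. by case: z w => a b []. Qed.
Lemma ImD z w : Im (z + w) = Im z + Im w. Proof. by case: z w => a b []. Qed.
Lemma ReN z : Re (- z) = - Re z. Proof. by case: z. Qed.
Lemma ImN z : Im (- z) = - Im z. Proof. by case: z. Qed.

Lemma normc2D_le z w : normc (z + w) ^+ 2 <= 2 * normc z ^+ 2 + 2 * normc w ^+ 2.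
Proof.
rewrite !normc2E !ReD !ImD; move: (Re z) (Re w) (Im z) (Im w) => a b c d.
have := sqr_ge0 (a - b); have := sqr_ge0 (c - d); nra.
Qed.

(** A weighted Cauchy-Schwarz inequality for a telescoping sum: the weights 2^j are compensated by
    the sum of 2^-j over j >= n, which is 2 * 2^-n. The induction peels off one increment with |z +
    w|^2 <= 2 |z|^2 + 2 |w|^2. *)
Lemma normc2_tail (x : nat -> R[i]) n p :
  normc (x (n + p)%N - x n) ^+ 2 <=
  2 * 2^-1 ^+ n * \sum_(n <= j < n + p) 2 ^+ j * normc (x j.+1 - x j) ^+ 2.
Proof.
elim: p n => [|p ih] n.
  by rewrite addn0 subrr ComplexField.Normc.normc0 expr0n /= big_geq// mulr0.
rewrite (_ : x (n + p.+1)%N - x n = (x n.+1 - x n) + (x (n.+1 + p)%N - x n.+1)); last first.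
  by rewrite addnS addSn; ring.
apply: le_trans (normc2D_le _ _) _.
rewrite big_ltn ?addnS ?ltnS ?leq_addr// mulrDr.
apply: lerD.
  rewrite (_ : _ * (_ ^+ n * _) = 2 * normc (x n.+1 - x n) ^+ 2)//.
  by rewrite exprVn; field; rewrite expf_neq0.
rewrite -addSn; apply: le_trans (ler_wpM2l _ (ih n.+1)) _ => //.
by rewrite exprS !mulrA mulfK// mulrC.
Qed.

(* The upper limit, unlike the limit, is measurable without any assumption on
   convergence. *)
Definition limfun (F : nat -> cfun R) : cfun R := fun z =>
  Complex (fine (limn_esup (fun n => (Re (F n z))%:E)))
          (fine (limn_esup (fun n => (Im (F n z))%:E))).

Lemma measurable_limfun (F : nat -> cfun R) :
  (forall n, measurable_circ (F n)) -> measurable_circ (limfun F).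
Proof.
move=> mF; split => /=.
- apply: (measurableT_comp (f := fine)) => //.
  apply: (@measurable_fun_limn_esup _ _ _ _ (fun n t => (Re (F n (circ t)))%:E)) => n.
  by apply/measurable_EFinP; case: (mF n).
- apply: (measurableT_comp (f := fine)) => //.
  apply: (@measurable_fun_limn_esup _ _ _ _ (fun n t => (Im (F n (circ t)))%:E)) => n.
  by apply/measurable_EFinP; case: (mF n).
Qed.

Lemma cvg_fine_limn_esup (x : nat -> R) : cvgn x ->
  x @ \oo --> fine (limn_esup (fun n => (x n)%:E)).
Proof.
move=> cx; have cE : (fun n => (x n)%:E) @ \oo --> (limn x)%:E.
  by apply: cvg_EFin; [exact: nearW|].
rewrite is_cvg_limn_esupE; last by apply/cvg_ex; exists (limn x)%:E.
by rewrite (cvg_lim _ cE).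
Qed.

Lemma cvgn_geometric_sq (x : nat -> R) (S : R) :
  (forall n p, (x (n + p)%N - x n) ^+ 2 <= 2^-1 ^+ n * S) -> cvgn x.
Proof.
move=> H; apply/cauchy_cvgP/cauchy_ballP => e e0 /=.
have S0 : 0 <= S.
  by have := H 0%N 0%N; rewrite expr0 mul1r; apply: le_trans; exact: sqr_ge0.
have : (fun n => 2^-1 ^+ n * S : R) @ \oo --> (0 : R).
  rewrite -(mul0r S); apply: cvgMr_tmp.
  have := @cvg_geometric R 1 2^-1; rewrite ger0_norm// invf_lt1// ltr1n => /(_ isT).
  by rewrite /geometric /=; under eq_fun do rewrite mul1r.
(* The estimate concerns squares, and two distances to [x N] are added: each has to be below e /
   2. *)
move=> /cvgrPdist_lt /(_ (e ^+ 2 / 4)).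
have e4 : 0 < e ^+ 2 / 4 by rewrite divr_gt0 ?exprn_gt0.
move=> /(_ e4)[N _ HN].
have key n : (N <= n)%N -> `|x n - x N| < e / 2.
  move=> Nn; rewrite -ltr_sqr ?nnegrE ?divr_ge0 ?(ltW e0)//.
  rewrite real_normK ?num_real// -(subnKC Nn).
  apply: le_lt_trans (H _ _) _.
  have := HN N (leqnn _); rewrite sub0r normrN ger0_norm; last first.
    by rewrite mulr_ge0 ?exprn_ge0.
  by rewrite (_ : (e / 2) ^+ 2 = e ^+ 2 / 4)//; field.
exists (x @` [set n | (N <= n)%N], x @` [set n | (N <= n)%N]) => /=.
  by split; exists N => // n /= Nn; exists n.
move=> [_ _] [/= [n Nn <-] [m Nm <-]].
rewrite /ball /=.
rewrite (_ : x n - x m = (x n - x N) - (x m - x N)); last by ring.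
by rewrite (le_lt_trans (ler_normB _ _))// [e]splitr ltrD// key.
Qed.

(** Riesz-Fischer for rapidly convergent sequences. With d_n the squared increments, the integral of
    S = sum 2^n d_n is at most sum C 2^-n = 2 C, so S is finite almost everywhere. There
    [normc2_tail] makes the sequence Cauchy, with squared error at most 2 * 2^-n S, and integration
    gives the stated rate. *)
Lemma L2_complete (F : nat -> cfun R) (C : R) : (forall n, L2 (F n)) ->
  (forall n, nsq (fun z => F n.+1 z - F n z) <= C * 4^-1 ^+ n) ->
  exists g, L2 g /\ forall n, nsq (fun z => F n z - g z) <= 4 * C * 2^-1 ^+ n.
Proof.
move=> LF HF.
pose d n t := normc (F n.+1 (circ t) - F n (circ t)) ^+ 2.
have id n : iI (d n) by have [] := L2B (LF n.+1) (LF n).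
have d0 n t : 0 <= d n t by exact: sqr_ge0.
pose s n t : \bar R := (2 ^+ n * d n t)%:E.
have s0 n t : unitI t -> (0 <= s n t)%E by move=> _; rewrite lee_fin mulr_ge0.
have ms n : measurable_fun unitI (s n).
  by apply/measurable_EFinP; apply: iI_mI; apply: iI_Z.
pose S t := (\sum_(n <oo) s n t)%E.
have mS : measurable_fun unitI S.
  by apply: (@ge0_emeasurable_sum _ _ _ _ _ xpredT); [move=> n t It _; exact: s0|].
have S0 t : unitI t -> (0 <= S t)%E by move=> It; apply: nneseries_ge0 => n _ _; exact: s0.
have intS : (\int[mu]_(t in unitI) S t <= (2 * C)%:E)%E.
  rewrite /S integral_nneseries//; last first.
    exact: munitI.
  have sle n : (\int[mu]_(t in unitI) s n t <= (C * 2^-1 ^+ n)%:E)%E.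
    have -> : (\int[mu]_(t in unitI) s n t = (\int[mu]_(t in unitI) (2 ^+ n * d n t))%:E)%E.
      rewrite /Rintegral fineK//; apply: integrable_fin_num; first exact: munitI.
      exact: (iI_Z _ (id n)).
    have -> : C * 2^-1 ^+ n = 2 ^+ n * (C * 4^-1 ^+ n).
      by rewrite mulrCA -exprMn; congr (_ * _ ^+ _); field.
    rewrite lee_fin RintegralZl; [|exact: munitI|exact: id].
    by rewrite ler_wpM2l// HF.
  apply: (@le_trans _ _ (\sum_(n <oo) (C * 2^-1 ^+ n)%:E)%E).
    by apply: lee_nneseries => n _; [rewrite integral_ge0// => t; exact: s0|exact: sle].
  have C0 : 0 <= C by have := HF 0%N; rewrite expr0 mulr1; apply: le_trans (nsq_ge0 _).
  apply: lime_le.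
    by apply: is_cvg_nneseries => n _ _; rewrite lee_fin mulr_ge0// exprn_ge0.
  apply: nearW => n; rewrite sumEFin lee_fin.
  have := @geometric_le_lim R n C 2^-1 C0; rewrite invr_gt0 ltr0n => /(_ isT).
  rewrite ger0_norm// invf_lt1// ltr1n => /(_ isT); rewrite /series /geometric /=.
  move=> /le_trans; apply; rewrite le_eqVlt; apply/orP; left; apply/eqP; by field.
have iS : mu.-integrable unitI S.
  apply/integrableP; split => //.
  under eq_integral => t /set_mem It do rewrite gee0_abs ?S0//.
  by rewrite (le_lt_trans intS)// ltry.
have Sfin := integrable_ae munitI iS.
pose g := limfun F.
have Hpt n : {ae mu, forall t, unitI t ->
    normc (F n (circ t) - g (circ t)) ^+ 2 <= 2 * 2^-1 ^+ n * fine (S t)}.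
  apply: aeS Sfin => t + It => /(_ It) St.
  pose x m := F m (circ t).
  have tail m p : normc (x (m + p)%N - x m) ^+ 2 <= 2 * 2^-1 ^+ m * fine (S t).
    apply: le_trans (normc2_tail _ _ _) _; rewrite ler_wpM2l// ?mulr_ge0 ?exprn_ge0//.
    rewrite -lee_fin fineK// -sumEFin.
    apply: (@le_trans _ _ (\sum_(0 <= j < m + p) s j t)%E).
      rewrite [leRHS](@big_cat_nat _ _ _ m) ?leq_addr//= leeDr//.
      by apply: sume_ge0 => j _; exact: s0.
    by apply: (nneseries_lim_ge (u_ := s ^~ t) (P := xpredT)) => j _ _; exact: s0.
  have cR : cvgn (fun m => Re (x m)).
    apply: (@cvgn_geometric_sq _ (2 * fine (S t))) => m p.
    rewrite [leRHS]mulrA [X in X * _]mulrC; apply: le_trans (tail m p).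
    by rewrite normc2E ReD ReN lerDl sqr_ge0.
  have cI : cvgn (fun m => Im (x m)).
    apply: (@cvgn_geometric_sq _ (2 * fine (S t))) => m p.
    rewrite [leRHS]mulrA [X in X * _]mulrC; apply: le_trans (tail m p).
    by rewrite normc2E ImD ImN lerDr sqr_ge0.
  have lR := cvg_fine_limn_esup cR; have lI := cvg_fine_limn_esup cI.
  rewrite normc2E !ReD !ImD !ReN !ImN.
  (* The pointwise bound survives the passage to the limit m -> oo in the tail estimate. *)
  have cvgT : (fun m => (Re (x n) - Re (x m)) ^+ 2 + (Im (x n) - Im (x m)) ^+ 2) @ \oo -->
      (Re (F n (circ t)) - Re (g (circ t))) ^+ 2 + (Im (F n (circ t)) - Im (g (circ t))) ^+ 2.
    apply: cvgD; rewrite !expr2; apply: cvgM; apply: cvgB; try exact: cvg_cst; by [].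
  apply: (cvgr_to_le cvgT).
  exists n => // m /= nm; rewrite -(subnKC nm).
  apply: le_trans (tail n (m - n)%N); rewrite normc2E !ReD !ImD !ReN !ImN.
  by rewrite -(opprB (Re (x n))) -(opprB (Im (x n))) !sqrrN.
have mg : measurable_circ g by apply: measurable_limfun => n; exact: L2_measurableT.
have mFg n : measurable_circ (fun z => F n z - g z).
  apply: (@cc_measurableT _ (fun z => F n z + (-1) * g z)).
    by move=> t; rewrite mulN1r.
  apply: measurableTD; first exact: L2_measurableT.
  exact: measurableTM (measurableT_cst _) mg.
have K0 n : 0 <= 2 * 2^-1 ^+ n :> R by rewrite mulr_ge0// exprn_ge0.
have intle n : (\int[mu]_(t in unitI) (normc (F n (circ t) - g (circ t)) ^+ 2)%:E
    <= (4 * C * 2^-1 ^+ n)%:E)%E.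
  apply: (@le_trans _ _ (\int[mu]_(t in unitI) ((2 * 2^-1 ^+ n)%:E * S t))%E).
    apply: ae_ge0_le_integral.
    - exact: munitI.
    - by move=> t _; rewrite lee_fin sqr_ge0.
    - by apply/measurable_EFinP; exact: (mI_normc2 (mFg n)).
    - by move=> t It; rewrite mule_ge0 ?lee_fin ?S0.
    - exact: measurable_funeM.
    - apply: aeS2 (Hpt n) Sfin => t + + It => /(_ It) h /(_ It) St.
      by move: h; rewrite -lee_fin => /le_trans; apply; rewrite EFinM fineK.
  rewrite ge0_integralZl//; last exact: munitI.
  rewrite (_ : 4 * C * _ = 2 * 2^-1 ^+ n * (2 * C)); last by ring.
  by rewrite [leRHS]EFinM lee_wpmul2l// lee_fin.
have LFg n : L2 (fun z => F n z - g z).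
  split; first exact: mFg.
  apply/integrableP; split; first by apply/measurable_EFinP; exact: (mI_normc2 (mFg n)).
  under eq_integral do rewrite gee0_abs ?lee_fin ?sqr_ge0//.
  by rewrite (le_lt_trans (intle n))// ltry.
exists g; split.
  apply: cc_L2 (L2B (LF 0%N) (LFg 0%N)) => t.
  by rewrite opprB addrCA subrr addr0.
move=> n; rewrite -lee_fin (le_trans _ (intle n))// le_eqVlt; apply/orP; left.
apply/eqP; rewrite /nsq /Rintegral fineK//; apply: integrable_fin_num; first exact: munitI.
by case: (LFg n).
Qed.

End Complete.

(** * Closed subspaces and orthogonal projections *)

Section Projection.
Context {R : realType}.
Implicit Types (t : R) (z w c : R[i]) (f g h u v : cfun R) (A : set (cfun R)).
Local Notation mu := (@lebesgue_measure R).
Local Notation Re := complex.Re.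
Local Notation Im := complex.Im.
Local Notation normc := ComplexField.Normc.normc.

(** Closed linear subspaces of L2. Since members are functions and not classes, closedness also has
    to provide stability under [eqT]; it does, because equal classes are at distance 0. *)
Definition csub A := [/\ A `<=` @L2 R, A (fun=> 0),
  forall c f g, A f -> A g -> A (fun z => c * f z + g z) &
  forall g, L2 g ->
    (forall e : R, 0 < e -> exists2 f, A f & nsq (fun z => f z - g z) < e) -> A g].

Lemma csub_L2 A f : csub A -> A f -> L2 f.
Proof. by move=> [h _ _ _]; exact: h. Qed.

Lemma csub_eqT A f g : csub A -> A f -> L2 g -> eqT f g -> A g.
Proof.
move=> [AL _ _ Acl] Af Lg fg; apply: Acl => // e e0; exists f => //.
rewrite (eqT_nsq (L2B (AL _ Af) Lg) (L2_cst 0)).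
  rewrite /nsq Rintegral_cst; last exact: munitI.
  by rewrite ComplexField.Normc.normc0 expr0n /= mul0r.
by apply: aeS fg => t + It => /(_ It) /= ->; rewrite subrr.
Qed.

Lemma csub_cc A f g : csub A -> A f -> cc f g -> A g.
Proof.
move=> cA Af fg; apply: (csub_eqT cA Af); last exact: cc_eqT.
exact: cc_L2 fg (csub_L2 cA Af).
Qed.

Lemma csubZ A c f : csub A -> A f -> A (fun z => c * f z).
Proof.
move=> cA Af; have [_ A0 AD _] := cA; apply: csub_cc cA (AD c _ _ Af A0) _ => t.
by rewrite addr0.
Qed.

Lemma csubD A f g : csub A -> A f -> A g -> A (fun z => f z + g z).
Proof.
move=> cA Af Ag; have [_ A0 AD _] := cA; apply: csub_cc cA (AD 1 _ _ Af Ag) _ => t.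
by rewrite mul1r.
Qed.

Lemma csubB A f g : csub A -> A f -> A g -> A (fun z => f z - g z).
Proof.
move=> cA Af Ag; apply: (csub_cc cA (csubD cA Af (csubZ (-1) cA Ag))) => t.
by rewrite mulN1r.
Qed.

Lemma csub_sum A k (F : 'I_k -> cfun R) : csub A -> (forall i, A (F i)) ->
  A (fun z => \sum_(i < k) F i z).
Proof.
move=> cA; elim: k F => [|k ih] F AF.
  have [_ A0 _ _] := cA; apply: (csub_cc cA A0) => t.
  by rewrite big_ord0.
apply: (csub_cc cA (csubD cA (AF ord0) (ih _ (fun i => AF (lift ord0 i))))) => t.
by rewrite big_ord_recl.
Qed.

Lemma csubI A B : csub A -> csub B -> csub (A `&` B).
Proof.
move=> [AL A0 AD Acl] [BL B0 BD Bcl]; split => //.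
- by move=> f [] /AL.
- by move=> c f g [? ?] [? ?]; split; [exact: AD|exact: BD].
- move=> g Lg H; split; [apply: Acl => // e e0|apply: Bcl => // e e0];
    by have [f [Af Bf] fe] := H e e0; exists f.
Qed.

Lemma normc_lim0 (z : R[i]) (M : R) :
  (forall e, 0 < e -> normc z <= M * e) -> z = 0.
Proof.
move=> H; apply: ComplexField.Normc.eq0_normc; apply/eqP; apply: contraT => z0.
have zp : 0 < normc z by rewrite lt_neqAle eq_sym z0 normc_ge0.
have M0 : 0 < M by rewrite -(mulr1 M) (lt_le_trans zp)// H.
have := H (normc z / (2 * M)); rewrite divr_gt0// ?mulr_gt0// => /(_ isT).
rewrite (_ : M * _ = normc z / 2); first by lra.
by field; rewrite gt_eqF.
Qed.

(** The functional is linear and bounded on [A] alone, which admits f -> <U f, h> with [U] an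
    operator controlled only on a model space. Continuity arguments are run through this lemma: an
    identity on generators becomes membership in a kernel. *)
Lemma csub_ker A (l : cfun R -> R[i]) (M : R) : csub A ->
  (forall c f g, A f -> A g -> l (fun z => c * f z + g z) = c * l f + l g) ->
  (forall f, A f -> normc (l f) <= M * norm2 f) ->
  csub (A `&` [set f | l f = 0]).
Proof.
move=> cA lD lM; have [AL A0 AD Acl] := cA.
have l0 : l (fun=> 0) = 0.
  have := lD 1 _ _ A0 A0.
  rewrite (_ : (fun z => _) = fun=> 0); last by apply/funext => z; rewrite mulr0 addr0.
  by rewrite mul1r => /eqP; rewrite -[X in X == _]addr0 (inj_eq (addrI _)) eq_sym => /eqP.
split.
- by move=> f [] /AL.
- by [].
- move=> c f g [Af lf] [Ag lg]; split; first exact: AD.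
  by rewrite /= lD// lf lg mulr0 addr0.
- move=> g Lg H; have Ag : A g.
    by apply: Acl => // e e0; have [f [Af _] fe] := H e e0; exists f.
  (* [M] may be negative, while the estimate below multiplies an inequality by the constant. *)
  split => //=; apply: (@normc_lim0 _ (Num.max M 0)) => e e0.
  have [f [Af lf] fe] := H (e ^+ 2) (exprn_gt0 _ e0).
  have Afg : A (fun z => (-1) * f z + g z) by exact: AD.
  have -> : l g = l (fun z => (-1) * f z + g z) by rewrite lD// lf mulr0 add0r.
  apply: le_trans (lM _ Afg) _.
  apply: (@le_trans _ _ (Num.max M 0 * norm2 (fun z => (-1) * f z + g z))).
    by rewrite ler_wpM2r ?norm2_ge0// le_max lexx.
  rewrite ler_wpM2l//; first by rewrite le_max lexx orbT.
  rewrite -ler_sqr ?nnegrE ?norm2_ge0 ?ltW// sqr_norm2.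
  rewrite (@cc_nsq _ _ (fun z => g z - f z)); last by move=> t; rewrite mulN1r addrC.
  by rewrite nsqBC ?ltW//; exact: AL.
Qed.

Lemma csub_L2_self : csub (@L2 R).
Proof. by split => //; [exact: L2_cst|move=> c f g Lf Lg; apply: L2D => //; exact: L2Z]. Qed.

Lemma csub_orth1 A h : csub A -> L2 h -> csub (A `&` [set f | innerp f h = 0]).
Proof.
move=> cA Lh; have L f : A f -> L2 f := csub_L2 cA.
apply: (csub_ker (M := norm2 h) cA) => [c f g Af Ag|f Af].
  by rewrite ipDl ?ipZl//; [exact: L|exact/L2Z/L|exact: L].
by rewrite mulrC; apply: CauchySchwarz => //; exact: L.
Qed.

Lemma csub_bigI (S : set (set (cfun R))) A : csub A ->
  (forall B, S B -> csub (A `&` B)) -> csub (A `&` [set f | forall B, S B -> B f]).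
Proof.
move=> [AL A0 AD Acl] SB; split => //.
- by move=> f [] /AL.
- by split => // B /SB [_ []].
- move=> c f g [Af Sf] [Ag Sg]; split; first exact: AD.
  move=> B HB; have [_ _ /(_ c f g) BD _] := SB _ HB.
  exact: proj2 (BD (conj Af (Sf _ HB)) (conj Ag (Sg _ HB))).
- move=> g Lg H; split.
    by apply: Acl => // e e0; have [f [Af _] fe] := H e e0; exists f.
  move=> B HB; have [_ _ _ /(_ g Lg) Bcl] := SB _ HB.
  apply: (fun x => proj2 (Bcl x)) => e e0; have [f [Af Sf] fe] := H e e0; exists f => //.
  by split => //; exact: Sf.
Qed.

Lemma csub_orth A (S : set (cfun R)) : csub A -> S `<=` @L2 R ->
  csub (A `&` [set f | forall h, S h -> innerp f h = 0]).
Proof.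
move=> cA SL.
have := @csub_bigI [set B | exists2 h, S h & B = [set f | innerp f h = 0]] A cA.
rewrite (_ : [set f | forall B, _] = [set f | forall h, S h -> innerp f h = 0]).
  by apply => B [h Sh ->]; apply: csub_orth1 => //; exact: SL.
apply/seteqP; split => f /= H.
  by move=> h Sh; apply: (H [set f | innerp f h = 0]); exists h.
by move=> B [h Sh ->]; exact: H.
Qed.

Lemma norm2_lt_sqr f (e : R) : 0 < e -> nsq f < e ^+ 2 -> norm2 f < e.
Proof.
by move=> e0 fe; rewrite -ltr_sqr ?nnegrE ?norm2_ge0 ?ltW// sqr_norm2.
Qed.

(** A minimizing sequence for the distance to [A], with excess below 4^-n so that its increments
    decay as [L2_complete] requires. Orthogonality is obtained for the approximants up to an error
    and then passed to the limit. *)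
Lemma projection_exists A f : csub A -> L2 f ->
  exists2 g, A g & forall h, A h -> innerp (fun z => f z - g z) h = 0.
Proof.
move=> cA Lf; have [AL A0 AD Acl] := cA.
pose D := [set x : R | exists2 g, A g & x = nsq (fun z => f z - g z)].
have D0 : lbound D 0 by move=> x [g Ag ->]; exact: nsq_ge0.
have Dn : D !=set0 by exists (nsq (fun z => f z - 0)); exists (fun=> 0).
have hD : has_inf D by split => //; exists 0.
pose d := inf D.
have dle g : A g -> d <= nsq (fun z => f z - g z).
  by move=> Ag; apply: ge_inf; [exists 0|exists g].
have ex n : exists g, A g /\ nsq (fun z => f z - g z) < d + 4^-1 ^+ n.
  have [|_ [g Ag ->] gd] := @inf_adherent _ D (4^-1 ^+ n) _ hD.
    by rewrite exprn_gt0// invr_gt0.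
  by exists g.
have [G HG] := choice ex.
have AG n : A (G n) by have [] := HG n.
have LG n : L2 (G n) by exact: AL.
have Gd n : nsq (fun z => f z - G n z) < d + 4^-1 ^+ n by have [] := HG n.
have e0 n : 0 <= 4^-1 ^+ n :> R by rewrite exprn_ge0.
(* The parallelogram identity, with the midpoint of [G n] and [G n.+1] in [A]: the squared increment
   is at most 2 (d + 4^-n) + 2 (d + 4^-(n+1)) - 4 d. *)
have GG n : nsq (fun z => G n.+1 z - G n z) <= 4 * 4^-1 ^+ n.
  have La := L2B Lf (LG n); have Lb := L2N (L2B Lf (LG n.+1)).
  have := nsqD La Lb; have := nsqD La (L2N Lb).
  rewrite nsqN// nsqN; last exact: L2B.
  have -> : innerp (fun z => f z - G n z) (fun z => - - (f z - G n.+1 z)) =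
      - innerp (fun z => f z - G n z) (fun z => - (f z - G n.+1 z)).
    rewrite -mulN1r -[X in X * _](@conjcK R) -ipZr//.
    by apply: ip_cc => // t; rewrite conjcN (rmorph1 (@conjc R)) mulN1r.
  rewrite ReN.
  rewrite (@cc_nsq _ _ (fun z => 2 * (f z - (2^-1 * G n z + 2^-1 * G n.+1 z)))); last first.
    by move=> t; field.
  rewrite (@cc_nsq _ (fun z => _ + - (f z - _)) (fun z => G n.+1 z - G n z)); last first.
    by move=> t; ring.
  have Am : A (fun z => 2^-1 * G n z + 2^-1 * G n.+1 z).
    by apply: AD => //; exact: csubZ.
  rewrite nsqZ; last exact: L2B Lf (AL _ Am).
  have -> : normc 2 ^+ 2 = 4 :> R.
    have e2 : (2 : R[i]) = (2 : R)%:C%C by rewrite rmorph_nat.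
    by rewrite [X in normc X]e2 normc_real ger0_norm// -natrX.
  have := dle _ Am; have := Gd n; have := Gd n.+1; rewrite exprS; have := e0 n.
  set a := nsq _; set b := nsq _; set m := nsq (fun z => f z - (_ + _)).
  set e := nsq _; set x := 4^-1 ^+ n; set r := Re _; lra.
have [g [Lg gG]] := L2_complete LG GG.
have small (e : R) : 0 < e -> exists n, 4^-1 ^+ n < e /\ nsq (fun z => G n z - g z) < e.
  move=> e0'.
  (* 16 is the constant 4 C of [L2_complete] for C = 4. *)
  have : (fun n => 16 * 2^-1 ^+ n : R) @ \oo --> (0 : R).
    by apply: cvg_geometric; rewrite ger0_norm// invf_lt1// ltr1n.
  move=> /cvgrPdist_lt /(_ _ e0') [N _ /(_ N (leqnn _))].
  rewrite sub0r normrN ger0_norm ?mulr_ge0 ?exprn_ge0// => lt.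
  exists N; split; last by apply: le_lt_trans (gG N) _; lra.
  apply: le_lt_trans lt; rewrite -[leLHS]mul1r ler_pM ?ler1n//.
  by apply: lerXn2r; rewrite ?nnegrE ?invr_ge0// lef_pV2 ?posrE ?ler_nat.
have Ag : A g.
  by apply: Acl => // e e0'; have [n [_ ?]] := small e e0'; exists (G n).
exists g => // h Ah; have Lh := AL _ Ah.
(* Moving [G n] along [h] cannot bring the squared distance below [d], so the gain computed in
   [nsq_min] is at most the excess 4^-n. *)
have bnd n : normc (innerp (fun z => f z - G n z) h) ^+ 2 <= 4^-1 ^+ n * nsq h.
  have [h0|h0] := eqVneq (nsq h) 0.
    by apply: le_trans (nsq_CS (L2B Lf (LG n)) Lh) _; rewrite h0 !mulr0.
  have hp : 0 < nsq h by rewrite lt_neqAle eq_sym h0 nsq_ge0.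
  have := nsq_min (L2B Lf (LG n)) Lh h0; set c := - _.
  have Am : A (fun z => - c * h z + G n z) by exact: AD.
  have := dle _ Am; rewrite (@cc_nsq _ _ (fun z => f z - G n z + c * h z)); last first.
    by move=> t; ring.
  move=> H1 H2; rewrite H2 in H1.
  rewrite -ler_pdivrMr//; have := Gd n; lra.
apply: (@normc_lim0 _ (2 * norm2 h)) => e e0'.
have [n [n1 n2]] := small _ (exprn_gt0 2 e0').
have -> : innerp (fun z => f z - g z) h =
    innerp (fun z => f z - G n z) h + innerp (fun z => G n z - g z) h.
  rewrite -ipDl//; try exact: L2B.
  by apply: ip_cc => // t; ring.
apply: le_trans (le_normcD _ _) _.
rewrite (_ : _ * e = e * norm2 h + e * norm2 h); last by ring.
apply: lerD.
  rewrite -ler_sqr ?nnegrE ?normc_ge0 ?mulr_ge0 ?norm2_ge0 ?(ltW e0')//.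
  apply: le_trans (bnd n) _; rewrite exprMn sqr_norm2 ler_wpM2r ?nsq_ge0//.
  exact: ltW.
apply: le_trans (CauchySchwarz (L2B (LG n) Lg) Lh) _.
by rewrite ler_wpM2r ?norm2_ge0// ltW// norm2_lt_sqr.
Qed.

End Projection.

(** * Uniqueness of Fourier coefficients of integrable functions *)

Section Uniqueness.
Context {R : realType}.
Implicit Types (t x y : R) (z w c : R[i]) (f g h p q : cfun R) (n m : nat).
Local Notation mu := (@lebesgue_measure R).
Local Notation Re := complex.Re.
Local Notation Im := complex.Im.
Local Notation normc := ComplexField.Normc.normc.

Lemma ae_neq (a : R) : {ae mu, forall t, t != a}.
Proof.
exists [set a]; split; first exact: measurable_set1.
  exact: lebesgue_measure_set1.
by move=> t /= /negP; rewrite negbK => /eqP.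
Qed.

Lemma aeI (P Q : R -> Prop) : {ae mu, forall t, P t} -> {ae mu, forall t, Q t} ->
  {ae mu, forall t, P t /\ Q t}.
Proof. by apply: aeS2 => t. Qed.

(** Almost every t is a Lebesgue point, at which x t is the derivative of the indefinite integral;
    that integral is 0 throughout ]0, 1[, a neighbourhood of t once the endpoints are discarded. *)
Lemma Rint_itv0_ae (x : R -> R) : iI x ->
  (forall s, 0 < s < 1 -> \int[mu]_(t in `[0, s]) x t = 0) ->
  {ae mu, forall t, unitI t -> x t = 0}.
Proof.
move=> ix x0.
have xpt : {ae mu, forall t, lebesgue_pt (x \_ unitI) t}.
  exact/lebesgue_differentiation/(integrable_locally munitI).
have iy : mu.-integrable `[0%R, 1%R] (EFin \o (x \_ unitI)).
  move: ix; rewrite /iI /unitI => ix.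
  apply: eq_integrable ix => //= t tI.
  by rewrite patchE ifT.
suff : {ae mu, forall t, 0 < t < 1 -> x t = 0}.
  move=> H; apply: aeS2 (aeI (ae_neq 0) (ae_neq 1)) H => t t01 H.
  rewrite /unitI /= in_itv /= => /andP[t0 t1]; case: t01 => a b.
  by apply: H; rewrite !lt_neqAle t0 t1 eq_sym a b.
apply: aeS xpt => t tpt /andP[t0 t1].
have [|_ dE] := @FTC1_lebesgue_pt R (x \_ unitI) (BLeft 0) t 1 t1 iy _ tpt.
  by rewrite lte_fin.
have -> : x t = (x \_ unitI) t.
  by rewrite patchE ifT// inE /unitI /= in_itv /= !ltW.
rewrite -dE.
rewrite -[RHS](derive1_cst 0 t).
rewrite !derive1E; apply: near_eq_derive.
have : \forall s \near t, s \in `]0, 1[.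
  by apply: near_in_itvoo; rewrite in_itv /= t0 t1.
apply: filterS => s; rewrite in_itv /= => s01; rewrite -[RHS](x0 _ s01).
apply: eq_Rintegral => r /set_mem; rewrite /= in_itv /= => /andP[r0 rs].
rewrite patchE ifT// inE /unitI /= in_itv /= r0 (le_trans rs)//.
by case/andP: s01 => _ /ltW.
Qed.

Lemma bernoulli_onem (a : R) n : 0 <= a <= 1 -> 1 - n%:R * a <= (1 - a) ^+ n.
Proof.
move=> /andP[a0 a1]; elim: n => [|n ih]; first by rewrite mul0r subr0.
rewrite exprS; apply: le_trans (ler_wpM2l _ ih); last by rewrite subr_ge0.
rewrite -natr1; have : 0 <= n%:R * a * a by rewrite !mulr_ge0.
nra.
Qed.

Lemma bernoulli_onep (a : R) n : 0 <= a -> 1 + n%:R * a <= (1 + a) ^+ n.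
Proof.
move=> a0; elim: n => [|n ih]; first by rewrite mul0r addr0.
rewrite exprS; apply: le_trans (ler_wpM2l _ ih); last by rewrite addr_ge0.
rewrite -natr1; have : 0 <= n%:R * a * a by rewrite !mulr_ge0.
nra.
Qed.

(* The functions of the Brosowski-Deutsch proof of the Stone-Weierstrass theorem. *)
Definition step n (u : R) : R := (1 - u ^+ n) ^+ (2 ^ n)%N.

Lemma step_itv n u : 0 <= u <= 1 -> 0 <= step n u <= 1.
Proof.
move=> /andP[u0 u1].
have a0 : 0 <= 1 - u ^+ n by rewrite subr_ge0 exprn_ile1.
rewrite /step exprn_ge0//= exprn_ile1// lerBlDr lerDl; exact: exprn_ge0.
Qed.

Lemma cvg_expn0 (a : R) : 0 <= a < 1 -> (fun n => a ^+ n) @ \oo --> (0 : R).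
Proof. by move=> /andP[a0 a1]; apply: cvg_expr; rewrite ger0_norm. Qed.

(** Bernoulli's inequality bounds [step n u] below by 1 - 2^n u^n, and 2 u < 1. *)
Lemma step_cvg1 (u : R) : 0 <= u < 2^-1 -> (fun n => step n u) @ \oo --> (1 : R).
Proof.
move=> /andP[u0 u1].
have u01 : 0 <= u <= 1 by lra.
have : (fun n => 1 - (2 * u) ^+ n : R) @ \oo --> (1 - 0 : R).
  by apply: cvgB; [exact: cvg_cst|apply: cvg_expn0; lra].
rewrite subr0 => cv.
apply: (squeeze_cvgr _ cv (cvg_cst (1 : R))).
apply: nearW => n; have /andP[_ ->] := step_itv n u01; rewrite andbT.
apply: le_trans (bernoulli_onem _ _); last first.
  by case/andP: u01 => ? ?; rewrite exprn_ge0//= exprn_ile1.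
by rewrite natrX -exprMn.
Qed.

(** Multiplying [step n u] by (1 + u^n)^(2^n) gives (1 - u^(2n))^(2^n) <= 1, and that factor is at
    least (2 u)^n by Bernoulli's inequality; here 2 u > 1. *)
Lemma step_cvg0 (u : R) : 2^-1 < u <= 1 -> (fun n => step n u) @ \oo --> (0 : R).
Proof.
move=> /andP[u1 u2].
have u0 : 0 < u by lra.
have u01 : 0 <= u <= 1 by lra.
have : (fun n => ((2 * u)^-1) ^+ n : R) @ \oo --> (0 : R).
  apply: cvg_expn0; rewrite invr_ge0 mulr_ge0 ?(ltW u0)//=.
  by rewrite invf_lt1 ?mulr_gt0//; lra.
move=> cv; apply: (squeeze_cvgr _ (cvg_cst (0 : R)) cv).
apply: nearW => n; have /andP[-> _] := step_itv n u01 => /=.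
have a0 : 0 < u ^+ n by rewrite exprn_gt0.
have a1 : 0 <= 1 - u ^+ n by rewrite subr_ge0 exprn_ile1// ltW.
rewrite exprVn -[leRHS]mul1r ler_pdivlMr ?exprn_gt0 ?mulr_gt0//.
apply: (@le_trans _ _ (step n u * (1 + u ^+ n) ^+ (2 ^ n)%N)).
  rewrite ler_wpM2l//; first by have /andP[] := step_itv n u01.
  apply: le_trans (bernoulli_onep _ (ltW a0)).
  by rewrite natrX -exprMn lerDr.
rewrite /step -exprMn -subr_sqr expr1n exprn_ile1//.
  by rewrite subr_ge0 expr_le1// ?exprn_ile1// ltW.
by rewrite lerBlDr lerDl sqr_ge0.
Qed.

Lemma L1M f (p : cfun R) : Linfty p -> L1 f -> L1 (fun z => p z * f z).
Proof.
move=> [mp [M pM]] [fr fi].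
apply: (@L1P _ _ (fun t => `|M| * (`|Re (f (circ t))| + `|Im (f (circ t))|))).
- apply: measurableTM => //; exact: L1_measurableT.
- apply: aeS pM => t h /h {}h; rewrite ComplexField.Normc.normcM.
  rewrite ler_pM ?normc_ge0//; first by rewrite (le_trans h) ?ler_norm.
  rewrite -ler_sqr ?nnegrE ?normc_ge0 ?addr_ge0// normc2E sqrrD !real_normK ?num_real//.
  by rewrite addrAC lerDl mulrn_wge0// mulr_ge0.
- apply: iI_Z; apply: iI_D; exact: integrable_norm.
Qed.

(** Closure conditions in place of explicit sums turn the algebra property and the vanishing of
    integrals into inductions. [TrigC] is there because z^n z^m = z^(n + m) holds on the circle but
    not at 0. *)
Inductive trigpoly : cfun R -> Prop :=
| TrigX (n : int) : trigpoly (fun z => z ^ n)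
| TrigD p q : trigpoly p -> trigpoly q -> trigpoly (fun z => p z + q z)
| TrigZ c p : trigpoly p -> trigpoly (fun z => c * p z)
| TrigC p q : cc p q -> trigpoly p -> trigpoly q.

Lemma trigpoly_Linfty p : trigpoly p -> Linfty p.
Proof.
elim=> [n|{}p q _ Lp _ Lq|c {}p _ Lp|{}p q pq _ [mp [M H]]].
- exact: LinftyX.
- exact: LinftyD.
- exact: LinftyM (Linfty_cst c) Lp.
- split; first exact: cc_measurableT mp.
  by exists M; apply: aeS H => t h /h; rewrite pq.
Qed.

Lemma trigpolyMX (n : int) q : trigpoly q -> trigpoly (fun z => z ^ n * q z).
Proof.
elim=> [m|{}p {}q _ Tp _ Tq|c {}p _ Tp|{}p {}q pq _ Tp].
- by apply: (@TrigC (fun z => z ^ (n + m))); [move=> t; rewrite circ_exprD|exact: TrigX].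
- apply: (@TrigC (fun z => z ^ n * p z + z ^ n * q z)); last exact: TrigD.
  by move=> t; rewrite mulrDr.
- apply: (@TrigC (fun z => c * (z ^ n * p z))); last exact: TrigZ.
  by move=> t; rewrite mulrCA.
- by apply: TrigC Tp => t; rewrite pq.
Qed.

Lemma trigpolyM p q : trigpoly p -> trigpoly q -> trigpoly (fun z => p z * q z).
Proof.
move=> + Tq; elim=> [n|{}p p' _ Tp _ Tp'|c {}p _ Tp|{}p p' pp' _ Tp].
- exact: trigpolyMX.
- apply: (@TrigC (fun z => p z * q z + p' z * q z)); last exact: TrigD.
  by move=> t; rewrite mulrDl.
- apply: (@TrigC (fun z => c * (p z * q z))); last exact: TrigZ.
  by move=> t; rewrite mulrA.
- by apply: TrigC Tp => t; rewrite pp'.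
Qed.

Lemma trigpoly_cst c : trigpoly (fun=> c).
Proof.
apply: (@TrigC (fun z => c * z ^ (0 : int))); last exact/TrigZ/TrigX.
by move=> t; rewrite expr0z mulr1.
Qed.

Lemma trigpolyXn p n : trigpoly p -> trigpoly (fun z => p z ^+ n).
Proof.
move=> Tp; elim: n => [|n ih].
  by apply: TrigC (trigpoly_cst 1) => t; rewrite expr0.
by apply: TrigC (trigpolyM Tp ih) => t; rewrite exprS.
Qed.

Lemma intT_trigpoly0 f p : L1 f -> (forall n : int, fourier f n = 0) ->
  trigpoly p -> intT (fun z => p z * f z) = 0.
Proof.
move=> Lf f0; elim=> [n|{}p q Tp p0 Tq q0|c {}p Tp p0|{}p q pq _ p0].
- rewrite -(f0 (- n)); apply: cc_intT => t /=.
  by rewrite conj_circ opprK mulrC.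
- rewrite (@cc_intT _ _ (fun z => p z * f z + q z * f z)); last first.
    by move=> t; rewrite mulrDl.
  by rewrite intTD ?p0 ?q0 ?addr0//; apply: L1M => //; exact: trigpoly_Linfty.
- rewrite (@cc_intT _ _ (fun z => c * (p z * f z))); last by move=> t; rewrite mulrA.
  rewrite intTZ ?p0 ?mulr0//; apply: L1M => //; exact: trigpoly_Linfty.
- by rewrite -p0; apply: cc_intT => t; rewrite pq.
Qed.

(* Since 2 sin (pi t) sin (pi (x - t)) = cos (2 pi t - pi x) - cos (pi x), this
   is a trigonometric polynomial. By [sep_lt] and [sep_gt], [step n (sep x)]
   converges boundedly to the indicator function of [0, x]. *)
Definition sep x t : R := 2^-1 - 2^-1 * (sin (pi * t) * sin (pi * (x - t))).

Lemma sep_itv x t : 0 <= sep x t <= 1.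
Proof.
rewrite /sep; have := sin_max (pi * t); have := sin_max (pi * (x - t)).
rewrite !ler_norml; move: (sin _) (sin _) => a b /andP[a1 a2] /andP[b1 b2]; nra.
Qed.

Lemma sep_lt x t : 0 < t < x -> x < 1 -> sep x t < 2^-1.
Proof.
move=> /andP[t0 tx] x1; rewrite /sep ltrBlDr ltrDl mulr_gt0// mulr_gt0//.
  by rewrite sin_gt0_pi// mulr_gt0 ?pi_gt0//= gtr_pMr ?pi_gt0// (lt_trans tx).
by rewrite sin_gt0_pi// mulr_gt0 ?pi_gt0 ?subr_gt0//= gtr_pMr ?pi_gt0//; lra.
Qed.

Lemma sep_gt x t : x < t < 1 -> 0 < x -> 2^-1 < sep x t.
Proof.
move=> /andP[xt t1] x0; rewrite /sep ltrDl oppr_gt0 pmulr_rlt0//.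
rewrite pmulr_rlt0; last first.
  by rewrite sin_gt0_pi// mulr_gt0 ?pi_gt0//= ?gtr_pMr ?pi_gt0//; lra.
rewrite -opprB mulrN sinN oppr_lt0.
by rewrite sin_gt0_pi// mulr_gt0 ?pi_gt0 ?subr_gt0//= gtr_pMr ?pi_gt0//; lra.
Qed.

Lemma sep_trig x : exists2 p, trigpoly p & forall t, p (circ t) = (sep x t)%:C%C.
Proof.
(* With w = exp(i pi x), cos(2 pi t - pi x) = (conj(w) z + w / z) / 2, and [sep x t] is 1/2 + cos(pi
   x) / 4 minus a quarter of this cosine. *)
pose w : R[i] := Complex (cos (pi * x)) (sin (pi * x)).
exists (fun z => (2^-1 + 4^-1 * cos (pi * x))%:C%C +
  (- 8^-1%:C%C) * (conjc w * z ^ (1 : int) + w * z ^ (-1 : int))).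
  apply: TrigD; first exact: trigpoly_cst.
  apply: TrigZ; apply: TrigD; apply: TrigZ; exact: TrigX.
move=> t; rewrite -conj_circ expr1z /sep.
have -> : 2^-1 * (sin (pi * t) * sin (pi * (x - t))) =
   4^-1 * (cos (2 * pi * t) * cos (pi * x) + sin (2 * pi * t) * sin (pi * x)
   - cos (pi * x)).
  have -> : 2 * pi * t = pi * t + pi * t by ring.
  rewrite mulrBr sinB cosD sinD.
  have := cos2Dsin2 (pi * t); move: (cos (pi * t)) (sin (pi * t)) => a b e.
  move: (cos _) (sin _) => c s.
  have -> : 2^-1 * (b * (s * a - c * b)) = 4^-1 * (2 * a * b * s - 2 * b ^+ 2 * c) by field.
  congr (_ * _); apply/eqP; rewrite -subr_eq0; apply/eqP.
  transitivity (c * (1 - (a ^+ 2 + b ^+ 2))); first by ring.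
  by rewrite e subrr mulr0.
rewrite /circ /w; apply/eqP; rewrite eq_complex /=.
by apply/andP; split; apply/eqP; field.
Qed.

Lemma step_trig x n : exists2 p, trigpoly p &
  forall t, p (circ t) = (step n (sep x t))%:C%C.
Proof.
have [p Tp pE] := sep_trig x.
exists (fun z => (1 + (-1) * p z ^+ n) ^+ (2 ^ n)%N).
  apply: trigpolyXn; apply: TrigD; first exact: trigpoly_cst.
  exact/TrigZ/trigpolyXn.
move=> t; rewrite pE /step [RHS]rmorphXn /=; congr (_ ^+ _).
by rewrite mulN1r -rmorphXn -[X in X - _](rmorph1 (real_complex R)) -rmorphB.
Qed.

Lemma measurable_step x n : mI (fun t => step n (sep x t)).
Proof.
have [p Tp pE] := step_trig x n.
have [[mr _] _] := trigpoly_Linfty Tp.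
by rewrite (_ : (fun t => _) = fun t => Re (p (circ t)))//; apply/funext => t; rewrite pE.
Qed.

(** By dominated convergence with majorant |y|, the integrals of step n (sep x) y tend to the
    integral of y over [0, x], which is thus 0 for every x. *)
Lemma fourier_unique_real (y : R -> R) : iI y ->
  (forall x n, \int[mu]_(t in unitI) (step n (sep x t) * y t) = 0) ->
  {ae mu, forall t, unitI t -> y t = 0}.
Proof.
move=> iy y0; apply: Rint_itv0_ae => // x /andP[x0 x1].
pose F n t := (step n (sep x t) * y t)%:E.
pose G t := ((y \_ `[0, x]) t)%:E.
have mF n : measurable_fun (@unitI R) (F n).
  apply/measurable_EFinP; apply: measurable_funM (measurable_step x n) _.
  exact: iI_mI.
have sub : `[0, x] `<=` @unitI R.
  move=> t; rewrite /unitI /= !in_itv /= => /andP[-> tx]; exact: le_trans tx (ltW x1).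
have mG : measurable_fun (@unitI R) G.
  apply/measurable_EFinP; apply: (@measurable_funS _ _ _ _ setT) => //.
  apply/(measurable_restrictT _ _).1 => //; apply: measurable_funS sub _.
    exact: munitI.
  exact: iI_mI.
have [] := @dominated_convergence _ _ R mu unitI munitI F G (EFin \o (fun t => `|y t|)) mF mG.
(* At 0, x and 1 the value of [sep x] is 1/2, where neither limit of [step] applies. *)
- apply: aeS2 (aeI (ae_neq 0) (ae_neq x)) (ae_neq 1) => t [t0 tx] t1 It.
  move: It; rewrite /unitI /= in_itv /= => /andP[t0' t1'].
  have {t0 t0'}tp : 0 < t by rewrite lt_neqAle eq_sym t0.
  have {t1 t1'}tl : t < 1 by rewrite lt_neqAle t1.
  apply: cvg_EFin; first exact: nearW.
  have [tltx|xltt] := ltP t x.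
    rewrite /G patchE ifT; last by rewrite inE /= in_itv /= !ltW.
    rewrite -[X in _ --> X]mul1r; apply: cvgMr_tmp.
    apply: step_cvg1; case/andP: (sep_itv x t) => -> _ /=.
    by apply: sep_lt => //; rewrite tp.
  have {tx xltt}xlt : x < t by rewrite lt_neqAle eq_sym tx.
  rewrite /G patchE ifF; last first.
    by apply/negbTE; rewrite notin_setE /= in_itv /= => /andP[_]; rewrite leNgt xlt.
  rewrite -[X in _ --> X](mul0r (y t)); apply: cvgMr_tmp.
  apply: step_cvg0; case/andP: (sep_itv x t) => _ -> /=; rewrite andbT.
  by apply: sep_gt => //; rewrite xlt.
- exact: integrable_norm.
- apply: aeW => t n It; rewrite /F /= lee_fin normrM ler_piMl//.
  by have /andP[s0 s1] := step_itv n (sep_itv x t); rewrite ger0_norm.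
have iF n : iI (fun t => step n (sep x t) * y t).
  apply: (@iI_le _ _ (fun t => `|y t|)); [| |exact: integrable_norm].
    by apply/measurable_EFinP; exact: mF.
  move=> t It; rewrite /= normrM ler_piMl//.
  by have /andP[s0 s1] := step_itv n (sep_itv x t); rewrite ger0_norm.
move=> iG _ /cvg_lim; rewrite (_ : (fun n => _) = fun=> 0%E); last first.
  apply/funext => n /=; rewrite -[LHS]fineK.
    by rewrite -[fine _]/(Rintegral mu unitI (fun t => step n (sep x t) * y t)) y0.
  by apply: integrable_fin_num; [exact: munitI|exact: (iF n)].
rewrite lim_cst// => /(_ (@ereal_hausdorff _)) => GE.
rewrite Rintegral_mkcond /Rintegral.
transitivity (fine (\int[mu]_(t in unitI) G t)%E); last by rewrite -GE.
rewrite [in RHS]integral_mkcond; congr fine; apply: eq_integral => t _.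
rewrite [RHS]patchE; case: ifPn => // tn; rewrite patchE ifF//.
by apply/negbTE; apply: contra tn; rewrite !inE; exact: sub.
Qed.

Lemma fourier_unique f : L1 f -> (forall n : int, fourier f n = 0) ->
  eqT f (fun=> 0).
Proof.
move=> Lf f0; have [fr fi] := Lf.
have H x n : \int[mu]_(t in unitI) (step n (sep x t) * Re (f (circ t))) = 0 /\
    \int[mu]_(t in unitI) (step n (sep x t) * Im (f (circ t))) = 0.
  have [p Tp pE] := step_trig x n.
  have := intT_trigpoly0 Lf f0 Tp; rewrite /intT => /eqP; rewrite eq_complex /=.
  move=> /andP[/eqP r0 /eqP i0]; split; [rewrite -[RHS]r0|rewrite -[RHS]i0];
    apply: eq_Rintegral => t _; rewrite pE; case: (f _) => a b /=; ring.
have r0 := fourier_unique_real fr (fun x n => (H x n).1).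
have i0 := fourier_unique_real fi (fun x n => (H x n).2).
apply: aeS2 r0 i0 => t r i It /=.
by move: (r It) (i It); case: (f _) => a b /= -> ->.
Qed.

End Uniqueness.

(** * Composition with the power map z^k *)

Section Power.
Context {R : realType}.
Implicit Types (t s : R) (f g h : cfun R).
Local Notation mu := (@lebesgue_measure R).
Local Notation Re := complex.Re.
Local Notation Im := complex.Im.
Local Notation normc := ComplexField.Normc.normc.

Definition affine (a b t : R) : measurableTypeR R := a * t - b.

Lemma measurable_affine (a b : R) : measurable_fun [set: measurableTypeR R] (affine a b).
Proof.
by apply: measurable_funB; [exact: mulrl_measurable|exact: measurable_cst].
Qed.

Lemma affine_preimage (a b x y : R) b0 b1 : 0 < a ->
  affine a b @^-1` [set` Interval (BSide b0 x) (BSide b1 y)] =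
  [set` Interval (BSide b0 ((x + b) / a)) (BSide b1 ((y + b) / a))].
Proof.
move=> a0; apply/seteqP; split => t; rewrite /affine /= !in_itv /= => /andP[].
  case: b0; case: b1 => /=; rewrite ?(lerBrDr, ltrBrDr, lerBlDr, ltrBlDr) => h1 h2;
    rewrite ?(ler_pdivrMr, ler_pdivlMr, ltr_pdivrMr, ltr_pdivlMr)// ?(mulrC t) ?h1 ?h2//.
case: b0; case: b1 => /=; rewrite ?(lerBrDr, ltrBrDr, lerBlDr, ltrBlDr);
    rewrite ?(ler_pdivrMr, ler_pdivlMr, ltr_pdivrMr, ltr_pdivlMr)// ?(mulrC t) => -> ->//.
Qed.

(** The pushforward is a measure only by way of a proof that [affine] is measurable; the existential
    hides that proof and leaves a measure that can be scaled. *)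
Lemma affine_pushforward_measure (a b : R) :
  exists m : {measure set (measurableTypeR R) -> \bar R},
    forall A, m A = pushforward mu (affine a b) A.
Proof.
unshelve eexists.
  unshelve refine (pushforward mu (affine a b) : {measure set (measurableTypeR R) -> \bar R}).
  exact: measurable_affine.
by [].
Qed.

(** Both sides are measures in A that agree on intervals, so uniqueness of Lebesgue measure
    applies. *)
Lemma lebesgue_measure_affine (a b : R) (A : set R) : 0 < a -> measurable A ->
  mu A = (a%:E * pushforward mu (affine a b) A)%E.
Proof.
move=> a0 mA; have [m mE] := affine_pushforward_measure a b.
pose r : {nonneg R} := NngNum (ltW a0).
transitivity (mscale r m A); last by rewrite /mscale mE.
apply: (@lebesgue_measure_unique R (mscale r m)) mA => _ [[x y] _ <-].
rewrite /= /mscale mE /pushforward affine_preimage//=.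
rewrite !lebesgue_measure_itv /= !lte_fin ltr_pM2r ?invr_gt0// ltrD2r.
case: ifPn => xy; last by rewrite mule0.
by rewrite -!EFinB -EFinM; congr EFin; field; rewrite gt_eqF.
Qed.

Lemma ge0_integral_affine (a b : R) (D : set R) (x : R -> \bar R) : 0 < a ->
  measurable D -> measurable_fun D x -> (forall t, D t -> 0 <= x t)%E ->
  (\int[mu]_(t in D) x t =
   a%:E * \int[mu]_(t in affine a b @^-1` D) x (affine a b t))%E.
Proof.
move=> a0 mD mx x0.
have -> : (\int[mu]_(t in affine a b @^-1` D) x (affine a b t) =
    \int[pushforward mu (affine a b)]_(t in D) x t)%E.
  rewrite (ge0_integral_pushforward (@measurable_affine a b))//.
  by move=> t /set_mem; exact: x0.
have [m mE] := affine_pushforward_measure a b.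
pose r : {nonneg R} := NngNum (ltW a0).
transitivity (a%:E * \int[m]_(t in D) x t)%E; last first.
  congr (_ * _)%E; apply: eq_measure_integral; first exact: measurable_affine.
  by move=> ? A _ _; exact: mE.
transitivity (\int[mscale r m]_(t in D) x t)%E; last by rewrite ge0_integral_mscale.
apply: eq_measure_integral => A mA _.
rewrite [LHS](lebesgue_measure_affine b a0)//.
by transitivity (a%:E * m A)%E; [rewrite mE|].
Qed.

Lemma ae_affine (a b : R) (P : R -> Prop) : 0 < a ->
  {ae mu, forall t, P t} -> {ae mu, forall t, P (a * t - b)}.
Proof.
move=> a0 [A [mA A0 PA]]; exists (affine a b @^-1` A); split.
- by rewrite -[X in measurable X]setTI; exact: measurable_affine.
- have := lebesgue_measure_affine b a0 mA; rewrite A0 /pushforward => /esym/eqP.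
  by rewrite mule_eq0 eqe gt_eqF//= => /eqP.
- by move=> t /= H; apply: PA.
Qed.

Lemma circ_subn t (j : nat) : circ (t - j%:R) = circ t.
Proof.
by rewrite -[in RHS](subrK j%:R t) [RHS]circD circ_nat mulr1.
Qed.

(** circ t ^ k = circ (k t - j) for every integer j. The countably many exceptional sets, one for
    each j, are discarded together; then j is chosen as the integer part of k t. *)
Lemma ae_Wadj k (P : R[i] -> Prop) : (0 < k)%N ->
  {ae mu, forall t, unitI t -> P (circ t)} ->
  {ae mu, forall t, unitI t -> P (circ t ^+ k)}.
Proof.
move=> k0 HP; have k0' : 0 < k%:R :> R by rewrite ltr0n.
have := ae_foralln (fun j : nat => ae_affine j%:R k0' HP).
apply: aeS => t H; rewrite /unitI /= in_itv /= => /andP[t0 t1].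
rewrite circX; have kt0 : 0 <= k%:R * t by rewrite mulr_ge0// ltW.
have := H (Num.truncn (k%:R * t)); rewrite circ_subn; apply.
rewrite /unitI /= in_itv /=; have /andP[h1 h2] := Num.Theory.truncn_itv kt0.
by rewrite subr_ge0 h1 /= lerBlDr addrC natr1 ltW.
Qed.

Section WadjIntegral.
Variables (k : nat) (F : R[i] -> R).
Hypotheses (k0 : (0 < k)%N) (mF : mI (fun t => F (circ t))).

Let a : R := k%:R.
Let a0 : 0 < a. Proof. by rewrite ltr0n. Qed.

Let piece (j : nat) : set R := `[j%:R / a, j.+1%:R / a[.

Let pieceE (j : nat) : piece j = affine a j%:R @^-1` `[0, 1[.
Proof. by rewrite /piece affine_preimage// add0r -natr1 [1 + _]addrC. Qed.

Let init (j : nat) : set R := `[0, j%:R / a[.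

Let initS j : init j.+1 = init j `|` piece j.
Proof.
apply: itv_bndbnd_setU; rewrite bnd_simp; first by rewrite divr_ge0// ltW.
by rewrite ler_pM2r ?invr_gt0// ler_nat.
Qed.

Let disj j : [disjoint init j & piece j].
Proof.
apply/disj_setPS => t []; rewrite /init /piece /= !in_itv /= => /andP[_ h1] /andP[h2 _].
by rewrite leNgt h1 in h2.
Qed.

Let mF' : measurable_fun (`[0, 1[ : set R) (fun t => F (circ t)).
Proof. by apply: measurable_funS mF; [exact: munitI|exact: subset_itv_co_cc]. Qed.

Let shift j t : F (circ t ^+ k) = F (circ (affine a j%:R t)).
Proof. by rewrite /affine circ_subn circX. Qed.

Let mpiece j : measurable_fun (piece j) (fun t => F (circ t ^+ k)).
Proof.
rewrite (_ : (fun t => _) = (fun t => F (circ t)) \o affine a j%:R); last first.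
  by apply/funext => t; exact: shift.
apply: (measurable_comp _ _ mF'); first exact: measurable_itv.
- by move=> _ [t + <-]; rewrite pieceE.
- exact: measurable_funS (measurable_affine _ _).
Qed.

Let minit j : measurable_fun (init j) (fun t => F (circ t ^+ k)).
Proof.
elim: j => [|j ih]; first by rewrite /init mul0r set_itvco0; exact: measurable_fun_set0.
by rewrite initS; apply/measurable_funU; [exact: measurable_itv|exact: measurable_itv|split].
Qed.

Let initk : init k = `[0, 1[%classic. Proof. by rewrite /init divff// gt_eqF. Qed.

Lemma mI_Wadj : mI (fun t => F (circ t ^+ k)).
Proof.
by apply/measurable_fun_itv_bndo_bndcP; rewrite -[X in measurable_fun X]initk; exact: minit.
Qed.

(** The map t -> k t - j carries [piece j] onto [0, 1[ and scales lengths by k, so each of the k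
    pieces contributes I / k. Half-open intervals keep the pieces disjoint. *)
Lemma ge0_integral_Wadj : (forall z, 0 <= F z) ->
  (\int[mu]_(t in unitI) (F (circ t ^+ k))%:E = \int[mu]_(t in unitI) (F (circ t))%:E)%E.
Proof.
move=> F0; pose I := (\int[mu]_(t in `[0%R, 1%R[) (F (circ t))%:E)%E.
have EF (x : R -> R) : mI x ->
    (\int[mu]_(t in unitI) (x t)%:E = \int[mu]_(t in `[0%R, 1%R[) (x t)%:E)%E.
  move=> mx; rewrite -integral_itv_bndo_bndc//; apply/measurable_EFinP.
  by apply: measurable_funS mx; [exact: munitI|exact: subset_itv_co_cc].
rewrite !EF//; last exact: mI_Wadj.
have Ip j : (\int[mu]_(t in piece j) (F (circ t ^+ k))%:E = a^-1%:E * I)%E.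
  have -> : I = (a%:E * \int[mu]_(t in piece j) (F (circ (affine a j%:R t)))%:E)%E.
    rewrite pieceE; apply: ge0_integral_affine => //.
      exact/measurable_EFinP.
    by move=> t _; rewrite lee_fin.
  rewrite muleA -EFinM mulVf ?gt_eqF// mul1e.
  by apply: eq_integral => t _; rewrite (shift j).
rewrite -/I -initk.
(* By periodicity every piece contributes equally, even those beyond 1, so the induction on j
   carries no bound j <= k. *)
suff H j : (\int[mu]_(t in init j) (F (circ t ^+ k))%:E = (j%:R / a)%:E * I)%E.
  by rewrite H divff ?gt_eqF// mul1e.
have I0 : (0 <= I)%E by apply: integral_ge0 => t _; rewrite lee_fin.
elim: j => [|j ih]; first by rewrite /init mul0r set_itvco0 integral_set0 mul0e.
rewrite initS ge0_integral_setU; try exact: measurable_itv; last first.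
- exact: disj.
- by move=> t _; rewrite lee_fin.
- apply/measurable_EFinP/measurable_funU; [exact: measurable_itv|exact: measurable_itv|].
  by split; [exact: minit|exact: mpiece].
by rewrite ih Ip -ge0_muleDl ?lee_fin ?divr_ge0 ?invr_ge0 ?(ltW a0)// -EFinD -natr1 mulrDl mul1r.
Qed.

End WadjIntegral.

Lemma iI_Wadj k (F : R[i] -> R) : (0 < k)%N -> iI (fun t => F (circ t)) ->
  iI (fun t => F (circ t ^+ k)).
Proof.
move=> k0 iF; have mF := iI_mI iF.
have mn : mI (fun t => `|F (circ t)|) by apply: measurableT_comp.
apply/integrableP; split; first by apply/measurable_EFinP; exact: mI_Wadj.
rewrite (@ge0_integral_Wadj k (fun z => `|F z|))//.
by case/integrableP : iF.
Qed.

Lemma Rint_Wadj k (F : R[i] -> R) : (0 < k)%N -> iI (fun t => F (circ t)) ->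
  \int[mu]_(t in unitI) F (circ t ^+ k) = \int[mu]_(t in unitI) F (circ t).
Proof.
move=> k0 iF.
have iN : iI (fun t => `|F (circ t)|) by exact: integrable_norm.
(* F is the difference of the nonnegative functions |F| + F and |F|. *)
have iM : iI (fun t => `|F (circ t)| + F (circ t)) by exact: iI_D.
have pos (G : R[i] -> R) : (forall z, 0 <= G z) -> iI (fun t => G (circ t)) ->
    \int[mu]_(t in unitI) G (circ t ^+ k) = \int[mu]_(t in unitI) G (circ t).
  by move=> G0 iG; rewrite /Rintegral ge0_integral_Wadj//; exact: iI_mI.
have := pos (fun z => `|F z| + F z); rewrite /= => /(_ _ iM) H.
have : \int[mu]_(t in unitI) (`|F (circ t ^+ k)| + F (circ t ^+ k)) =
    \int[mu]_(t in unitI) (`|F (circ t)| + F (circ t)).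
  by apply: H => z; rewrite -lerBlDr sub0r -normrN ler_norm.
rewrite !RintegralD//; try exact: munitI.
- by rewrite (pos (fun z => `|F z|))// => /addrI.
- by apply: integrable_norm; exact: (iI_Wadj k0 iF).
- exact: (iI_Wadj k0 iF).
Qed.

Lemma intT_Wadj k f : (0 < k)%N -> L1 f -> intT (Wadj k f) = intT f.
Proof.
move=> k0 [fr fi]; congr Complex.
- exact: (@Rint_Wadj k (fun z => Re (f z))).
- exact: (@Rint_Wadj k (fun z => Im (f z))).
Qed.

Lemma measurable_circ_Wadj k f : (0 < k)%N -> measurable_circ f -> measurable_circ (Wadj k f).
Proof.
move=> k0 [fr fi]; split.
- exact: (@mI_Wadj k (fun z => Re (f z))).
- exact: (@mI_Wadj k (fun z => Im (f z))).
Qed.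

Lemma L2_Wadj k f : (0 < k)%N -> L2 f -> L2 (Wadj k f).
Proof.
move=> k0 [mf fi]; split; first exact: measurable_circ_Wadj.
exact: (@iI_Wadj k (fun z => normc (f z) ^+ 2)).
Qed.

Lemma ip_Wadj k f g : (0 < k)%N -> L2 f -> L2 g ->
  innerp (Wadj k f) (Wadj k g) = innerp f g.
Proof. by move=> k0 Lf Lg; rewrite -[RHS](intT_Wadj k0)//; exact: L2_L1M. Qed.

End Power.

(** * Fourier coefficients and the Hardy space *)

Section Spectrum.
Context {R : realType}.
Implicit Types (t : R) (z w c : R[i]) (f g h u v a : cfun R) (n m : int) (A B : set (cfun R)).
Local Notation mu := (@lebesgue_measure R).
Local Notation Re := complex.Re.
Local Notation Im := complex.Im.
Local Notation normc := ComplexField.Normc.normc.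

Lemma Rint_cos2pi : \int[mu]_(t in unitI) cos (2 * pi * t : R) = 0.
Proof.
pose l : R := 2 * pi; have l0 : l != 0 by rewrite mulf_neq0// gt_eqF// pi_gt0.
have dF t : is_derive t 1 (fun t => l^-1 * sin (l * t)) (cos (l * t)).
  apply: is_derive_eq; rewrite /GRing.scale /=; by field.
have cc : continuous (fun t => cos (l * t)).
  move=> t; apply: continuous_comp; last exact: continuous_cos.
  by apply: continuousM; [exact: cvg_cst|exact: cvg_id].
have cF : continuous (fun t => l^-1 * sin (l * t)).
  move=> t; apply: differentiable_continuous; apply/derivable1_diffP.
  exact: (@ex_derive _ _ _ _ _ _ _ (dF t)).
have := @continuous_FTC2 R (fun t => cos (l * t)) (fun t => l^-1 * sin (l * t)) 0 1 ltr01.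
rewrite /Rintegral /unitI => ->.
- rewrite mulr0 sin0 mulr0 mulr1 /l (_ : 2 * pi = 0 + pi *+ 2) ?sinD2pi ?sin0 ?mulr0 ?subee//.
  by rewrite add0r mulr_natl.
- exact: continuous_subspaceT.
- split; first by move=> t _; exact: (@ex_derive _ _ _ _ _ _ _ (dF t)).
  + exact: cvg_at_right_filter (cF 0).
  + exact: cvg_at_left_filter (cF 1).
- by move=> t _; rewrite derive1E; exact: derive_val.
Qed.

Lemma Rint_sin2pi : \int[mu]_(t in unitI) sin (2 * pi * t : R) = 0.
Proof.
pose l : R := 2 * pi; have l0 : l != 0 by rewrite mulf_neq0// gt_eqF// pi_gt0.
have dF t : is_derive t 1 (fun t => - l^-1 * cos (l * t)) (sin (l * t)).
  apply: is_derive_eq; rewrite /GRing.scale /=; by field.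
have cc : continuous (fun t => sin (l * t)).
  move=> t; apply: continuous_comp; last exact: continuous_sin.
  by apply: continuousM; [exact: cvg_cst|exact: cvg_id].
have cF : continuous (fun t => - l^-1 * cos (l * t)).
  move=> t; apply: differentiable_continuous; apply/derivable1_diffP.
  exact: (@ex_derive _ _ _ _ _ _ _ (dF t)).
have := @continuous_FTC2 R (fun t => sin (l * t)) (fun t => - l^-1 * cos (l * t)) 0 1 ltr01.
rewrite /Rintegral /unitI => ->.
- rewrite mulr0 cos0 !mulr1 /l (_ : 2 * pi = 0 + pi *+ 2) ?cosD2pi ?cos0 ?mulr1 ?subee//.
  by rewrite add0r mulr_natl.
- exact: continuous_subspaceT.
- split; first by move=> t _; exact: (@ex_derive _ _ _ _ _ _ _ (dF t)).
  + exact: cvg_at_right_filter (cF 0).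
  + exact: cvg_at_left_filter (cF 1).
- by move=> t _; rewrite derive1E; exact: derive_val.
Qed.

Lemma L2_L1 f : L2 f -> L1 f.
Proof.
move=> Lf; apply: cc_L1 (L2_L1M Lf (L2_cst 1)) => t.
by rewrite (rmorph1 (@conjc R)) mulr1.
Qed.

Lemma intTX n : intT (fun z : R[i] => z ^ n) = (n == 0)%:R.
Proof.
have pos k : intT (fun z : R[i] => z ^+ k.+1) = 0.
  (* z^(k+1) is z composed with a power map, and the integral is invariant under this composition:
     one frequency suffices. *)
  rewrite -[LHS]/(intT (Wadj k.+1 (fun z : R[i] => z))) intT_Wadj//.
    by rewrite /intT /circ /= Rint_cos2pi Rint_sin2pi.
  apply: cc_L1 (L2_L1 (L2X 1)) => t; exact: expr1z.
case: n => [[|k]|k].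
- by rewrite -[RHS](@intT_cst R); apply: cc_intT => t; rewrite expr0z.
- exact: pos.
- rewrite (@cc_intT _ _ (fun z => conjc (z ^ Posz k.+1))); last first.
    by move=> t; rewrite conj_circ NegzE.
  by rewrite intTJ ?pos ?conjc0//; exact: L2_L1 (L2X k.+1).
Qed.

Lemma ipX n m : innerp (fun z : R[i] => z ^ n) (fun z => z ^ m) = (n == m)%:R.
Proof.
rewrite -subr_eq0 -intTX; apply: cc_intT => t.
by rewrite conj_circ circ_exprD.
Qed.

Lemma fourierX n m : fourier (fun z : R[i] => z ^ n) m = (n == m)%:R.
Proof. exact: ipX. Qed.

Lemma ipMr u f g : innerp f (fun z => u z * g z) = innerp (fun z => conjc (u z) * f z) g.
Proof. by apply: cc_intT => t; rewrite conjcM mulrA [f _ * _]mulrC. Qed.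

Lemma fourierMX n m f : fourier (fun z => z ^ n * f z) m = fourier f (m - n).
Proof.
apply: cc_intT => t; rewrite !conj_circ opprB circ_exprD.
by rewrite mulrA [f _ * _]mulrC.
Qed.

Lemma fourierD f g n : L2 f -> L2 g ->
  fourier (fun z => f z + g z) n = fourier f n + fourier g n.
Proof. by move=> Lf Lg; apply: ipDl => //; exact: L2X. Qed.

Lemma fourierB f g n : L2 f -> L2 g ->
  fourier (fun z => f z - g z) n = fourier f n - fourier g n.
Proof. by move=> Lf Lg; apply: ipBl => //; exact: L2X. Qed.

Lemma fourierZ c f n : L2 f -> fourier (fun z => c * f z) n = c * fourier f n.
Proof. by move=> Lf; apply: ipZl => //; exact: L2X. Qed.

Lemma fourierJ f n : L2 f -> fourier (fun z => conjc (f z)) n = conjc (fourier f (- n)).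
Proof.
move=> Lf; rewrite /fourier -ipC//; last exact: L2X.
apply: cc_intT => t.
by rewrite conj_circ mulrC.
Qed.

Lemma fourier_eqT f g n : L2 f -> L2 g -> eqT f g -> fourier f n = fourier g n.
Proof. by move=> Lf Lg fg; apply: ip_eqT => //; [exact: L2X|exact: L2X|exact: eqT_refl]. Qed.

Lemma fourier_cc f g n : cc f g -> fourier f n = fourier g n.
Proof. by move=> fg; apply: ip_cc. Qed.

Lemma ip_sumr k (F : 'I_k -> cfun R) g : (forall i, L2 (F i)) -> L2 g ->
  innerp (fun z => \sum_(i < k) F i z) g = \sum_(i < k) innerp (F i) g.
Proof.
move=> LF Lg; elim: k F LF => [|k ih] F LF.
  by rewrite big_ord0 -[RHS](ip0l g); apply: ip_cc => // t; rewrite big_ord0.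
rewrite big_ord_recl -ih// -ipDl//; last exact: L2_sum.
by apply: ip_cc => // t; rewrite big_ord_recl.
Qed.

Definition tpoly k (c : nat -> R[i]) : cfun R := fun z => \sum_(j < k) c j * z ^ (j : int).

Lemma L2_tpoly k (c : nat -> R[i]) : L2 (tpoly k c).
Proof. by apply: L2_sum => i; apply: L2Z; exact: L2X. Qed.

Lemma Linfty_tpoly k (c : nat -> R[i]) : Linfty (tpoly k c).
Proof.
rewrite /tpoly; elim: k => [|k ih].
  have [m0 [M HM]] := Linfty_cst (0 : R[i]); split.
    by apply: cc_measurableT m0 => t; rewrite big_ord0.
  by exists M; apply: aeS HM => t h /h; rewrite big_ord0.
have [m0 [M HM]] := LinftyD ih (LinftyM (Linfty_cst (c k)) (LinftyX k)); split.
  by apply: cc_measurableT m0 => t; rewrite big_ord_recr.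
by exists M; apply: aeS HM => t h /h; rewrite big_ord_recr.
Qed.

Lemma ip_tpolyl k (c : nat -> R[i]) g : L2 g ->
  innerp (tpoly k c) g = \sum_(j < k) c j * innerp (fun z => z ^ (j : int)) g.
Proof.
move=> Lg; rewrite /tpoly ip_sumr//; last by move=> i; apply: L2Z; exact: L2X.
by apply: eq_bigr => i _; rewrite ipZl//; exact: L2X.
Qed.

Lemma fourier_tpoly k (c : nat -> R[i]) (m : nat) : fourier (tpoly k c) m = if (m < k)%N then c m else 0.
Proof.
rewrite /fourier ip_tpolyl; last exact: L2X.
under eq_bigr do rewrite ipX eqz_nat.
case: ltnP => mk.
  rewrite (bigD1 (Ordinal mk))//= eqxx mulr1 big1 ?addr0// => i im.
  by rewrite (negbTE (_ : i != m :> nat)) ?mulr0//; apply: contra im => /eqP e; apply/eqP/val_inj.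
rewrite big1// => i _; rewrite (_ : (i == m :> nat) = false) ?mulr0//.
by apply/negbTE; rewrite neq_ltn (leq_trans (ltn_ord i)).
Qed.

Lemma fourier_tpoly_lt0 k (c : nat -> R[i]) n : n < 0 -> fourier (tpoly k c) n = 0.
Proof.
move=> n0; rewrite /fourier ip_tpolyl; last exact: L2X.
rewrite big1// => i _; rewrite ipX (_ : (_ == _) = false) ?mulr0//.
by apply/negbTE; rewrite gt_eqF// (lt_le_trans n0).
Qed.

Lemma eqT0_fourier f : L2 f -> (forall n, fourier f n = 0) -> eqT f (fun=> 0).
Proof. by move=> /L2_L1; exact: fourier_unique. Qed.

Lemma eqT_sub0 f g : eqT (fun z => f z - g z) (fun=> 0) -> eqT f g.
Proof. by apply: aeS => t + It => /(_ It) /eqP; rewrite subr_eq0 => /eqP. Qed.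

Lemma csub_spectrum (I : int -> Prop) :
  csub (@L2 R `&` [set f | forall n, ~ I n -> fourier f n = 0]).
Proof.
have := @csub_orth R _ [set h | exists2 n, ~ I n & h = fun z => z ^ n] (@csub_L2_self R).
rewrite (_ : [set f | forall h, _] = [set f | forall n, ~ I n -> fourier f n = 0]).
  by apply => _ [n _ ->]; exact: L2X.
apply/seteqP; split => f /= H.
  by move=> n In; apply: H; exists n.
by move=> _ [n In ->]; exact: H.
Qed.

(** Density of trigonometric polynomials without approximation: f minus its projection onto the
    members of A with spectrum in I has zero coefficients, on I by orthogonality to z^n and off I by
    the spectral condition. *)
Lemma spectral_ind (I : int -> Prop) A f : csub A -> L2 f ->
  (forall n, ~ I n -> fourier f n = 0) ->
  (forall n, I n -> A (fun z => z ^ n)) -> A f.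
Proof.
move=> cA Lf fI AX; have cB := csubI cA (csub_spectrum I).
have BX n : I n -> (A `&` (@L2 R `&` [set f | forall n, ~ I n -> fourier f n = 0]))
    (fun z => z ^ n).
  move=> In; split; first exact: AX.
  split; first exact: L2X.
  move=> m Im; rewrite fourierX (_ : (n == m) = false)//.
  by apply/negbTE/eqP => nm; apply: Im; rewrite -nm.
have [g [Ag [Lg gI]] gP] := projection_exists cB Lf.
apply: (csub_eqT cA Ag Lf); apply: eqT_sym; apply: eqT_sub0.
apply: eqT0_fourier; first exact: L2B.
move=> n; have [In|In] := pselect (I n); first exact: gP _ (BX _ In).
by rewrite fourierB// fI// gI// subrr.
Qed.

(** This replaces Parseval's formula: f lies in the closed span of those z^n at which g has
    coefficient 0, all of them orthogonal to g. *)
Lemma ip_disjoint f g : L2 f -> L2 g ->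
  (forall n, fourier f n = 0 \/ fourier g n = 0) -> innerp f g = 0.
Proof.
move=> Lf Lg H.
have [] // : (@L2 R `&` [set f | innerp f g = 0]) f.
apply: (@spectral_ind (fun n => fourier g n = 0)) => //.
- exact: csub_orth1 (@csub_L2_self R) Lg.
- by move=> n gn; case: (H n).
- move=> n gn; split; first exact: L2X.
  rewrite /= ipC//; last exact: L2X.
  by rewrite -/(fourier g n) gn conjc0.
Qed.

Lemma csub_H2 : csub (@H2 R).
Proof.
have := csub_spectrum (fun n => 0 <= n).
rewrite (_ : _ `&` _ = @H2 R)//.
apply/seteqP; split => f [Lf H]; split => // n n0; apply: H.
  by apply/negP; rewrite -ltNge.
by rewrite ltNge; apply/negP.
Qed.

Lemma H2_L2 f : H2 f -> L2 f. Proof. by case. Qed.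

Lemma H2_lt0 f n : H2 f -> n < 0 -> fourier f n = 0. Proof. by case=> _; apply. Qed.

Lemma H2X (n : nat) : H2 (fun z : R[i] => z ^ (n : int)).
Proof.
split; first exact: L2X.
move=> m m0; rewrite fourierX (_ : (_ == _) = false)//.
by apply/negbTE; rewrite gt_eqF// (lt_le_trans m0).
Qed.

Lemma H2_tpoly k (c : nat -> R[i]) : H2 (tpoly k c).
Proof. by split; [exact: L2_tpoly|move=> n; exact: fourier_tpoly_lt0]. Qed.

Lemma H2_cc f g : H2 f -> cc f g -> H2 g.
Proof. by move=> Hf; exact: csub_cc csub_H2 Hf. Qed.

Lemma H2_eqT f g : H2 f -> L2 g -> eqT f g -> H2 g.
Proof. by move=> Hf; exact: csub_eqT csub_H2 Hf. Qed.

Lemma H2MX (k : nat) f : H2 f -> H2 (fun z => z ^ (k : int) * f z).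
Proof.
move=> [Lf f0]; split; first exact: L2MX.
by move=> n n0; rewrite fourierMX f0// subr_lt0 (lt_le_trans n0).
Qed.

(** For n < 0 the coefficient is <f, conj(u) z^n>, and conj(u) z^n has no coefficient at m >= 0. *)
Lemma H2M u f : Hinfty u -> H2 f -> H2 (fun z => u z * f z).
Proof.
move=> [[Lu u0] uoo] [Lf f0]; split; first exact: L2M.
move=> n n0; rewrite /fourier ipM; apply: ip_disjoint => //.
  by apply: L2M; [exact: LinftyJ|exact: L2X].
move=> m; have [m0|m0] := ltP m 0; first by left; exact: f0.
right; rewrite (@fourier_cc _ (fun z => z ^ n * conjc (u z))); last by move=> t; rewrite mulrC.
rewrite fourierMX fourierJ// opprB u0 ?conjc0//.
by rewrite subr_lt0 (lt_le_trans n0).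
Qed.

Lemma ip_H2_conj f g : H2 f -> L2 g -> (forall n, 0 <= n -> fourier g n = 0) -> innerp f g = 0.
Proof.
move=> [Lf f0] Lg g0; apply: ip_disjoint => // n.
by have [n0|n0] := ltP n 0; [left; exact: f0|right; exact: g0].
Qed.

Lemma riesz_projection f : L2 f -> exists2 g, H2 g &
  forall n, 0 <= n -> fourier (fun z => f z - g z) n = 0.
Proof.
move=> Lf; have [g Hg gP] := projection_exists csub_H2 Lf.
exists g => // -[n|//] _; exact: gP _ (H2X n).
Qed.

End Spectrum.

(** * Model spaces and the compressed shift *)

Section Model.
Context {R : realType}.
Implicit Types (t : R) (z w c : R[i]) (f g h u v a b : cfun R) (A B : set (cfun R)).
Local Notation mu := (@lebesgue_measure R).
Local Notation normc := ComplexField.Normc.normc.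

Lemma inner_Hinfty a : is_inner a -> Hinfty a. Proof. by case. Qed.
Lemma inner_H2 a : is_inner a -> H2 a. Proof. by move=> [[]]. Qed.
Lemma inner_Linfty a : is_inner a -> Linfty a. Proof. by move=> [[]]. Qed.
Lemma inner_L2 a : is_inner a -> L2 a. Proof. by move=> /inner_H2/H2_L2. Qed.

Lemma inner_conj a : is_inner a -> eqT (fun z => a z * conjc (a z)) (fun=> 1).
Proof. by move=> [_]; apply: aeS => t + It => /(_ It) /= h; exact: normc1_conj. Qed.

Lemma inner_intro a : H2 a ->
  {ae mu, forall t, unitI t -> normc (a (circ t)) = 1} -> is_inner a.
Proof.
move=> Ha a1; split => //; split => //; split; first exact: L2_measurableT (H2_L2 Ha).
by exists 1; apply: aeS a1 => t h /h ->.
Qed.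

Lemma innerM a b : is_inner a -> is_inner b -> is_inner (fun z => a z * b z).
Proof.
move=> ia ib; apply: inner_intro; first exact: H2M (inner_Hinfty ia) (inner_H2 ib).
case: ia ib => _ + [_]; apply: aeS2 => t + + It => /(_ It) a1 /(_ It) b1.
by rewrite ComplexField.Normc.normcM a1 b1 mulr1.
Qed.

Lemma L2_inner a f : is_inner a -> L2 f -> L2 (fun z => a z * f z).
Proof. by move=> /inner_Linfty; exact: L2M. Qed.

Lemma L2_innerJ a f : is_inner a -> L2 f -> L2 (fun z => conjc (a z) * f z).
Proof. by move=> /inner_Linfty/LinftyJ; exact: L2M. Qed.

Lemma H2_inner a f : is_inner a -> H2 f -> H2 (fun z => a z * f z).
Proof. by move=> /inner_Hinfty; exact: H2M. Qed.

Lemma inner_cancel a f : is_inner a -> eqT (fun z => conjc (a z) * (a z * f z)) f.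
Proof.
move=> [_]; apply: aeS => t + It => /(_ It) h.
by rewrite /= mulrA [conjc _ * _]mulrC normc1_conj// mul1r.
Qed.

Lemma ip_inner a f g : is_inner a -> L2 f -> L2 g ->
  innerp (fun z => a z * f z) (fun z => a z * g z) = innerp f g.
Proof.
move=> ia Lf Lg; rewrite ipM; apply: ip_eqT => //.
- by apply: L2_innerJ => //; exact: L2_inner.
- exact: eqT_refl.
- exact: inner_cancel.
Qed.

Lemma csub_K a : is_inner a -> csub (Kspace a).
Proof.
move=> ia; have := @csub_orth R _ [set f | exists2 h, H2 h & f = fun z => a z * h z] (@csub_H2 R).
rewrite (_ : _ `&` _ = Kspace a).
  by apply => _ [h Hh ->]; apply: L2_inner => //; exact: H2_L2.
apply/seteqP; split => f [Hf H]; split => //.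
  by move=> h Hh; apply: H; exists h.
by move=> _ [h Hh ->]; exact: H.
Qed.

Lemma K_H2 a f : Kspace a f -> H2 f. Proof. by case. Qed.
Lemma K_L2 a f : Kspace a f -> L2 f. Proof. by move=> /K_H2/H2_L2. Qed.

(** The quotient [l] is the Riesz projection of conj(a) f; what is left of conj(a) f has negative
    spectrum, so a times it is orthogonal to a H2. *)
Lemma K_decomp a f : is_inner a -> H2 f ->
  exists k l : cfun R, [/\ Kspace a k, H2 l & forall z, f z = k z + a z * l z].
Proof.
move=> ia Hf; have Lf := H2_L2 Hf; have Lcf := L2_innerJ ia Lf.
have [n Hn nP] := riesz_projection Lcf.
exists (fun z => f z - a z * n z), n; split => //; last by move=> z; rewrite subrK.
split; first exact: csubB csub_H2 Hf (H2_inner ia Hn).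
move=> h Hh; have Lh := H2_L2 Hh; have Ln := H2_L2 Hn.
rewrite ipBl//; try exact: L2_inner.
rewrite ip_inner// ipMr -ipBl// ipC//; last exact: L2B.
by rewrite (ip_H2_conj Hh (L2B Lcf Ln))// conjc0.
Qed.

Lemma orth_projP A f : csub A -> L2 f -> A (orth_proj A f) /\
  forall h, A h -> innerp (fun z => f z - orth_proj A f z) h = 0.
Proof.
move=> cA Lf; have [g Ag gP] := projection_exists cA Lf.
have /(xgetPex (fun=> 0)) := ex_intro (fun g => A g /\ forall h, A h -> innerp (fun z => f z - g z) h = 0) g (conj Ag gP).
by case.
Qed.

Lemma ip_orth_proj A f h : csub A -> L2 f -> A h ->
  innerp (orth_proj A f) h = innerp f h.
Proof.
move=> cA Lf Ah; have [Ap pP] := orth_projP cA Lf.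
by apply/eqP; rewrite eq_sym -subr_eq0 -ipBl ?pP//; exact: csub_L2 cA _.
Qed.

Definition bshift (k : nat) f : cfun R :=
  fun z => z ^ (- (k : int)) * (f z - tpoly k (fun j => fourier f j) z).

Lemma L2_bshift k f : L2 f -> L2 (bshift k f).
Proof. by move=> Lf; apply: L2MX; apply: L2B => //; exact: L2_tpoly. Qed.

Lemma fourier_bshift k f n : L2 f -> 
  fourier (bshift k f) n = fourier f (n + k) - fourier (tpoly k (fun j => fourier f j)) (n + k).
Proof.
by move=> Lf; rewrite /bshift fourierMX opprK fourierB//; exact: L2_tpoly.
Qed.

Lemma fourier_bshift_nat k f (n : nat) : L2 f -> fourier (bshift k f) n = fourier f (n + k)%N.
Proof.
move=> Lf; rewrite fourier_bshift// -PoszD fourier_tpoly.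
by rewrite ltnNge leq_addl subr0.
Qed.

Lemma H2_bshift k f : H2 f -> H2 (bshift k f).
Proof.
move=> Hf; have Lf := H2_L2 Hf; split; first exact: L2_bshift.
move=> n n0; rewrite fourier_bshift//.
have [nk|] := ltP (n + k) 0.
  by rewrite (H2_lt0 Hf)// fourier_tpoly_lt0// subrr.
case e : (n + k) => [m|//] _; rewrite fourier_tpoly.
rewrite ifT ?subrr// -ltz_nat -e gtrDr//.
Qed.

(** Against a h, the factor z^-k moves to the right: f is orthogonal to a z^k h, and the Taylor
    polynomial has degree less than k while z^k a h starts at k. *)
Lemma K_bshift a k f : is_inner a -> Kspace a f -> Kspace a (bshift k f).
Proof.
move=> ia Kf; have [Hf fP] := Kf; have Lf := H2_L2 Hf.
split; first exact: H2_bshift.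
move=> h Hh; have Lh := H2_L2 Hh.
have Ltp : L2 (tpoly k (fun j => fourier f j)) by exact: L2_tpoly.
rewrite /bshift ipM.
rewrite (@ip_cc _ _ (fun z => f z - tpoly k (fun j => fourier f j) z) _ (fun z => a z * (z ^ (k : int) * h z)))//; last first.
  by move=> t; rewrite conj_circ opprK mulrCA.
rewrite ipBl//; last by apply: L2_inner => //; exact: L2MX.
rewrite fP ?sub0r; last exact: H2MX.
rewrite ip_disjoint ?oppr0//; first by apply: L2_inner => //; exact: L2MX.
move=> n; have [n0|n0] := ltP n k; last first.
  left; move: n0; case: n => [n|//] nk; rewrite fourier_tpoly ltnNge.
  by rewrite -lez_nat nk.
right; rewrite (@fourier_cc _ _ (fun z => z ^ (k : int) * (a z * h z))); last first.
  by move=> t; rewrite mulrCA.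
rewrite fourierMX (H2_lt0 (H2_inner ia Hh))//.
by rewrite subr_lt0.
Qed.

Lemma eqT_bshift k f g : L2 f -> L2 g -> eqT f g -> eqT (bshift k f) (bshift k g).
Proof.
move=> Lf Lg fg; rewrite /bshift.
rewrite (_ : tpoly k _ = tpoly k (fun j => fourier g j)); last first.
  by congr tpoly; apply/funext => j; exact: fourier_eqT.
by apply: aeS fg => t + It => /(_ It) /= ->.
Qed.

Lemma bshiftS k f : L2 f -> cc (bshift 1 (bshift k f)) (bshift k.+1 f).
Proof.
move=> Lf t; rewrite {1}/bshift /tpoly big_ord1 fourier_bshift_nat// add0n.
rewrite {1}/bshift [RHS]/bshift /tpoly big_ord_recr /= expr0z mulr1.
rewrite [_ - (_ + _)](_ : _ = f (circ t) - \sum_(i < k) fourier f i * circ t ^ (i : int) -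
  fourier f k * circ t ^ (k : int)); last by rewrite opprD addrA.
rewrite -[k.+1]addn1 PoszD opprD circ_exprD.
have e : circ t ^ (- (k : int)) * circ t ^ (k : int) = 1.
  by rewrite -circ_exprD addNr expr0z.
move: e; set D := f _ - _; set x := circ t ^ (- _); set y := circ t ^ (- _); set q := circ t ^ _ => e.
transitivity (y * (x * D) - y * fourier f k * (x * q)); last by ring.
by rewrite e; ring.
Qed.

Lemma bshift0 f : cc (bshift 0 f) f.
Proof. by move=> t; rewrite /bshift /tpoly big_ord0 expr0z mul1r subr0. Qed.

(** Two solutions of the adjoint identity differ by an element of A orthogonal to A, so any explicit
    solution identifies the chosen one up to [eqT]. *)
Lemma adjoint_onP A T f g : csub A -> A g -> (forall h, A h -> innerp (T h) f = innerp h g) ->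
  A (adjoint_on A T f) /\ eqT (adjoint_on A T f) g.
Proof.
move=> cA Ag gP.
have /(xgetPex (fun=> 0)) : exists g, A g /\ forall h, A h -> innerp (T h) f = innerp h g.
  by exists g.
rewrite -/(adjoint_on A T f); set p := adjoint_on A T f => -[Ap pP]; split => //.
apply: eqT_sub0; have Apg := csubB cA Ap Ag; have Lpg := csub_L2 cA Apg.
apply: nsq0_eqT => //; apply: complexI; rewrite -ip_nsq rmorph0.
rewrite ipBr//; try exact: csub_L2 cA _.
by rewrite -pP// -gP// subrr.
Qed.

Lemma cshift_adjE a f : is_inner a -> Kspace a f ->
  Kspace a (cshift_adj a f) /\ eqT (cshift_adj a f) (bshift 1 f).
Proof.
move=> ia Kf; have cK := csub_K ia; have Lf := K_L2 Kf.
apply: adjoint_onP => //; first exact: K_bshift.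
move=> h Kh; have Lh := K_L2 Kh.
have Lzh : L2 (fun z => z * h z) by apply: cc_L2 (L2MX 1 Lh) => t; rewrite expr1z.
rewrite /cshift ip_orth_proj// /bshift ipMr.
rewrite [RHS](@ip_cc _ _ (fun z => z * h z) _ (fun z => f z - tpoly 1 (fun j => fourier f j) z))//; last first.
  by move=> t; rewrite conj_circ opprK expr1z.
rewrite ipBr//; last exact: L2_tpoly.
rewrite (@ip_disjoint _ _ (tpoly 1 _)) ?subr0//; first exact: L2_tpoly.
move=> n; have [n0|n0] := ltP n 1; last first.
  right; move: n0; case: n => [[|n]|//] nk //; by rewrite fourier_tpoly.
left; rewrite (@fourier_cc _ _ (fun z => z ^ (1 : int) * h z)); last by move=> t; rewrite expr1z.
by rewrite fourierMX (H2_lt0 (K_H2 Kh))// subr_lt0.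
Qed.

Lemma iter_cshift_adjE a k f : is_inner a -> Kspace a f ->
  Kspace a (iter k (cshift_adj a) f) /\ eqT (iter k (cshift_adj a) f) (bshift k f).
Proof.
move=> ia Kf; have Lf := K_L2 Kf; elim: k => [|k [Kk ek]] /=.
  by split => //; apply: eqT_sym; apply: cc_eqT; exact: bshift0.
have [KS eS] := cshift_adjE ia Kk; split => //.
apply: eqT_trans eS _; apply: eqT_trans (eqT_bshift 1 (K_L2 Kk) (L2_bshift k Lf) ek) _.
exact/cc_eqT/bshiftS.
Qed.

(* The projection of [z ^ n] onto [Kspace a]; it is bounded, because the analytic
   part of conj(a) z ^ n is a polynomial. *)
Definition projX a (n : nat) : cfun R := fun z =>
  z ^ (n : int) - a z * tpoly n.+1 (fun j => conjc (fourier a (n%:Z - j%:Z))) z.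

Lemma H2_projX a n : is_inner a -> H2 (projX a n).
Proof. by move=> ia; exact: csubB csub_H2 (H2X n) (H2_inner ia (H2_tpoly _ _)). Qed.

Lemma K_projX a n : is_inner a -> Kspace a (projX a n).
Proof.
move=> ia; split; first exact: H2_projX.
move=> h Hh; have Lh := H2_L2 Hh.
rewrite /projX; set s := tpoly n.+1 _; have Ls : L2 s by exact: L2_tpoly.
rewrite ipBl//; [|exact: L2X|exact: L2_inner|exact: L2_inner].
rewrite ip_inner// ipMr -ipBl//; last by apply: L2_innerJ => //; exact: L2X.
have Lz : L2 (fun z => conjc (a z) * z ^ (n : int)) by apply: L2_innerJ => //; exact: L2X.
apply: ip_disjoint => //; first exact: L2B.
move=> m; have [m0|m0] := ltP m 0; [by right; exact: H2_lt0|left].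
rewrite fourierB//.
have -> : fourier (fun z => conjc (a z) * z ^ (n : int)) m = conjc (fourier a (n%:Z - m)).
  rewrite (@fourier_cc _ _ (fun z => z ^ (n : int) * conjc (a z))); last by move=> t; rewrite mulrC.
  by rewrite fourierMX fourierJ ?opprB//; exact: inner_L2.
case: m m0 => [m|//] _; rewrite fourier_tpoly ltnS; case: leqP => nm; first by rewrite subrr.
by rewrite (H2_lt0 (inner_H2 ia)) ?conjc0 ?subrr// subr_lt0.
Qed.

Lemma Linfty_projX a n : is_inner a -> Linfty (projX a n).
Proof.
move=> ia; have := LinftyD (LinftyX n) (LinftyM (Linfty_cst (-1)) (LinftyM (inner_Linfty ia)
  (Linfty_tpoly n.+1 (fun j => conjc (fourier a (n%:Z - j%:Z)))))).
rewrite (_ : (fun z => _) = projX a n)//; apply/funext => z.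
by rewrite mulN1r.
Qed.

Lemma Kinfty_projX a n : is_inner a -> Kinfty a (projX a n).
Proof.
move=> ia; split; first exact: K_projX.
by split; [exact: H2_projX|exact: Linfty_projX].
Qed.

(** What remains of f after projection is orthogonal to every [projX a n] and, being in the model
    space, to a H2, hence to their sum z^n. As the [projX a n] are bounded, this also yields the
    density of [Kinfty]. *)
Lemma K_ind a A f : is_inner a -> csub A -> (forall n, A (projX a n)) -> Kspace a f -> A f.
Proof.
move=> ia cA AX Kf; have cK := csub_K ia; have cB := csubI cA cK.
have Lf := K_L2 Kf.
have [g [Ag Kg] gP] := projection_exists cB Lf.
apply: (csub_eqT cA Ag Lf); apply: eqT_sym; apply: eqT_sub0.
have Kfg := csubB cK Kf Kg; have Lfg := K_L2 Kfg.
apply: eqT0_fourier => // n; have [n0|] := ltP n 0; first exact: H2_lt0 (K_H2 Kfg) n0.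
case: n => [n|//] _.
set s := tpoly n.+1 (fun j => conjc (fourier a (n%:Z - j%:Z))).
have Ls : L2 s by exact: L2_tpoly.
transitivity (innerp (fun z => f z - g z) (fun z => projX a n z + a z * s z)).
  by apply: ip_cc => // t; rewrite /projX subrK.
rewrite ipDr//; [|exact: H2_L2 (H2_projX n ia)|exact: L2_inner].
rewrite gP; last by split; [exact: AX|exact: K_projX].
by rewrite add0r; case: Kfg => _; apply; exact: H2_tpoly.
Qed.

End Model.

(** * Beurling's theorem and common divisors of inner functions *)

Section Beurling.
Context {R : realType}.
Implicit Types (t : R) (z w c : R[i]) (f g h u v a b m : cfun R) (A B : set (cfun R)).
Local Notation mu := (@lebesgue_measure R).
Local Notation normc := ComplexField.Normc.normc.

(** Inner functions without analyticity: multiplication is still isometric on L2, and z^-1 and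
    conj(a) b are included. *)
Definition unimodular u := Linfty u /\
  {ae mu, forall t, unitI t -> normc (u (circ t)) = 1}.

Lemma unimodular_inner u : is_inner u -> unimodular u.
Proof. by move=> iu; split; [exact: inner_Linfty|case: iu]. Qed.

Lemma unimodularX (n : int) : unimodular (fun z => z ^ n).
Proof. by split; [exact: LinftyX|apply: aeW => t _; exact: normc_circX]. Qed.

Lemma unimodularJ u : unimodular u -> unimodular (fun z => conjc (u z)).
Proof.
by move=> [/LinftyJ ? h]; split => //; apply: aeS h => t h /h; rewrite normc_conj.
Qed.

Lemma unimodularM u v : unimodular u -> unimodular v -> unimodular (fun z => u z * v z).
Proof.
move=> [uoo u1] [voo v1]; split; first exact: LinftyM.
apply: aeS2 u1 v1 => t + + It => /(_ It) h1 /(_ It) h2.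
by rewrite ComplexField.Normc.normcM h1 h2 mulr1.
Qed.

Lemma csub_mul u A : unimodular u -> csub A ->
  csub (@L2 R `&` [set f | A (fun z => u z * f z)]).
Proof.
move=> [uoo u1] cA; have [AL A0 AD Acl] := cA; split.
- by move=> f [].
- split; first exact: L2_cst.
  by apply: (csub_cc cA A0) => t; rewrite mulr0.
- move=> c f g [Lf Af] [Lg Ag]; split; first by apply: L2D => //; exact: L2Z.
  by apply: (csub_cc cA (AD c _ _ Af Ag)) => t; rewrite mulrDr mulrCA.
- move=> g Lg H; split => //=; apply: Acl => [|e e0]; first exact: L2M.
  have [f [Lf Af] fe] := H e e0; exists (fun z => u z * f z) => //.
  rewrite (@cc_nsq _ _ (fun z => u z * (f z - g z))); last by move=> t; rewrite mulrBr.
  by rewrite -sqr_norm2 norm2M_inner ?sqr_norm2//; exact: L2B.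
Qed.

Lemma eqT_or_nsq f : L2 f -> eqT f (fun=> 0) \/ 0 < nsq f.
Proof.
move=> Lf; have [f0|f0] := eqVneq (nsq f) 0; [left; exact: nsq0_eqT|right].
by rewrite lt_neqAle eq_sym f0 nsq_ge0.
Qed.

(** [d] is a unit vector of N orthogonal to z N. It exists because N = z N would make every element
    of N divisible in H2 by all powers of z, hence zero. *)
Lemma wandering (N : set (cfun R)) : csub N -> N `<=` @H2 R ->
  (forall f, N f -> N (fun z => z ^ (1 : int) * f z)) ->
  (exists2 f, N f & ~ eqT f (fun=> 0)) ->
  exists d, [/\ N d, nsq d = 1 &
    forall f, N f -> innerp d (fun z => z ^ (1 : int) * f z) = 0].
Proof.
move=> cN NH Nz [g Ng g0].
(* [Z] is z N, written as a preimage under z^-1 so that [csub_mul] makes it closed. *)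
pose Z := @L2 R `&` [set f | N (fun z => z ^ (-1 : int) * f z)].
have cZ : csub Z by exact: csub_mul (unimodularX _) cN.
have cancel f : cc (fun z => z ^ (1 : int) * (z ^ (-1 : int) * f z)) f.
  by move=> t; rewrite mulrA -circ_exprD expr0z mul1r.
have cancel' f : cc (fun z => z ^ (-1 : int) * (z ^ (1 : int) * f z)) f.
  by move=> t; rewrite mulrA -circ_exprD expr0z mul1r.
have ZN f : Z f -> N f by move=> [_ Nf]; exact: csub_cc cN (Nz _ Nf) (cancel f).
have NZ f : N f -> Z (fun z => z ^ (1 : int) * f z).
  move=> Nf; split; first exact: L2MX (csub_L2 cN Nf).
  by apply: (csub_cc cN Nf) => t; rewrite cancel'.
have [f [Nf Zf]] : exists f, N f /\ ~ Z f.
  apply: contrapT => /forallNP H.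
  have {}H f : N f -> Z f by move=> Nf; apply: contrapT => Zf; exact: (H f).
  apply: g0; apply: eqT0_fourier; first exact: csub_L2 cN Ng.
  suff key (n : nat) : forall f, N f -> fourier f n = 0.
    case=> n; first exact: key.
    by apply: (H2_lt0 (NH _ Ng)); rewrite NegzE oppr_lt0.
  elim: n => [|n ih] f Nf; have [_ /=] := H _ Nf => Nzf.
    have := H2_lt0 (n := -1) (NH _ Nzf); rewrite fourierMX subrr; exact.
  by have := ih _ Nzf; rewrite fourierMX opprK -PoszD addn1.
have Lf := csub_L2 cN Nf.
have [p Zp pP] := projection_exists cZ Lf.
pose d0 z := f z - p z.
have Nd0 : N d0 by exact: csubB cN Nf (ZN _ Zp).
have Ld0 := csub_L2 cN Nd0.
have [d00|d0p] := eqT_or_nsq Ld0.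
  by exfalso; apply: Zf; apply: (csub_eqT cZ Zp Lf); apply/eqT_sym/eqT_sub0.
pose c : R[i] := ((norm2 d0)^-1)%:C%C.
exists (fun z => c * d0 z); split; first exact: csubZ.
- rewrite nsqZ// normc_real real_normK ?num_real// exprVn sqr_norm2 mulVf//.
  by rewrite gt_eqF.
- move=> h Nh; have [Lzh _] := NZ _ Nh.
  by rewrite ipZl// pP ?mulr0//; exact: NZ.
Qed.

(** Orthogonality of d to z^n d for n > 0 kills all nonconstant coefficients of |d|^2, so d is
    inner. Orthogonality of d to z^n f says that conj(d) f has no negative coefficient. *)
Lemma beurling (N : set (cfun R)) : csub N -> N `<=` @H2 R ->
  (forall f, N f -> N (fun z => z ^ (1 : int) * f z)) ->
  (exists2 f, N f & ~ eqT f (fun=> 0)) ->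
  exists d, [/\ N d, is_inner d & forall f, N f -> H2 (fun z => conjc (d z) * f z)].
Proof.
move=> cN NH Nz Nn0; have [d [Nd d1 dP]] := wandering cN NH Nz Nn0.
have Ld := csub_L2 cN Nd.
have NX (n : nat) f : N f -> N (fun z => z ^ (n : int) * f z).
  move=> Nf; elim: n => [|n ih].
    by apply: (csub_cc cN Nf) => t; rewrite expr0z mul1r.
  apply: (csub_cc cN (Nz _ ih)) => t.
  by rewrite mulrA -circ_exprD.
have dP' (n : nat) f : N f -> innerp d (fun z => z ^ (n.+1 : int) * f z) = 0.
  move=> Nf; rewrite -(dP _ (NX n _ Nf)); apply: ip_cc => // t.
  by rewrite mulrA -circ_exprD.
have L1d : L1 (fun z => d z * conjc (d z)) by exact: L2_L1M.
have L1c : L1 (fun=> - 1 : R[i]) by exact: L2_L1 (L2_cst _).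
have d1ae : eqT (fun z => d z * conjc (d z) + (- 1)) (fun=> 0).
  apply: fourier_unique => [|n]; first exact: L1D.
  have -> : fourier (fun z => d z * conjc (d z) + (- 1)) n =
      innerp d (fun z => z ^ n * d z) - (n == 0)%:R.
    rewrite -[X in _ - X]mul1r -mulNr.
    have -> : (n == 0)%:R = intT (fun z : R[i] => conjc (z ^ n)).
      rewrite intTJ; last exact: L2_L1 (L2X n).
      by rewrite intTX (rmorph_nat (@conjc R)).
    rewrite -intTZ; last exact: L1J (L2_L1 (L2X n)).
    rewrite -intTD.
    - by apply: cc_intT => t; rewrite conjcM mulrDl -mulrA [conjc (d _) * _]mulrC.
    - by apply: L2_L1M => //; exact: L2MX.
    - by apply: L1Z; exact: L1J (L2_L1 (L2X n)).
  have [n0|n0|->] := ltgtP n 0.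
  - rewrite subr0.
    have -> : innerp d (fun z => z ^ n * d z) = innerp (fun z => z ^ (- n) * d z) d.
      by rewrite ipMr; apply: ip_cc => // t; rewrite conj_circ.
    case: n n0 => // n _; rewrite NegzE opprK ipC//; last exact: L2MX.
    by rewrite dP'// conjc0.
  - by case: n n0 => // -[//|n] _; rewrite dP'// subr0.
  - rewrite (@ip_cc _ _ d _ d)//; last by move=> t; rewrite expr0z mul1r.
    by rewrite ip_nsq d1 subrr.
have id : is_inner d.
  apply: inner_intro; first exact: NH.
  apply: aeS d1ae => t + It => /(_ It) /= /eqP; rewrite subr_eq0 mulCconj => /eqP.
  by case => /eqP; rewrite sqrp_eq1 ?normc_ge0// => /eqP.
exists d; split => // f Nf; have Lf := csub_L2 cN Nf; split; first exact: L2_innerJ.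
case=> // n _.
have -> : fourier (fun z => conjc (d z) * f z) (Negz n) =
    innerp (fun z => z ^ (n.+1 : int) * f z) d.
  by apply: cc_intT => t; rewrite conj_circ NegzE opprK; ring.
by rewrite ipC ?dP' ?conjc0//; exact: L2MX.
Qed.

Lemma inner_neq0 u : is_inner u -> ~ eqT u (fun=> 0).
Proof.
move=> iu u0.
have := ip_inner iu (L2_cst 1) (L2_cst 1).
rewrite (@ip_eqT _ _ (fun=> 0) _ (fun=> 0)); try exact: L2_cst.
- rewrite ip0l ip_nsq (_ : nsq _ = 1); first by move/eqP; rewrite eq_sym oner_eq0.
  by rewrite /nsq ComplexField.Normc.normc1 expr1n Rint_cst.
- by apply: L2_inner => //; exact: L2_cst.
- by apply: L2_inner => //; exact: L2_cst.
- by apply: aeS u0 => t + It => /(_ It) /= ->; rewrite mul0r.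
- by apply: aeS u0 => t + It => /(_ It) /= ->; rewrite mul0r.
Qed.

(* The functions m in H2 such that b m is in a H2 form a closed shift-invariant
   subspace; let d be its inner generator. Then e = a / (g d) is inner, and g e
   divides both a and b, so that e is invertible in H2 by maximality of g. *)
Lemma gcd_factor (a b g m : cfun R) : is_inner a -> is_inner b -> is_gcd a b g ->
  H2 m -> H2 (fun z => conjc (a z) * (b z * m z)) ->
  exists2 h, H2 h & eqT m (fun z => a z * conjc (g z) * h z).
Proof.
move=> ia ib [[ig [q iq aq]] [_ [r ir br]] gP] Hm Ham.
pose N := @H2 R `&` (@L2 R `&` [set f | H2 (fun z => (conjc (a z) * b z) * f z)]).
have uab : unimodular (fun z => conjc (a z) * b z).
  by apply: unimodularM; [exact/unimodularJ/unimodular_inner|exact: unimodular_inner].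
have cN : csub N by apply: csubI csub_H2 (csub_mul uab csub_H2).
have NH : N `<=` @H2 R by move=> f [].
have Nz f : N f -> N (fun z => z ^ (1 : int) * f z).
  move=> [Hf [Lf Hf']]; split; first exact: (H2MX 1).
  split; first exact: L2MX.
  by apply: (H2_cc (H2MX 1 Hf')) => t; rewrite mulrCA.
(* With a = g q and b = g r, the product conj(a) b q is r. *)
have Nq : N q.
  split; first exact: inner_H2.
  split; first exact: inner_L2.
  apply: (H2_eqT (inner_H2 ir)); first exact: L2M uab.1 (inner_L2 iq).
  apply: aeS2 (aeI (inner_conj iq) (inner_conj ig)) (aeI aq br) => t [eq eg] [h1 h2] It.
  have eq1 := eq It; have eg1 := eg It; have {}h1 := h1 It; have {}h2 := h2 It.
  rewrite /= in eq1 eg1 h1 h2 *; rewrite h1 h2 conjcM.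
  set x := g _ in eg1 *; set y := q _ in eq1 *; set w := r _.
  transitivity ((x * conjc x) * (y * conjc y) * w); last by ring.
  by rewrite eq1 eg1 !mul1r.
have [d [Nd id dP]] := beurling cN NH Nz (ex_intro2 _ _ q Nq (inner_neq0 iq)).
(* Almost everywhere [e] is q / d and [eta] is b / (g e), the two cofactors of the divisibility by g
   e. *)
pose e z := conjc (d z) * q z; pose eta z := conjc (a z) * b z * d z.
have uJ u v : is_inner u -> is_inner v -> unimodular (fun z => conjc (u z) * v z).
  by move=> iu iv; apply: unimodularM; [exact/unimodularJ/unimodular_inner|exact: unimodular_inner].
have ie : is_inner e by apply: inner_intro; [exact: dP|exact: (uJ _ _ id iq).2].
have ieta : is_inner eta.
  apply: inner_intro; first by case: Nd => _ [].
  exact: (unimodularM uab (unimodular_inner id)).2.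
have ige := innerM ig ie.
have ae3 : {ae mu, forall t, unitI t -> [/\ g (circ t) * conjc (g (circ t)) = 1,
    d (circ t) * conjc (d (circ t)) = 1, a (circ t) * conjc (a (circ t)) = 1 &
    a (circ t) = g (circ t) * q (circ t)]}.
  apply: aeS2 (aeI (inner_conj ig) (inner_conj id)) (aeI (inner_conj ia) aq).
  by move=> t [h1 h2] [h3 h4] It; split; [exact: h1|exact: h2|exact: h3|exact: h4].
have ge_a : inner_dvd (fun z => g z * e z) a.
  split => //; exists d => //; apply: aeS ae3 => t h It /=; have [_ h2 _ ->] := h It.
  rewrite /e; set x := g _; set y := q _; move: h2; set w := d _ => h2.
  transitivity (x * y * (w * conjc w)); last by ring.
  by rewrite h2 mulr1.
have ge_b : inner_dvd (fun z => g z * e z) b.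
  split => //; exists eta => //; apply: aeS ae3 => t h It /=; have [_ h2 h3 h4] := h It.
  rewrite /e /eta; move: h2 h3 h4; set x := g _; set y := q _; set w := d _; set v := a _.
  move=> h2 h3 h4; transitivity ((v * conjc v) * (w * conjc w) * b (circ t)).
    by rewrite h2 h3 !mul1r.
  by rewrite {1}h4; ring.
have [_ [s is_ gs]] := gP _ ge_a ge_b.
have Hdm : H2 (fun z => conjc (d z) * m z).
  apply: dP; split => //; split; first exact: H2_L2.
  by apply: (H2_cc Ham) => t; rewrite mulrA.
(* From g = g e s, s inverts e; since d e = q, this gives d = q s and m = q s conj(d) m, where q = a
   conj(g). *)
exists (fun z => s z * (conjc (d z) * m z)); first exact: H2_inner.
apply: aeS2 ae3 gs => t h k It /=; have [h1 h2 h3 h4] := h It; have {k} := k It.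
rewrite /= /e h4; move: h1 h2; set x := g _; set y := q _; set w := d _; set v := m _; set r' := s _.
move=> h1 h2 k.
have k' : conjc w * y * r' = 1.
  transitivity ((conjc x * x) * (conjc w * y * r')); first by rewrite [conjc x * _]mulrC h1 mul1r.
  by rewrite -h1 {3}k; ring.
transitivity ((x * conjc x) * (conjc w * y * r') * v); last by ring.
by rewrite h1 k' !mul1r.
Qed.

End Beurling.

(** * The operator W_k and the intertwining relation *)

Section Operators.
Context {R : realType}.
Implicit Types (t : R) (z w c : R[i]) (f g h u v a b m : cfun R) (A B : set (cfun R)).
Local Notation mu := (@lebesgue_measure R).
Local Notation normc := ComplexField.Normc.normc.

Lemma normcB_le z w : normc (z - w) <= normc z + normc w.
Proof. by apply: le_trans (le_normcD _ _) _; rewrite normcN. Qed.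

Lemma bounded_linear_csub_ker A A' (T : cfun R -> cfun R) h : csub A -> csub A' ->
  bounded_linear A A' T -> L2 h -> exists M, 
  [/\ forall c f g, A f -> A g ->
    innerp (T (fun z => c * f z + g z)) h = c * innerp (T f) h + innerp (T g) h &
  forall f, A f -> normc (innerp (T f) h) <= M * norm2 f].
Proof.
move=> cA cA' [TA TD [M TM]] Lh; exists (M * norm2 h).
have L f : A f -> L2 (T f) by move=> /TA; exact: csub_L2.
split => [c f g Af Ag|f Af].
  have Acfg : A (fun z => c * f z + g z) by case: cA => _ _ AD _; exact: AD.
  have Lf := L _ Af; have Lg := L _ Ag.
  rewrite -ipZl// -ipDl//; last exact: L2Z.
  apply: ip_eqT => //; [exact: L|by apply: L2D => //; exact: L2Z|exact: TD|exact: eqT_refl].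
apply: le_trans (CauchySchwarz (L _ Af) Lh) _.
by rewrite mulrAC ler_wpM2r ?norm2_ge0// TM.
Qed.

(** Operators act on functions, not classes; that they respect [eqT] follows from the norm bound
    applied to a difference of norm 0. *)
Lemma bounded_linear_eqT A A' (T : cfun R -> cfun R) f g : csub A -> csub A' ->
  bounded_linear A A' T -> A f -> A g -> eqT f g -> eqT (T f) (T g).
Proof.
move=> cA cA' [TA TD [M TM]] Af Ag fg.
have L f' : A f' -> L2 (T f') by move=> /TA; exact: csub_L2.
have LTf := L _ Af; have LTg := L _ Ag.
have Ad : A (fun z => (-1) * g z + f z) by case: cA => _ _ AD _; exact: AD.
have Ld := csub_L2 cA Ad.
have n0 : norm2 (fun z => (-1) * g z + f z) = 0.
  rewrite norm2E (@eqT_nsq _ _ (fun=> 0))//; last 2 first.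
  - exact: L2_cst.
  - by apply: aeS fg => t + It => /(_ It) /= ->; rewrite mulN1r addNr.
  by rewrite /nsq ComplexField.Normc.normc0 expr0n /= Rint_cst sqrtr0.
have := TM _ Ad; rewrite n0 mulr0 => Tn.
have Tn0 : nsq (T (fun z => (-1) * g z + f z)) = 0.
  by rewrite -sqr_norm2; apply/eqP; rewrite sqrf_eq0 -(rwP eqP); apply/le_anti; rewrite Tn norm2_ge0.
have := nsq0_eqT (L _ Ad) Tn0; have := TD (-1) _ _ Ag Af.
move=> e1 e2; have := eqT_trans (eqT_sym e1) e2.
apply: aeS => t + It => /(_ It) /=; rewrite mulN1r => /eqP.
by rewrite addrC subr_eq0 => /eqP.
Qed.

Section Wk.
Variables (k : nat) (W : cfun R -> cfun R).
Hypotheses (k0 : (0 < k)%N) (isW : is_W k W).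

Lemma L2_W f : L2 f -> L2 (W f). Proof. by case: isW => -[h _ _] _; exact: h. Qed.

Lemma WadjX (n : int) : cc (Wadj k (fun z => z ^ n)) (fun z => z ^ (k%:Z * n) : R[i]).
Proof. by move=> t; rewrite /Wadj -exprz_exp. Qed.

Lemma ip_WXX (n m : int) :
  innerp (W (fun z => z ^ n)) (fun z => z ^ m) = innerp (fun z : R[i] => z ^ n) (fun z => z ^ (k%:Z * m)).
Proof.
have [_ /(_ n) WX] := isW.
rewrite ipX; case: ifPn WX => [kn|kn] WX.
  rewrite (@ip_eqT _ _ (fun z => z ^ (n %/ k)%Z) _ (fun z => z ^ m)) //; try exact: L2X.
  - rewrite ipX; congr (_%:R); congr nat_of_bool.
    have k0' : (k%:Z != 0) by rewrite eqz_nat -lt0n.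
    apply/eqP/eqP => [<-|->]; first by rewrite mulrC divzK.
    by rewrite mulKz.
  - exact: L2_W (L2X n).
  - exact: eqT_refl.
rewrite (@ip_eqT _ _ (fun=> 0) _ (fun z => z ^ m)) //; try exact: L2X.
- rewrite ip0l (_ : (n == _) = false)//; apply: contraNF kn => /eqP ->.
  exact: dvdz_mulr.
- exact: L2_W (L2X n).
- exact: L2_cst.
- exact: eqT_refl.
Qed.

Lemma norm2_Wadj g : L2 g -> norm2 (Wadj k g) = norm2 g.
Proof.
move=> Lg; congr Num.sqrt; apply: complexI.
by rewrite -[LHS]ip_nsq -[RHS]ip_nsq ip_Wadj.
Qed.

(** The case of two monomials is extended by spectral induction in f with g a monomial, and then in
    g. *)
Lemma ip_W f g : L2 f -> L2 g -> innerp (W f) g = innerp f (Wadj k g).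
Proof.
move=> Lf Lg; have cL := @csub_L2_self R.
have H1 (m : int) u : L2 u -> innerp (W u) (fun z => z ^ m) = innerp u (fun z => z ^ (k%:Z * m)).
  move=> Lu; pose l v := innerp (W v) (fun z => z ^ m) - innerp v (fun z => z ^ (k%:Z * m)).
  have [M [lD lM]] := bounded_linear_csub_ker cL cL isW.1 (L2X m).
  have cK : csub (@L2 R `&` [set v | l v = 0]).
    apply: (@csub_ker _ _ l (M + norm2 (fun z : R[i] => z ^ (k%:Z * m)))) => // [c f' g' Lf' Lg'|f' Lf'].
      rewrite /l lD// ipDl ?ipZl//; try exact: L2X; last exact: L2Z.
      by ring.
    have -> : l f' = innerp (W f') (fun z => z ^ m) - innerp f' (fun z => z ^ (k%:Z * m)) by [].
    apply: le_trans (normcB_le _ _) _; rewrite [leRHS]mulrDl; apply: lerD; first exact: lM.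
    by rewrite [leRHS]mulrC; apply: CauchySchwarz => //; exact: L2X.
  have [_ /=] : (@L2 R `&` [set v | l v = 0]) u.
    apply: (@spectral_ind _ (fun=> True)) => // n _; split; first exact: L2X.
    by rewrite /= /l ip_WXX subrr.
  by move/eqP; rewrite subr_eq0 => /eqP.
pose l v := innerp v (W f) - innerp (Wadj k v) f.
have cK : csub (@L2 R `&` [set v | l v = 0]).
  apply: (@csub_ker _ _ l (norm2 (W f) + norm2 f)) => // [c f' g' Lf' Lg'|f' Lf'].
    have LWf := L2_W Lf; have LWf' := L2_Wadj k0 Lf'; have LWg' := L2_Wadj k0 Lg'.
    rewrite /l ipDl ?ipZl//; last exact: L2Z.
    have -> : innerp (Wadj k (fun z => c * f' z + g' z)) f =
        c * innerp (Wadj k f') f + innerp (Wadj k g') f.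
      by rewrite -ipZl// -ipDl//; exact: L2Z.
    by ring.
  have -> : l f' = innerp f' (W f) - innerp (Wadj k f') f by [].
  apply: le_trans (normcB_le _ _) _; rewrite [leRHS]mulrDl; apply: lerD.
    by rewrite [leRHS]mulrC; apply: CauchySchwarz => //; exact: L2_W.
  by rewrite -(norm2_Wadj Lf') [leRHS]mulrC; apply: CauchySchwarz => //; exact: L2_Wadj.
have [_ /=] : (@L2 R `&` [set v | l v = 0]) g.
  apply: (@spectral_ind _ (fun=> True)) => // n _; split; first exact: L2X.
  rewrite /= /l (ipC (L2_W Lf) (L2X n)) H1//.
  rewrite (@ip_cc _ _ (fun z => z ^ (k%:Z * n)) f f (@WadjX n))//.
  by rewrite -ipC ?subrr//; exact: L2X.
move/eqP; rewrite subr_eq0 => /eqP e.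
by rewrite (ipC Lg (L2_W Lf)) e -ipC//; exact: L2_Wadj.
Qed.

Lemma fourier_Wadj_mul g (l : int) : L2 g -> fourier (Wadj k g) (k%:Z * l) = fourier g l.
Proof.
move=> Lg; rewrite -[RHS](ip_Wadj k0 Lg (L2X l)).
by apply: ip_cc => // t; rewrite WadjX.
Qed.

Lemma fourier_Wadj0 g (n : int) : L2 g -> ~~ (k %| n)%Z -> fourier (Wadj k g) n = 0.
Proof.
move=> Lg kn; have [_ /(_ n)] := isW; rewrite (negbTE kn) => WX.
rewrite /fourier (ipC (L2X n) (L2_Wadj k0 Lg)) -ip_W//; last exact: L2X.
rewrite (@ip_eqT _ _ (fun=> 0) _ g)//.
- by rewrite ip0l conjc0.
- exact: L2_W (L2X n).
- exact: L2_cst.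
- exact: eqT_refl.
Qed.

Lemma H2_Wadj g : H2 g -> H2 (Wadj k g).
Proof.
move=> Hg; have Lg := H2_L2 Hg; split; first exact: L2_Wadj.
move=> n n0; have [|kn] := boolP (k %| n)%Z; last exact: fourier_Wadj0.
move=> /dvdzP[l nE]; rewrite nE mulrC fourier_Wadj_mul// (H2_lt0 Hg)//.
by move: n0; rewrite nE pmulr_llt0// ltz_nat.
Qed.

Lemma inner_Wadj b : is_inner b -> is_inner (Wadj k b).
Proof.
move=> ib; apply: inner_intro; first exact: H2_Wadj (inner_H2 ib).
by case: ib => _; exact: (@ae_Wadj R k (fun z => normc (b z) = 1)).
Qed.

End Wk.

Lemma norm2_bshift k f : H2 f -> norm2 (bshift k f) <= norm2 f.
Proof.
move=> Hf; have Lf := H2_L2 Hf; set p := tpoly k (fun j => fourier f j).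
have Lp : L2 p by exact: L2_tpoly.
have Lfp : L2 (fun z => f z - p z) by exact: L2B.
have -> : norm2 (bshift k f) = norm2 (fun z => f z - p z).
  by have [uoo u1] := @unimodularX R (- k%:Z); exact: norm2M_inner.
rewrite -ler_sqr ?nnegrE ?norm2_ge0// !sqr_norm2.
rewrite [leRHS](@cc_nsq _ _ (fun z => f z - p z + p z)); last by move=> t; rewrite subrK.
rewrite (nsqD Lfp Lp) ip_disjoint ?mulr0 ?addr0 ?lerDl ?nsq_ge0//.
case=> [n|n]; last by right; exact: fourier_tpoly_lt0.
rewrite fourierB// fourier_tpoly; case: ltnP => nk; [left|right] => //.
by rewrite subrr.
Qed.

Lemma bshiftD k c f g : L2 f -> L2 g ->
  cc (bshift k (fun z => c * f z + g z)) (fun z => c * bshift k f z + bshift k g z).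
Proof.
move=> Lf Lg t; rewrite /bshift.
have -> : tpoly k (fun j => fourier (fun z => c * f z + g z) j) (circ t) =
  c * tpoly k (fun j => fourier f j) (circ t) + tpoly k (fun j => fourier g j) (circ t).
  rewrite /tpoly mulr_sumr -big_split /=; apply: eq_bigr => i _.
  by rewrite fourierD ?fourierZ ?mulrDl ?mulrA//; exact: L2Z.
ring.
Qed.

Lemma Linfty_bshift k f : Linfty f -> Linfty (bshift k f).
Proof.
move=> foo; have := LinftyM (LinftyX (- k%:Z)) (LinftyD foo (LinftyM (Linfty_cst (-1))
  (Linfty_tpoly k (fun j => fourier f j)))).
rewrite (_ : (fun z => _) = bshift k f)//; apply/funext => z.
by rewrite mulN1r.
Qed.

Lemma L2Mr u f : Linfty u -> L2 f -> L2 (fun z => f z * u z).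
Proof. by move=> uoo Lf; apply: cc_L2 (L2M uoo Lf) => t; rewrite mulrC. Qed.

Lemma ip_bshift1 f h : H2 f -> H2 h ->
  innerp (bshift 1 f) h = innerp f (fun z => z ^ (1 : int) * h z).
Proof.
move=> Hf Hh; have Lf := H2_L2 Hf; have Lh := H2_L2 Hh.
rewrite /bshift ipM.
rewrite (@ip_cc _ _ (fun z => f z - tpoly 1 (fun j => fourier f j) z) _ (fun z => z ^ (1 : int) * h z))//; last first.
  by move=> t; rewrite conj_circ opprK.
rewrite ipBl//; [|exact: L2_tpoly|exact: L2MX].
rewrite (@ip_disjoint _ (tpoly 1 _)) ?subr0//; [exact: L2_tpoly|exact: L2MX|].
move=> n; have [n0|n0] := ltP n 1; last first.
  by left; move: n0; case: n => [[|n]|//] nk //; rewrite fourier_tpoly.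
by right; rewrite fourierMX (H2_lt0 Hh)// subr_lt0.
Qed.

(** Every b g is a multiple of b plus an element of z b H2. As z h is orthogonal to z b H2, only its
    component along b has to be removed. *)
Lemma K_shift b h : is_inner b -> Kspace b h ->
  Kspace b (fun z => z ^ (1 : int) * h z - innerp (fun z => z ^ (1 : int) * h z) b * b z).
Proof.
move=> ib [Hh hP]; have Lh := H2_L2 Hh; have Lb := inner_L2 ib.
set c := innerp _ b; have Lzh : L2 (fun z => z ^ (1 : int) * h z) by exact: L2MX.
split; first by apply: csubB csub_H2 (H2MX 1 Hh) (csubZ c csub_H2 (inner_H2 ib)).
move=> g Hg; have Lg := H2_L2 Hg; have Lbg := L2_inner ib Lg.
pose g1 := bshift 1 g; have Hg1 : H2 g1 by exact: H2_bshift.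
have Lg1 := H2_L2 Hg1.
rewrite ipBl ?ipZl//; last exact: L2Z.
rewrite (@ip_cc _ _ (fun z => z ^ (1 : int) * h z) (fun z => b z * g z)
   (fun z => fourier g 0 * b z + z ^ (1 : int) * (b z * g1 z)))//; last first.
  move=> t; rewrite /g1 /bshift /tpoly big_ord1 expr0z mulr1.
  have e : circ t ^ (1 : int) * circ t ^ (- (1 : int)) = 1.
    by rewrite -circ_exprD subrr expr0z.
  rewrite mulrCA [circ t ^ 1 * _]mulrA e; ring.
rewrite ipDr//; [|exact: L2Z|by apply: L2MX; exact: L2_inner].
rewrite ipZr// -/c.
have -> : innerp (fun z => z ^ (1 : int) * h z) (fun z => z ^ (1 : int) * (b z * g1 z)) = 0.
  rewrite ipM -[RHS](hP _ Hg1); apply: ip_cc => // t.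
  by rewrite mulrA conj_circ -circ_exprD addNr expr0z mul1r.
have -> : innerp b (fun z => b z * g z) = conjc (fourier g 0).
  rewrite (@ip_cc _ _ (fun z => b z * (fun=> 1) z) _ (fun z => b z * g z))//; last first.
    by move=> t; rewrite mulr1.
  rewrite ip_inner//; last exact: L2_cst.
  rewrite /fourier -(ipC Lg (L2X 0)).
  by apply: ip_cc => // t; rewrite expr0z.
by rewrite addr0 mulrC subrr.
Qed.

Lemma K_orth_inner b f : is_inner b -> Kspace b f -> innerp f b = 0.
Proof.
move=> ib [Hf fP]; rewrite -(fP _ (H2X 0)); apply: ip_cc => // t.
by rewrite expr0z mulr1.
Qed.

Section Bounded.
Variables (k : nat) (W : cfun R -> cfun R) (a b phi : cfun R) (U : cfun R -> cfun R).
Hypotheses (k0 : (0 < k)%N) (isW : is_W k W) (ia : is_inner a) (ib : is_inner b).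
Hypotheses (Lphi : L2 phi) (extU : bounded_extension W a b phi U).

Let B := Wadj k b.
(** On the circle this is [Wadj k] of z h; the explicit factor z^k makes its spectrum visibly start
    at k. *)
Let lift h : cfun R := fun z => z ^ (k : int) * Wadj k h z.

(** Here the operator is exchanged for its symbol: boundedness of f puts [phi f] in L2, and the
    projection disappears against an element of the model space. *)
Lemma ip_U f h : Kinfty a f -> Kspace b h ->
  innerp (U f) h = innerp (fun z => phi z * f z) (Wadj k h).
Proof.
move=> Kf Kh; have [[UK _ _] UE] := extU; have [KKf [_ foo]] := Kf.
have Lpf : L2 (fun z => phi z * f z) by exact: L2Mr.
have LW := L2_W isW Lpf.
have [KP _] := orth_projP (csub_K ib) LW.
rewrite (@ip_eqT _ _ (Uop W b phi f) _ h)//.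
- by rewrite /Uop (ip_orth_proj (csub_K ib))// (ip_W k0 isW)//; exact: K_L2 Kh.
- exact: K_L2 (UK _ KKf).
- exact: K_L2 KP.
- exact: K_L2 Kh.
- exact: K_L2 Kh.
- exact: UE.
- exact: eqT_refl.
Qed.

(** z h may leave the model space, and [ip_U] does not apply to it. Its component along b is
    orthogonal to U f, and [ip_U] is applied to the rest. *)
Lemma ip_U_shift f h : Kinfty a f -> Kspace b h ->
  innerp (U f) (fun z => z ^ (1 : int) * h z) =
  innerp (fun z => phi z * f z) (lift h) -
  innerp (fun z => phi z * f z) B * innerp B (lift h).
Proof.
move=> Kf Kh; have [[UK _ _] UE] := extU; have [KKf [_ foo]] := Kf.
have Lpf : L2 (fun z => phi z * f z) by exact: L2Mr.
have KUf := UK _ KKf; have LUf := K_L2 KUf; have Lh := K_L2 Kh; have Lb := inner_L2 ib.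
have Kk := K_shift ib Kh; set c := innerp _ b in Kk.
have Lzh : L2 (fun z => z ^ (1 : int) * h z) by exact: L2MX.
rewrite [LHS](@ip_cc _ _ (U f) _ (fun z => (z ^ (1 : int) * h z - c * b z) + c * b z))//; last first.
  by move=> t; rewrite subrK.
rewrite ipDr//; [|exact: K_L2 Kk|exact: L2Z].
rewrite ipZr// (K_orth_inner ib KUf) mulr0 addr0 ip_U//.
have LB : L2 B by exact: L2_Wadj.
have Ll : L2 (lift h) by apply: L2MX; exact: L2_Wadj.
rewrite (@ip_cc _ _ (fun z => phi z * f z) _ (fun z => lift h z - c * B z))//.
rewrite ipBr//; last exact: L2Z.
rewrite ipZr// mulrC; congr (_ - _ * _).
rewrite /c -ipC// -(ip_Wadj k0)//.
Qed.

Lemma Kinfty_bshift f : Kinfty a f -> Kinfty a (bshift k f).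
Proof.
move=> [Kf [Hf foo]]; split; first exact: K_bshift.
by split; [exact: H2_bshift|exact: Linfty_bshift].
Qed.

Lemma ip_U_bshift f h : Kinfty a f -> Kspace b h ->
  innerp (U (bshift k f)) h =
  innerp (fun z => phi z * f z) (lift h) -
  \sum_(j < k) fourier f j * innerp (fun z => phi z * z ^ (j : int)) (lift h).
Proof.
move=> Kf Kh; have [KKf [_ foo]] := Kf.
have Lpf : L2 (fun z => phi z * f z) by exact: L2Mr.
have Lh := K_L2 Kh; have Ll : L2 (lift h) by apply: L2MX; exact: L2_Wadj.
rewrite ip_U//; last exact: Kinfty_bshift.
set p := tpoly k (fun j => fourier f j).
have Lpp : L2 (fun z => phi z * p z) by apply: L2Mr => //; exact: Linfty_tpoly.
have -> : \sum_(j < k) fourier f j * innerp (fun z => phi z * z ^ (j : int)) (lift h) =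
    innerp (fun z => phi z * p z) (lift h).
  rewrite (@ip_cc _ _ (fun z => \sum_(j < k) (fourier f j * (phi z * z ^ (j : int)))) _ (lift h))//; last first.
    by move=> t; rewrite /p /tpoly mulr_sumr; apply: eq_bigr => j _; rewrite mulrCA.
  rewrite ip_sumr//; last by move=> j; apply: L2Z; apply: L2Mr => //; exact: LinftyX.
  by apply: eq_bigr => j _; rewrite ipZl//; apply: L2Mr => //; exact: LinftyX.
rewrite -ipBl//; apply: cc_intT => t; rewrite /bshift /lift -/p conjcM conj_circ.
by ring.
Qed.

(** The defect [l h f] of the intertwining relation, tested against h, is a bounded functional of f
    on [Kspace a]. Its formula in terms of the symbol is available on [Kinfty], and vanishing there
    propagates by [K_ind]. *)
Lemma intertwining_iff :
  (forall f, Kspace a f ->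
     eqT (cshift_adj b (U f)) (U (iter k (cshift_adj a) f))) <->
  (forall f h, Kinfty a f -> Kspace b h ->
     \sum_(j < k) fourier f j * innerp (fun z => phi z * z ^ (j : int)) (lift h) =
     innerp (fun z => phi z * f z) B * innerp B (lift h)).
Proof.
have [Ubl _] := extU; have [UK _ _] := Ubl.
have cKa := csub_K ia; have cKb := csub_K ib.
pose l h f := innerp (U f) (fun z => z ^ (1 : int) * h z) - innerp (U (bshift k f)) h.
have lE f h : Kinfty a f -> Kspace b h -> l h f =
    \sum_(j < k) fourier f j * innerp (fun z => phi z * z ^ (j : int)) (lift h) -
     innerp (fun z => phi z * f z) B * innerp B (lift h).
  by move=> Kf Kh; rewrite /l ip_U_shift// ip_U_bshift//; ring.
have ck h : Kspace b h -> csub (Kspace a `&` [set f | l h f = 0]).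
  move=> Kh; have Lh := K_L2 Kh; have Lzh : L2 (fun z => z ^ (1 : int) * h z) by exact: L2MX.
  have [M1 [D1 B1]] := bounded_linear_csub_ker cKa cKb Ubl Lzh.
  have [M2 [D2 B2]] := bounded_linear_csub_ker cKa cKb Ubl Lh.
  (* The absolute value of [M2] is used since the norm of [bshift k f] is then enlarged to that of
     f. *)
  apply: (@csub_ker _ _ (l h) (M1 + `|M2|)) => // [c f g Kf Kg|f Kf].
    have KSf := K_bshift k ia Kf; have KSg := K_bshift k ia Kg.
    have Kc : Kspace a (fun z => c * bshift k f z + bshift k g z).
      by case: cKa => _ _ AD _; exact: AD.
    have Kc' : Kspace a (bshift k (fun z => c * f z + g z)).
      by apply: K_bshift => //; case: cKa => _ _ AD _; exact: AD.
    have e : innerp (U (bshift k (fun z => c * f z + g z))) h =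
        c * innerp (U (bshift k f)) h + innerp (U (bshift k g)) h.
      rewrite -(D2 c _ _ KSf KSg); apply: ip_eqT => //.
      - exact: K_L2 (UK _ Kc').
      - exact: K_L2 (UK _ Kc).
      - apply: (bounded_linear_eqT cKa cKb Ubl Kc' Kc).
        apply: cc_eqT; apply: bshiftD; [exact: K_L2 Kf|exact: K_L2 Kg].
      - exact: eqT_refl.
    rewrite /l e (D1 c _ _ Kf Kg) mulrBr opprD addrACA //.
  have -> : l h f = innerp (U f) (fun z => z ^ (1 : int) * h z) - innerp (U (bshift k f)) h by [].
  apply: le_trans (normcB_le _ _) _; rewrite [leRHS]mulrDl; apply: lerD; first exact: B1.
  apply: le_trans (B2 _ (K_bshift k ia Kf)) _.
  apply: le_trans (ler_wpM2r (norm2_ge0 _) (ler_norm _)) _.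
  apply: ler_wpM2l; [exact: normr_ge0|apply: norm2_bshift; exact: (K_H2 Kf)].
have ipE f h : Kspace a f -> Kspace b h ->
    innerp (cshift_adj b (U f)) h - innerp (U (iter k (cshift_adj a) f)) h = l h f.
  move=> Kf Kh; have KU := UK _ Kf; have [Kc ec] := cshift_adjE ib KU.
  have [Ki ei] := iter_cshift_adjE k ia Kf; have KS := K_bshift k ia Kf.
  have Lh := K_L2 Kh; rewrite /l; congr (_ - _).
    rewrite -(ip_bshift1 (K_H2 KU) (K_H2 Kh)); apply: ip_eqT => //.
    - exact: K_L2 Kc.
    - by apply: L2_bshift; exact: K_L2 KU.
    - exact: eqT_refl.
  apply: ip_eqT => //.
  - exact: K_L2 (UK _ Ki).
  - exact: K_L2 (UK _ KS).
  - exact: (bounded_linear_eqT cKa cKb Ubl).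
  - exact: eqT_refl.
split => [H f h Kf Kh|H f Kf].
  have [KKf _] := Kf; have KU := UK _ KKf; have [Kc _] := cshift_adjE ib KU.
  have [Ki _] := iter_cshift_adjE k ia KKf.
  apply/eqP; rewrite -subr_eq0 -lE// -ipE// subr_eq0; apply/eqP.
  apply: ip_eqT; [exact: K_L2 Kc|exact: K_L2 (UK _ Ki)|exact: K_L2 Kh|exact: K_L2 Kh|exact: H|exact: eqT_refl].
have KU := UK _ Kf; have [Kc _] := cshift_adjE ib KU.
have [Ki _] := iter_cshift_adjE k ia Kf.
have KUi := UK _ Ki; have Kd := csubB cKb Kc KUi.
(* The difference of the two sides is itself in [Kspace b] and serves as the test function h. *)
apply: eqT_sub0; apply: nsq0_eqT; first exact: K_L2 Kd.
apply: complexI; rewrite -ip_nsq ipBl; [|exact: K_L2 Kc|exact: K_L2 KUi|exact: K_L2 Kd].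
rewrite ipE// rmorph0.
have [] := @K_ind _ a _ f ia (ck _ Kd) _ Kf; last by [].
move=> n; split; first exact: K_projX.
by rewrite /= lE//; [rewrite H ?subrr//|]; exact: Kinfty_projX.
Qed.

End Bounded.

End Operators.

(** * Taylor coefficients on model spaces *)

Section Taylor.
Context {R : realType}.
Implicit Types (t : R) (z w c : R[i]) (f g h u v a b m s : cfun R) (A B : set (cfun R)).
Local Notation mu := (@lebesgue_measure R).
Local Notation normc := ComplexField.Normc.normc.

Lemma Kinfty_ind a A f : is_inner a -> csub A -> (forall g, Kinfty a g -> A g) ->
  Kspace a f -> A f.
Proof. by move=> ia cA H; apply: K_ind => // n; apply: H; exact: Kinfty_projX. Qed.

(* As [Kspace a] is stable under the backward shift, a linear relation between
   the first k Taylor coefficients becomes a recurrence for all of them, and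
   [Kspace a] would have dimension less than k. *)
Lemma taylor_free a k (x : nat -> R[i]) : is_inner a -> dim_ge k (Kspace a) ->
  (forall f, Kinfty a f -> \sum_(j < k) fourier f j * x j = 0) ->
  forall j, (j < k)%N -> x j = 0.
Proof.
move=> ia [e [Ke eP]] xP.
have cK := csub_K ia.
(* Written as orthogonality to a polynomial, the relation defines a closed subspace and so extends
   from [Kinfty]. *)
have relation f : Kspace a f -> \sum_(j < k) fourier f j * x j = 0.
  pose q := tpoly k (fun j => conjc (x j)); have Lq : L2 q by exact: L2_tpoly.
  have qE g : L2 g -> innerp g q = \sum_(j < k) fourier g j * x j.
    move=> Lg; rewrite (ipC Lq Lg) ip_tpolyl// (rmorph_sum (@conjc R)) /=.
    apply: eq_bigr => j _; rewrite conjcM conjcK -(ipC (L2X j) Lg) mulrC//.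
  move=> Kf; have [_ /=] : (@L2 R `&` [set g | innerp g q = 0]) f.
    apply: (Kinfty_ind ia) Kf; first exact: csub_orth1 (@csub_L2_self R) Lq.
    move=> g [Kg Hg]; split; first exact: K_L2 Kg.
    by rewrite /= qE; [exact: xP|exact: K_L2 Kg].
  by rewrite qE//; exact: K_L2 Kf.
move=> j0 j0k; apply/eqP; apply: contraT => xj0; exfalso.
pose P i := (i < k)%N && (x i != 0).
have exP : exists i, P i by exists j0; rewrite /P j0k.
have ubP i : P i -> (i <= k)%N by move=> /andP[/ltnW].
have [d /andP[dk xd] dmax] := ex_maxnP exP ubP.
(* d is the last index with x d nonzero: the relation for the (n - d)-fold backward shift of f
   expresses coefficient n through earlier ones. *)
have rel f : Kspace a f -> (forall j, (j < d)%N -> fourier f j = 0) -> forall n : nat, fourier f n = 0.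
  move=> Kf f0; elim/ltn_ind => n ih; have [|dn] := ltnP n d; first exact: f0.
  have Lf := K_L2 Kf.
  have := relation _ (K_bshift (n - d) ia Kf).
  rewrite (bigD1 (Ordinal dk))//= big1 ?addr0 => [|i /eqP id].
    rewrite fourier_bshift_nat// subnKC// => /eqP.
    by rewrite mulf_eq0 (negbTE xd) orbF => /eqP.
  rewrite fourier_bshift_nat//; have [lt|le] := ltnP i d.
    by rewrite ih ?mul0r// addnC -ltn_subRL subKn.
  suff -> : x i = 0 by rewrite mulr0.
  apply/eqP; apply: contraT => xi; have : (i <= d)%N by apply: dmax; rewrite /P ltn_ord.
  move=> le'; exfalso; apply: id; apply: val_inj => /=; apply/eqP.
  by rewrite eqn_leq le le'.
(* k functions against d < k conditions: some nontrivial combination of the [e i] has its first d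
   coefficients zero, hence vanishes by [rel]. *)
pose M : 'M[R[i]]_(k, d) := \matrix_(i, j) fourier (e i) j.
have kM : kermx M != 0.
  rewrite kermx_eq0 /row_free; apply: contraL dk => /eqP rk.
  by rewrite -leqNgt -rk rank_leq_col.
have [i ri] : exists i, row i (kermx M) != 0.
  apply: contrapT => /forallNP H; move/eqP: kM; apply; apply/row_matrixP => i.
  by rewrite row0; apply/eqP; move: (H i) => /negP; rewrite negbK.
set r := row i (kermx M) in ri.
have rM : r *m M = 0 by apply/sub_kermxP; exact: row_sub.
have Kr : Kspace a (fun z => \sum_(i < k) r 0 i * e i z).
  by apply: csub_sum => // l; exact: csubZ.
have r0 : forall l, r 0 l = 0.
  apply: eP; apply: eqT0_fourier; first exact: K_L2 Kr.
  case=> n; last by rewrite (H2_lt0 (K_H2 Kr)).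
  apply: rel Kr _ n => j jd; have /matrixP/(_ 0 (Ordinal jd)) := rM.
  rewrite mxE mxE => rMj; rewrite -[RHS]rMj /fourier ip_sumr; last exact: L2X.
    apply: eq_bigr => l _; rewrite [M _ _]mxE.
    by rewrite ipZl; [|exact: K_L2 (Ke l)|exact: L2X].
  by move=> l; apply: L2Z; exact: K_L2 (Ke l).
by move/eqP: ri; apply; apply/rowP => l; rewrite r0 mxE.
Qed.

(** As |B| = 1, the left side is the mean value of s f, which pairs coefficient j of f with
    coefficient -j of s; analyticity of f and the lower bound on the spectrum of s leave 0 <= j <
    k. *)
Lemma ip_inner_taylor (B s f : cfun R) k : is_inner B -> L2 s -> Linfty f -> H2 f ->
  (forall n : int, n <= - k%:Z -> fourier s n = 0) ->
  innerp (fun z => B z * (s z * f z)) B = \sum_(j < k) fourier f j * fourier s (- j%:Z).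
Proof.
move=> iB Ls foo Hf s0; have Lf := H2_L2 Hf.
have Lsf : L2 (fun z => s z * f z) by exact: L2Mr.
rewrite (@ip_cc _ _ (fun z => B z * (s z * f z)) _ (fun z => B z * (fun=> 1) z))//; last first.
  by move=> t; rewrite mulr1.
rewrite ip_inner//; last exact: L2_cst.
have LJs := L2J Ls; set p := tpoly k (fun j => fourier f j).
have Lp : L2 p by exact: L2_tpoly.
have -> : innerp (fun z => s z * f z) (fun=> 1) = innerp f (fun z => conjc (s z)).
  by apply: cc_intT => t; rewrite conjcK (rmorph1 (@conjc R)) mulr1 mulrC.
have -> : innerp f (fun z => conjc (s z)) = innerp p (fun z => conjc (s z)).
  apply/eqP; rewrite -subr_eq0 -ipBl//; apply/eqP; apply: ip_disjoint => //; first exact: L2B.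
  move=> n; have [kn|nk] := leP (k%:Z) n.
    by right; rewrite fourierJ// s0 ?conjc0// lerN2.
  left; rewrite fourierB//; case: n nk => n nk.
    by rewrite fourier_tpoly -ltz_nat nk subrr.
  by rewrite (H2_lt0 Hf)// fourier_tpoly_lt0// subrr.
rewrite ip_tpolyl//; apply: eq_bigr => j _; congr (_ * _).
by apply: cc_intT => t; rewrite conjcK conj_circ opprK mulrC.
Qed.

(** Because h is orthogonal to b H2, y = conj(b) z h has no positive spectrum, so v = y(z^k) lives
    on nonpositive multiples of k. On these, z^j s has at most the coefficient at 0, namely
    coefficient -j of s. *)
Lemma ip_inner_lift (W : cfun R -> cfun R) b s h k j : (j < k)%N -> is_W k W ->
  is_inner b -> L2 s -> Kspace b h ->
  (forall n : int, n <= - k%:Z -> fourier s n = 0) ->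
  innerp (fun z => Wadj k b z * (s z * z ^ (j : int))) (fun z => z ^ (k : int) * Wadj k h z) =
  fourier s (- j%:Z) * innerp (Wadj k b) (fun z => z ^ (k : int) * Wadj k h z).
Proof.
move=> jk isW ib Ls [Hh hP] s0; have k0 : (0 < k)%N by exact: leq_ltn_trans jk.
have Lh := H2_L2 Hh; have iB := inner_Wadj k0 isW ib.
set B := Wadj k b; set q := fun z => z ^ _ * Wadj k h z.
have Lq : L2 q by apply: L2MX; exact: L2_Wadj.
pose y : cfun R := fun z => conjc (b z) * (z ^ (1 : int) * h z).
have Ly : L2 y by apply: L2_innerJ => //; exact: L2MX.
have y0 (n : int) : 0 < n -> fourier y n = 0.
  case: n => // -[//|n] _; rewrite -(hP _ (H2X n)); apply: cc_intT => t.
  rewrite /y conjcM !conj_circ -[n.+1]addn1 PoszD opprD circ_exprD.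
  have e : circ t ^ (1 : int) * circ t ^ (- (1 : int)) = 1.
    by rewrite -circ_exprD subrr expr0z.
  transitivity (circ t ^ (1 : int) * circ t ^ (- (1 : int)) *
    (h (circ t) * (conjc (b (circ t)) * circ t ^ (- n%:Z)))); first by ring.
  by rewrite e mul1r.
pose v := Wadj k y; have Lv : L2 v by exact: L2_Wadj.
pose x : cfun R := fun z => z ^ (j : int) * s z.
have Lx : L2 x by exact: L2MX.
pose c := fourier s (- j%:Z); have Lc : L2 (fun=> c) by exact: L2_cst.
have -> : innerp (fun z => B z * (s z * z ^ (j : int))) q = innerp x v.
  by apply: cc_intT => t; rewrite /v /x /y /q /Wadj expr1z !conjcM conjcK -/B /B /Wadj exprnP; ring.
have -> : innerp B q = innerp (fun=> 1) v.
  by apply: cc_intT => t; rewrite /v /y /q /Wadj expr1z !conjcM conjcK /B /Wadj exprnP; ring.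
have -> : innerp x v = innerp (fun z => x z - c) v + innerp (fun=> c) v.
  rewrite -ipDl//; last exact: L2B.
  by apply: ip_cc => // t; rewrite subrK.
rewrite -ipZl//; last exact: L2_cst.
have -> : innerp (fun=> c * 1) v = innerp (fun=> c) v.
  by apply: ip_cc => // t; rewrite mulr1.
rewrite ip_disjoint ?add0r//; first exact: L2B.
have fc n : fourier (fun=> c) n = c * (0 == n)%:R.
  rewrite -fourierX -fourierZ; last exact: L2X.
  by apply: fourier_cc => t; rewrite expr0z mulr1.
move=> n; have [|kn] := boolP (k %| n)%Z; last first.
  by right; exact: (fourier_Wadj0 k0 isW Ly kn).
move=> /dvdzP[l nE]; rewrite nE mulrC.
have [l0|l0|->] := ltgtP l 0.
- left; rewrite fourierB// fc fourierMX s0.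
    rewrite (_ : (0 == _) = false) ?mulr0 ?subrr//; apply/negbTE.
    by rewrite eq_sym mulf_neq0 ?eqz_nat -?lt0n// ltr0_neq0.
  have : k%:Z * l <= - k%:Z by rewrite -mulrN1 ler_pM2l ?ltz_nat// -ltzD1 addNr.
  by apply: le_trans; rewrite gerBl.
- by right; rewrite fourier_Wadj_mul// y0.
- by left; rewrite mulr0 fourierB// fc fourierMX sub0r eqxx mulr1 subrr.
Qed.

End Taylor.

(** * Symbols of intertwining operators *)

Section Symbol.
Context {R : realType}.
Implicit Types (t : R) (z w c : R[i]) (f h u v m s : cfun R) (A : set (cfun R)).
Local Notation mu := (@lebesgue_measure R).
Local Notation normc := ComplexField.Normc.normc.

Variables (k : nat) (W : cfun R -> cfun R) (a b g phi : cfun R).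
Hypotheses (k0 : (0 < k)%N) (isW : is_W k W) (ia : is_inner a) (ib : is_inner b).
Hypotheses (gcdg : is_gcd a (Wadj k b) g) (Lphi : L2 phi).

Let B := Wadj k b.
Let iB : is_inner B. Proof. exact: (inner_Wadj k0 isW ib). Qed.
Let LB : L2 B. Proof. exact: (inner_L2 iB). Qed.
Let lift h : cfun R := fun z => z ^ (k : int) * Wadj k h z.
Let Llift h : L2 h -> L2 (lift h). Proof. by move=> Lh; apply: L2MX; exact: L2_Wadj. Qed.

Lemma conj_circ_exp t n : conjc (circ t) ^+ n = circ t ^ (- n%:Z).
Proof. by rewrite -conj_circ; exact: esym (rmorphXn (@conjc R) n _). Qed.

Lemma circ_mulVX t (n : int) : circ t ^ n * circ t ^ (- n) = 1.
Proof. by rewrite -circ_exprD subrr expr0z. Qed.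

Lemma intertwining_of_symbol (h1 h2 h3 : cfun R) : H2 h1 -> H2 h2 -> Kspace g h3 ->
  eqT phi (fun z => conjc (a z * h1 z) + conjc z ^+ k.-1 * B z * h2 z
    + conjc (a z / g z * h3 z)) ->
  forall f h, Kinfty a f -> Kspace b h ->
     \sum_(j < k) fourier f j * innerp (fun z => phi z * z ^ (j : int)) (lift h) =
     innerp (fun z => phi z * f z) B * innerp B (lift h).
Proof.
move=> Hh1 Hh2 [Hh3 _] phiE f h [Kf [Hf foo]] Kh.
have [[ig [q iq aE]] [_ [r ir bE]] _] := gcdg.
(* q is a / g, so the first and third summands of the symbol form conj(m) with m in H2, and the
   middle one is B s. *)
pose m z := a z * h1 z + q z * h3 z.
have Hm : H2 m by apply: csubD csub_H2 (H2_inner ia Hh1) (H2_inner iq Hh3).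
have Lm := H2_L2 Hm; have LJm := L2J Lm.
(* The exponent k - 1 is the largest for which the coefficients of s still vanish at all n <= -k. *)
pose s : cfun R := fun z => z ^ (- k.-1%:Z) * h2 z.
have Ls : L2 s by apply: L2MX; exact: H2_L2.
have s0 (n : int) : n <= - k%:Z -> fourier s n = 0.
  move=> nk; rewrite fourierMX (H2_lt0 Hh2)// opprK.
  by apply: le_lt_trans (lerD nk (lexx _)) _; rewrite addrC subr_lt0 ltz_nat ltn_predL.
have LBs u : Linfty u -> L2 (fun z => B z * (s z * u z)).
  by move=> uoo; apply: L2_inner => //; exact: L2Mr.
have phiE' : eqT phi (fun z => conjc (m z) + B z * s z).
  apply: eqT_trans phiE _; apply: aeS2 aE (inner_conj ig) => t + + It => /(_ It) + /(_ It) /=.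
  move=> /= aE g1; rewrite conj_circ_exp /m /s aE conjcD.
  have gn0 : g (circ t) != 0.
    by apply/eqP => g0; move: g1; rewrite g0 mul0r => /eqP; rewrite eq_sym oner_eq0.
  rewrite -addrA [_ * _ * h2 _ + _]addrC addrA; congr (_ + _); last by rewrite mulrCA mulrA.
  by congr (_ + conjc (_ * _)); rewrite mulrAC mulfV// mul1r.
have split_ip u v : Linfty u -> L2 v -> innerp (fun z => phi z * u z) v =
    innerp (fun z => conjc (m z) * u z) v + innerp (fun z => B z * (s z * u z)) v.
  move=> uoo Lv; rewrite -ipDl//; [|exact: L2Mr|exact: LBs].
  apply: ip_eqT => //; [exact: L2Mr|by apply: L2D; [exact: L2Mr|exact: LBs]| |exact: eqT_refl].
  by apply: aeS phiE' => t + It => /(_ It) /= ->; rewrite mulrDl mulrA.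
have Lf := H2_L2 Hf; have Lh := K_L2 Kh.
rewrite split_ip// (ip_inner_taylor iB Ls foo Hf s0).
(* B q = g r q = a r, so B m = a (B h1 + r h3) is in a H2, to which f is orthogonal. *)
have -> : innerp (fun z => conjc (m z) * f z) B = 0.
  rewrite ipM.
  have Hx : H2 (fun z => B z * h1 z + r z * h3 z).
    by apply: csubD csub_H2 (H2_inner iB Hh1) (H2_inner ir Hh3).
  rewrite -[RHS](Kf.2 _ Hx); apply: ip_eqT => //; last first.
  - apply: aeS2 aE bE => t + + It => /(_ It) + /(_ It) /=; rewrite -/(B (circ t)) conjcK /m.
    by move=> /= aE bE; rewrite bE aE; ring.
  - exact: eqT_refl.
  - by apply: L2_inner => //; exact: H2_L2 Hx.
  - apply: cc_L2 (L2_inner iB Lm) => t; by rewrite conjcK mulrC.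
rewrite add0r mulr_suml; apply: eq_bigr => j _.
rewrite split_ip; [|exact: LinftyX|exact: Llift].
rewrite (ip_inner_lift (ltn_ord j) isW)// -mulrA; congr (_ * _).
(* conj(m) z^j has spectrum at most j < k, whereas that of [lift h] starts at k. *)
rewrite ip_disjoint ?add0r//; [by apply: L2Mr => //; exact: LinftyX|exact: Llift|].
move=> n; have [nk|kn] := ltP n k%:Z.
  by right; rewrite /lift fourierMX (H2_lt0 (H2_Wadj k0 isW (K_H2 Kh)))// subr_lt0.
left; rewrite (@fourier_cc _ _ (fun z => z ^ (j : int) * conjc (m z))); last first.
  by move=> t; rewrite mulrC.
rewrite fourierMX fourierJ// opprB (H2_lt0 Hm) ?conjc0// subr_lt0.
by apply: lt_le_trans kn; rewrite ltz_nat.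
Qed.

(** Against b h the backward shift of b gives <b, z b h> = <1, z h> = 0. This is the test function
    that determines the constants [c j]. *)
Lemma bshift_inner_in_K : Kspace b (bshift 1 b).
Proof.
have Hb := inner_H2 ib; have Lb := H2_L2 Hb; split; first exact: H2_bshift.
move=> h Hh; have Lh := H2_L2 Hh; have Lbh := L2_inner ib Lh.
rewrite ip_bshift1//; last exact: H2_inner.
rewrite (@ip_cc _ _ (fun z => b z * (fun=> 1) z) _ (fun z => b z * (z ^ (1 : int) * h z))); last 2 first.
- by move=> t; rewrite mulr1.
- by move=> t; rewrite mulrCA.
rewrite ip_inner//; [|exact: L2_cst|exact: L2MX].
rewrite (@ip_cc _ _ (fun z => z ^ (0 : int)) _ (fun z => z ^ (1 : int) * h z)) //.
rewrite (ipC (L2MX 1 Lh) (L2X 0)) -/(fourier (fun z => z ^ (1 : int) * h z) 0).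
by rewrite fourierMX (H2_lt0 Hh) ?conjc0.
Qed.

(** Invariance under [Wadj] turns the value into <b, b - b(0)>, the squared norm of b - b(0). *)
Lemma ip_bshift_inner_neq0 : nonconstant b ->
  innerp B (lift (bshift 1 b)) != 0.
Proof.
move=> ncb; have Hb := inner_H2 ib; have Lb := H2_L2 Hb.
set p := tpoly 1 (fun j => fourier b j); have Lp : L2 p by exact: L2_tpoly.
have Lbp : L2 (fun z => b z - p z) by exact: L2B.
have -> : innerp B (lift (bshift 1 b)) = innerp b (fun z => b z - p z).
  rewrite -[RHS](ip_Wadj k0 Lb Lbp); apply: ip_cc => // t.
  have e : Wadj k (bshift 1 b) (circ t) = bshift 1 b (circ (k%:R * t)).
    by rewrite /Wadj circX.
  rewrite /lift e /bshift -/p /Wadj circX mulrA.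
  have e3 := circ_mulVX (k%:R * t) 1; rewrite expr1z in e3.
  by rewrite -[circ t ^ _]/(circ t ^+ k) circX e3 mul1r.
apply/eqP => D0; apply: ncb; exists (fourier b 0).
have p0 : innerp p (fun z => b z - p z) = 0.
  apply: ip_disjoint => // n; case: n => [[|n]|n].
  - by right; rewrite fourierB// fourier_tpoly subrr.
  - by left; rewrite fourier_tpoly.
  - by left; exact: fourier_tpoly_lt0.
apply: eqT_trans (_ : eqT b p) _.
  apply: eqT_sub0; apply: nsq0_eqT => //; apply: complexI.
  by rewrite -ip_nsq ipBl// D0 p0 subrr.
by apply: cc_eqT => t; rewrite /p /tpoly big_ord1 expr0z mulr1.
Qed.

(** In the decomposition of u along the model space and a H2, the first component is orthogonal to
    itself. *)
Lemma orth_K_factor u : H2 u -> (forall f, Kspace a f -> innerp f u = 0) ->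
  H2 (fun z => conjc (a z) * u z).
Proof.
move=> Hu uP; have Lu := H2_L2 Hu.
have [x [l [Kx Hl uE]]] := K_decomp ia Hu.
have Lx := K_L2 Kx; have Ll := H2_L2 Hl; have Lal := L2_inner ia Ll.
have x0 : eqT x (fun=> 0).
  apply: nsq0_eqT => //; apply: complexI; rewrite -ip_nsq rmorph0 -(uP _ Kx).
  rewrite [RHS](@ip_cc _ _ x _ (fun z => x z + a z * l z))//.
  by rewrite ipDr// (Kx.2 _ Hl) addr0.
apply: (H2_eqT Hl); first exact: L2_innerJ.
apply: eqT_sym; apply: eqT_trans (inner_cancel l ia).
by apply: aeS x0 => t + It => /(_ It) /= x0; rewrite uE x0 add0r.
Qed.

(* For n = q k + i, write z ^ n = z ^ i (z ^ k) ^ q and decompose z ^ q along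
   [Kspace b] and b H2. *)
Lemma fourier_neg_lift v : L2 v ->
  (forall i h, (i < k)%N -> Kspace b h ->
     innerp v (fun z => z ^ (i : int) * Wadj k h z) = 0) ->
  exists2 u, H2 u & forall n : int, 0 <= n -> fourier (fun z => v z - B z * u z) n = 0.
Proof.
move=> Lv vP; have LJv := L2_innerJ iB Lv.
have [u Hu uP] := riesz_projection LJv; exists u => //.
have Lu := H2_L2 Hu; have LBu := L2_inner iB Lu.
case=> // n _; have Ll i h : L2 h -> L2 (fun z => z ^ (i : int) * Wadj k h z).
  by move=> Lh; apply: L2MX; exact: L2_Wadj.
have [x [l [Kx Hl XE]]] := K_decomp ib (H2X (n %/ k)).
have Lx := K_L2 Kx; have Lel := H2_L2 Hl.
pose i := (n %% k)%N; have ik : (i < k)%N by rewrite ltn_mod.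
rewrite /fourier (@ip_cc _ _ (fun z => v z - B z * u z) _
  (fun z => z ^ (i : int) * Wadj k x z + B z * (z ^ (i : int) * Wadj k l z)))//; last first.
  move=> t; rewrite mulrCA -mulrDr /B /Wadj -XE -!exprnP -exprM -exprD.
  by rewrite addnC mulnC -divn_eq.
rewrite ipDr; [|exact: Ll|by apply: L2_inner => //; exact: Ll|exact: L2B].
rewrite !ipBl//; try exact: Ll; try (by apply: L2_inner => //; exact: Ll).
rewrite vP// sub0r.
have -> : innerp (fun z => B z * u z) (fun z => z ^ (i : int) * Wadj k x z) = 0.
  (* Multiplying both entries by z^(j+1) turns z^i into z^k and u into z^j times z u;
     [ip_inner_lift] then yields a factor that is coefficient -j of z u, which is 0. *)
  pose j := (k - i.+1)%N.
  have jk : (j < k)%N by rewrite /j ltn_subrL k0.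
  have Lzu : L2 (fun z => z ^ (1 : int) * u z) by exact: L2MX.
  have kE : k%:Z = j%:Z + 1 + i%:Z.
    by rewrite -!PoszD addn1 addSnnS /j subnK.
  transitivity (innerp (fun z => B z * ((z ^ (1 : int) * u z) * z ^ (j : int))) (lift x)).
    apply: cc_intT => t; rewrite /lift !conjcM !conj_circ kE !opprD !circ_exprD.
    have e1 := circ_mulVX t 1; have e2 := circ_mulVX t j.
    transitivity ((circ t ^ (1 : int) * circ t ^ (- (1 : int))) * (circ t ^ (j : int) * circ t ^ (- j%:Z)) *
      (B (circ t) * u (circ t) * (circ t ^ (- i%:Z) * conjc (Wadj k x (circ t))))).
      by rewrite e1 e2 !mul1r.
    by ring.
  rewrite (ip_inner_lift jk isW)//.
    by rewrite fourierMX (H2_lt0 Hu) ?mul0r// subr_lt0 (le_lt_trans _ ltr01)// oppr_le0.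
  move=> n' n'k; rewrite fourierMX (H2_lt0 Hu)// subr_lt0.
  by apply: le_lt_trans n'k _; rewrite (le_lt_trans _ ltr01)// oppr_le0.
rewrite oppr0 add0r ip_inner//; last exact: Ll.
rewrite ipMr -ipBl//; last exact: Ll.
have Hil : H2 (fun z => z ^ (i : int) * Wadj k l z) by apply: H2MX; exact: (H2_Wadj k0 isW).
rewrite (ipC (H2_L2 Hil)); last exact: L2B.
by rewrite (ip_H2_conj Hil) ?conjc0//; exact: L2B.
Qed.

Lemma symbol_of_intertwining : nonconstant b -> dim_ge k (Kspace a) ->
  (forall f h, Kinfty a f -> Kspace b h ->
     \sum_(j < k) fourier f j * innerp (fun z => phi z * z ^ (j : int)) (lift h) =
     innerp (fun z => phi z * f z) B * innerp B (lift h)) ->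
  exists h1 h2 h3 : cfun R,
     [/\ H2 h1, H2 h2, Kspace g h3 &
         eqT phi (fun z =>
           conjc (a z * h1 z)
           + conjc z ^+ k.-1 * B z * h2 z
           + conjc (a z / g z * h3 z))].
Proof.
move=> ncb dimK star.
have [[ig [q iq aE]] _ _] := gcdg.
have Kh0 := bshift_inner_in_K; have D0 := ip_bshift_inner_neq0 ncb.
set h0 := bshift 1 b in Kh0 D0.
pose c (j : nat) := innerp (fun z => phi z * z ^ (j : int)) (lift h0) / innerp B (lift h0).
have cf f : Kinfty a f -> innerp (fun z => phi z * f z) B = \sum_(j < k) fourier f j * c j.
  move=> Kf; apply: (mulIf D0); rewrite -star// mulr_suml; apply: eq_bigr => j _.
  by rewrite /c -mulrA divfK.
have cj h j : (j < k)%N -> Kspace b h ->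
    innerp (fun z => phi z * z ^ (j : int)) (lift h) = c j * innerp B (lift h).
  move=> jk Kh; apply/eqP; rewrite -subr_eq0; apply/eqP.
  (* Subtracting the relation rewritten with [cf] leaves sum f_j x_j = 0 on [Kinfty], the hypothesis
     of [taylor_free]. *)
  pose x (j : nat) := innerp (fun z => phi z * z ^ (j : int)) (lift h) - c j * innerp B (lift h).
  apply: (@taylor_free _ a k x) jk => // f Kf.
  rewrite /x; under eq_bigr do rewrite mulrBr mulrA.
  by rewrite sumrB star// cf// mulr_suml subrr.
pose s : cfun R := fun z => \sum_(j < k) c j * z ^ (- j%:Z).
have Ls : L2 s by apply: L2_sum => i; apply: L2Z; exact: L2X.
have fs (n : int) : fourier s n = \sum_(j < k) c j * (- j%:Z == n)%:R.
  rewrite /fourier /s ip_sumr; [|by move=> i; apply: L2Z; exact: L2X|exact: L2X].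
  by apply: eq_bigr => i _; rewrite ipZl ?ipX//; exact: L2X.
have s0 (n : int) : n <= - k%:Z -> fourier s n = 0.
  move=> nk; rewrite fs big1// => j _; rewrite (_ : (_ == _) = false) ?mulr0//.
  by apply/negbTE; rewrite gt_eqF// (le_lt_trans nk)// ltrN2 ltz_nat.
have sj j : (j < k)%N -> fourier s (- j%:Z) = c j.
  move=> jk; rewrite fs (bigD1 (Ordinal jk))//= eqxx mulr1 big1 ?addr0// => i /eqP ij.
  rewrite eqr_opp eqz_nat (_ : (_ == _) = false) ?mulr0//.
  by apply/negbTE/eqP => e; apply: ij; exact: val_inj.
pose psi z := phi z - B z * s z.
have Lpsi : L2 psi by apply: L2B => //; exact: L2_inner.
have psif f : Kinfty a f -> innerp (fun z => psi z * f z) B = 0.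
  move=> Kf; have [_ [Hf foo]] := Kf; rewrite (@ip_cc _ _ (fun z => phi z * f z - B z * (s z * f z)) _ B)//; last first.
    by move=> t; rewrite mulrBl mulrA.
  rewrite ipBl//; [|exact: L2Mr|by apply: L2_inner => //; exact: L2Mr].
  rewrite cf// (ip_inner_taylor iB Ls foo Hf s0) -sumrB big1// => j _.
  by rewrite sj ?subrr.
have psij j h : (j < k)%N -> Kspace b h -> innerp (fun z => psi z * z ^ (j : int)) (lift h) = 0.
  move=> jk Kh; have Ll := Llift (K_L2 Kh).
  rewrite (@ip_cc _ _ (fun z => phi z * z ^ (j : int) - B z * (s z * z ^ (j : int))) _ (lift h))//; last first.
    by move=> t; rewrite mulrBl mulrA.
  rewrite ipBl//; [|by apply: L2Mr => //; exact: LinftyX|].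
    by rewrite cj// (ip_inner_lift jk isW)// sj// subrr.
  by apply: L2_inner => //; apply: L2Mr => //; exact: LinftyX.
(* For j = k - i - 1 one has <v, z^i h^k> = <psi z^j, z^k h^k>: dividing by z matches the range j <
   k with the range i < k. *)
pose v : cfun R := fun z => z ^ (-1 : int) * psi z.
have Lv : L2 v by exact: L2MX.
have [i h ik Kh|u Hu uP] := @fourier_neg_lift v Lv.
  pose j := (k - i.+1)%N.
  have jk : (j < k)%N by rewrite /j ltn_subrL k0.
  have kE : k%:Z = j%:Z + 1 + i%:Z.
    by rewrite -!PoszD addn1 addSnnS /j subnK.
  rewrite -(psij _ _ jk Kh); apply: cc_intT => t.
  rewrite /lift /v !conjcM !conj_circ kE !opprD !circ_exprD.
  have e2 := circ_mulVX t j.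
  transitivity ((circ t ^ (j : int) * circ t ^ (- j%:Z)) *
    (circ t ^ (-1 : int) * psi (circ t) * (circ t ^ (- i%:Z) * conjc (Wadj k h (circ t))))).
    by rewrite e2 mul1r.
  by ring.
have Lu := H2_L2 Hu; have LBu := L2_inner iB Lu.
pose w z := v z - B z * u z; have Lw : L2 w by exact: L2B.
(* w has strictly negative spectrum; restoring the factor z allows the coefficient at 0, so the
   conjugate is a general element of H2. *)
pose r : cfun R := fun z => z ^ (1 : int) * w z; have Lr : L2 r by exact: L2MX.
pose m z := conjc (r z); have Lm : L2 m by exact: L2J.
have Hm : H2 m.
  split => // n n0; rewrite fourierJ// fourierMX uP ?conjc0//.
  by case: n n0 => // n _; rewrite NegzE opprK -[n.+1]addn1 PoszD addrK.
have psiE : cc psi (fun z => conjc (m z) + B z * (z ^ (1 : int) * u z)).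
  move=> t; rewrite /m conjcK /r /w /v mulrBr [_ * (_ * psi _)]mulrA circ_mulVX mul1r.
  by rewrite [B _ * (_ * _)]mulrCA subrK.
pose zu : cfun R := fun z => z ^ (1 : int) * u z.
have Lzu : L2 zu by exact: L2MX.
have Bm0 f : Kspace a f -> innerp f (fun z => B z * m z) = 0.
  have LBm := L2_inner iB Lm.
  move=> Kf; have [_ //] : (@L2 R `&` [set f | innerp f (fun z => B z * m z) = 0]) f.
  apply: (Kinfty_ind ia) Kf; first exact: csub_orth1 (@csub_L2_self R) LBm.
  move=> {}f Kf; have [KKf [Hf foo]] := Kf; split; first exact: H2_L2.
  rewrite /=; have := psif f Kf.
  rewrite (@ip_cc _ _ (fun z => conjc (m z) * f z + B z * (zu z * f z)) _ B)//; last first.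
    by move=> t; rewrite psiE mulrDl -[B _ * _ * _]mulrA.
  rewrite ipDl//; [|by apply: L2Mr => //; exact: L2J|by apply: L2_inner => //; exact: L2Mr].
  (* z u has no coefficient at -j for j >= 0, so the B-part of psi contributes nothing. *)
  rewrite (ip_inner_taylor (k := k) iB Lzu foo Hf); last first.
    move=> n nk; rewrite fourierMX (H2_lt0 Hu)// subr_lt0.
    by apply: le_lt_trans nk _; rewrite (le_lt_trans _ ltr01)// oppr_le0.
  rewrite [X in _ + X]big1 ?addr0 => [|j _].
    by move=> <-; apply: cc_intT => t; rewrite conjcM; ring.
  rewrite fourierMX (H2_lt0 Hu) ?mulr0// subr_lt0.
have HBm : H2 (fun z => conjc (a z) * (B z * m z)).
  by apply: orth_K_factor => //; exact: H2_inner.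
have [h Hh mE] := gcd_factor ia iB gcdg Hm HBm.
have [h3 [h1 [Kh3 Hh1 hE]]] := K_decomp ig Hh.
(* The spectrum of z u + s starts no lower than -(k - 1), so this power of z makes it analytic. *)
pose h2 : cfun R := fun z => z ^ (k.-1%:Z) * (zu z + s z).
exists h1, h2, h3; split => //.
- split; first by apply: L2MX; exact: L2D.
  move=> n n0; rewrite fourierMX fourierD// fourierMX (H2_lt0 Hu) ?add0r; last first.
    rewrite -addrA -opprD; apply: lt_trans n0; rewrite gtrDl oppr_lt0.
    by rewrite -PoszD addn1.
  rewrite s0// -ltzD1 (_ : - k%:Z + 1 = - k.-1%:Z).
    by rewrite gtrDr.
  by rewrite -[in LHS](prednK k0) -addn1 PoszD opprD addrNK.
- have phiE : cc phi (fun z => conjc (m z) + B z * (zu z + s z)).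
    move=> t; have := psiE t; rewrite /psi => /eqP; rewrite subr_eq => /eqP ->.
    by rewrite mulrDr addrA.
  apply: eqT_trans (cc_eqT phiE) _; apply: aeS2 mE (inner_conj ig) => t + + It => /(_ It) + /(_ It) /=.
  move=> /= -> g1; rewrite conj_circ_exp /h2 hE.
  have gn0 : g (circ t) != 0.
    by apply/eqP => g0; move: g1; rewrite g0 mul0r => /eqP; rewrite eq_sym oner_eq0.
  have gV : (g (circ t))^-1 = conjc (g (circ t)).
    by apply: (mulfI gn0); rewrite mulfV.
  have e : circ t ^ (- k.-1%:Z) * B (circ t) * (circ t ^ k.-1%:Z * (zu (circ t) + s (circ t))) =
      B (circ t) * (zu (circ t) + s (circ t)).
    transitivity ((circ t ^ k.-1%:Z * circ t ^ (- k.-1%:Z)) * (B (circ t) * (zu (circ t) + s (circ t)))).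
      by ring.
    by rewrite circ_mulVX mul1r.
  rewrite e gV -addrA [X in _ = _ + X]addrC addrA -conjcD; congr (conjc _ + _).
  transitivity (a (circ t) * (g (circ t) * conjc (g (circ t))) * h1 (circ t) +
    a (circ t) * conjc (g (circ t)) * h3 (circ t)); first by ring.
  by rewrite g1 mulr1.
Qed.

End Symbol.

Theorem theorem3p7 (R : realType) (k : nat) (W : cfun R -> cfun R)
    (alpha beta gamma phi : cfun R) (U : cfun R -> cfun R) :
  (0 < k)%N ->
  is_W k W ->
  is_inner alpha -> nonconstant alpha ->
  is_inner beta -> nonconstant beta ->
  is_gcd alpha (Wadj k beta) gamma ->
  dim_ge k (Kspace alpha) ->
  L2 phi ->
  bounded_extension W alpha beta phi U ->
  (forall f, Kspace alpha f ->
     eqT (cshift_adj beta (U f)) (U (iter k (cshift_adj alpha) f)))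
  <->
  (exists h1 h2 h3 : cfun R,
     [/\ H2 h1, H2 h2, Kspace gamma h3 &
         eqT phi (fun z =>
           conjc (alpha z * h1 z)
           + conjc z ^+ k.-1 * Wadj k beta z * h2 z
           + conjc (alpha z / gamma z * h3 z))]).
Proof.
move=> k0 isW ia _ ib ncb gcdg dimK Lphi extU.
rewrite (intertwining_iff k0 isW ia ib Lphi extU); split.
  exact: (symbol_of_intertwining k0 isW ia ib gcdg Lphi ncb dimK).
move=> [h1 [h2 [h3 [Hh1 Hh2 Kh3 phiE]]]] f h Kf Kh.
exact: (intertwining_of_symbol k0 isW ia ib gcdg Lphi Hh1 Hh2 Kh3 phiE Kf Kh).
Qed.
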